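(* Let $t>0$ and $\rho\in\mathbb{R}^d$ with $|\rho|=1$ be fixed, and suppose that the spatial mesh sizes $\lambda=\lambda_n>0$ satisfy $\lambda_n=o(n^{-1/4})$ as $n\to\infty$. Then the second-order spatial variation $\mathbf{V}_{\mathrm{sp}}$ satisfies $$\sqrt{n}\left(\frac{\lambda^{\beta-2}}{n}\mathbf{V}_{\mathrm{sp}}-\frac{t}{\vartheta}C_{\mathrm{sp},\mathbb{E}}\right)\xrightarrow{d}N\left(0,\frac{t^2}{\vartheta^2}C_{\mathrm{sp},\mathbb{V}}\right),\qquad n\to\infty.$$
   Context: Let $d\in\mathbb{N}$, $\beta\in(0,\min(2,d))$ and $\vartheta>0$. $u=(u(t,x))_{t\ge0,x\in\mathbb{R}^d}$ denotes the solution of the stochastic wave equation $\partial_{tt}^2u=\vartheta\Delta u+\dot W_\beta$ on $\mathbb{R}^d$ with $u(0,\cdot)=\partial_tu(0,\cdot)\equiv0$, driven by centred Gaussian noise that is white in time and has Riesz-kernel spatial covariance (proportional to $|x-y|^{-\beta}$) with spectral density $|\xi|^{\beta-d}$. That is, $u$ is the centred Gaussian process with covariance $$\mathbb{E}[u(t,x)u(s,y)]=\frac{1}{(2\pi)^d}\int_0^{t\wedge s}\int_{\mathbb{R}^d}e^{\mathrm{i}(x-y)\cdot\xi}\,\frac{\sin((t-r)\sqrt\vartheta|\xi|)}{\sqrt\vartheta|\xi|}\,\frac{\sin((s-r)\sqrt\vartheta|\xi|)}{\sqrt\vartheta|\xi|}\,|\xi|^{\beta-d}\,d\xi\,dr.$$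 Observation points: $x_k=\lambda k\rho$, $k=0,\dots,n+1$. Define $\mathbf{I}_{\mathrm{sp},k}=u(t,x_{k+1})+u(t,x_{k-1})-2u(t,x_k)$ for $k=1,\dots,n$ and $\mathbf{V}_{\mathrm{sp}}=\sum_{k=1}^n\mathbf{I}_{\mathrm{sp},k}^2$. Constants: with $g_{\mathrm{sp}}(\omega)=\sin^4(\rho\cdot\omega/2)|\omega|^{\beta-d-2}$ and $\mathcal{F}_c(f)(\xi)=\int_{\mathbb{R}^d}\cos(\xi\cdot\omega)f(\omega)\,d\omega$, $$C_{\mathrm{sp},\mathbb{E}}=\frac{8}{(2\pi)^d}\|g_{\mathrm{sp}}\|_{L^1(\mathbb{R}^d)},\qquad C_{\mathrm{sp},\mathbb{V}}=\frac{128}{(2\pi)^{2d}}\sum_{k\in\mathbb{Z}}\big(\mathcal{F}_c(g_{\mathrm{sp}})(k\rho)\big)^2.$$ *)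

(* Defs.v *)
From HB Require Import structures.
From mathcomp Require Import all_boot all_order all_algebra.
From mathcomp Require Import all_classical all_reals all_analysis.
From mathcomp Require Import complex.
Import Order.TTheory GRing.Theory Num.Theory.
Import numFieldNormedType.Exports.

Set Implicit Arguments.
Unset Strict Implicit.
Unset Printing Implicit Defensive.

Local Open Scope classical_set_scope.
Local Open Scope ring_scope.

Section measurable_rV.
Context {d : measure_display} {T : sigmaRingType d}.
Variable n : nat.

Let coors : 'I_n -> 'rV[T]_n -> T := fun i x => x ord0 i.

Let rV_set0 : g_sigma_preimage coors set0.
Proof. exact: sigma_algebra0. Qed.

Let rV_setC A : g_sigma_preimage coors A -> g_sigma_preimage coors (~` A).
Proof. exact: sigma_algebraC. Qed.

Let rV_bigcup (F : _^nat) : (forall i, g_sigma_preimage coors (F i)) ->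
  g_sigma_preimage coors (\bigcup_i (F i)).
Proof. exact: sigma_algebra_bigcup. Qed.

(* The product sigma-algebra, generated by the coordinates, as the library
   does for n.-tuple T. *)
HB.instance Definition _ := @isMeasurable.Build (measure_tuple_display d)
  'rV[T]_n (g_sigma_preimage coors) rV_set0 rV_setC rV_bigcup.

End measurable_rV.

Lemma measurable_coord_rV d (T : measurableType d) (n : nat) (i : 'I_n) :
  measurable_fun [set: 'rV[T]_n] (fun x : 'rV[T]_n => x ord0 i).
Proof.
move=> _ Y mY; rewrite setTI; apply: sub_sigma_algebra => /=.
rewrite -bigcup_seq/=; exists i => /=; first by rewrite mem_index_enum.
by exists Y => //; rewrite setTI.
Qed.

Lemma measurable_fun_rV d1 d2 (T1 : measurableType d1)
    (T2 : measurableType d2) (n : nat) (f : T1 -> 'rV[T2]_n) :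
  (forall i, measurable_fun [set: T1] (fun x => f x ord0 i)) ->
  measurable_fun [set: T1] f.
Proof.
case: n f => [|n] f mf _ A mA; rewrite setTI; move: A mA;
    pose G A := measurable (f @^-1` A); apply: (@smallest_sub _ _ _ G).
1, 3: split=> [|A|F mF]; rewrite /G;
  [by rewrite preimage_set0|by rewrite setTD preimage_setC; exact: measurableC|
   by rewrite preimage_bigcup; exact: bigcupT_measurable].
- by rewrite big_ord0.
- rewrite -bigcup_mkord_ord => A [i _ [B mB <-]].
  by rewrite /G setTI; have := mf (inord i) measurableT B mB; rewrite setTI.
Qed.

Section lebesgue_measure_rV.
Context {R : realType}.

Section cons_rV.
Variable n : nat.

Definition cons_rV (p : 'rV[R]_n * measurableTypeR R) : 'rV[R]_n.+1 :=
  row_mx (const_mx p.2 : 'rV[R]_1) p.1.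

Lemma measurable_cons_rV : measurable_fun setT cons_rV.
Proof.
apply: measurable_fun_rV => i; rewrite /cons_rV.
case: (@split_ordP 1 n i) => j ->.
  rewrite (_ : (fun _ => _) = snd)//; apply/funext => p.
  by rewrite (@row_mxEl _ 1 1 n) mxE.
rewrite (_ : (fun _ => _) = (fun x : 'rV[R]_n => x ord0 j) \o fst); last first.
  by apply/funext => p; rewrite (@row_mxEr _ 1 1 n).
exact: (measurableT_comp (@measurable_coord_rV _ R _ j)).
Qed.

Variable m : {measure set 'rV[R]_n -> \bar R}.

Definition lebesgue_cons : set 'rV[R]_n.+1 -> \bar R :=
  pushforward (m \x (@lebesgue_measure R))%E cons_rV.

HB.instance Definition _ := Measure.copy lebesgue_cons
  (measure_function_pushforward__canonical__measure_function_Measure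
     (m \x (@lebesgue_measure R))%E measurable_cons_rV).

End cons_rV.

Fixpoint lebesgue_rV (n : nat) : {measure set 'rV[R]_n -> \bar R} :=
  match n with
  | 0 => \d_(0 : 'rV[R]_0)
  | n'.+1 => lebesgue_cons (lebesgue_rV n')
  end.

(* On boxes, lebesgue_rV is the product of the side lengths. *)
Lemma lebesgue_rV_box (n : nat) (A : 'I_n -> set R) :
  (forall i, measurable (A i)) ->
  lebesgue_rV n [set x | forall i, A i (x ord0 i)] =
  (\prod_(i < n) lebesgue_measure (A i))%E.
Proof.
elim: n A => [|n IH] A mA.
  by rewrite big_ord0 /= diracE mem_set// => -[].
pose B : set 'rV[R]_n := [set x | forall i, A (lift ord0 i) (x ord0 i)].
have mB : measurable B.
  rewrite (_ : B = \bigcap_(i in [set: 'I_n])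
    ((fun x : 'rV[R]_n => x ord0 i) @^-1` A (lift ord0 i))).
    apply: fin_bigcap_measurable => [|i _]; first exact: finite_finset.
    rewrite -[X in measurable X]setTI.
    exact: measurable_coord_rV.
  by apply/seteqP; split=> x /= h i; [move=> _|]; exact: h.
have -> : lebesgue_rV n.+1 [set x | forall i, A i (x ord0 i)] =
    (lebesgue_rV n \x (@lebesgue_measure R))%E (B `*` A ord0).
  suff <- : @cons_rV n @^-1` [set x | forall i, A i (x ord0 i)] = B `*` A ord0.
    by [].
  apply/seteqP; split=> -[x a] /=; rewrite /B/=.
    move=> h; split=> [i|].
      have := h (lift ord0 i).
      by rewrite /cons_rV (_ : lift ord0 i = rshift 1 i) ?(@row_mxEr _ 1 1 n)//; exact/val_inj.
    have := h (@lshift 1 n ord0); rewrite /cons_rV (@row_mxEl _ 1 1 n) mxE.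
    by rewrite (_ : @lshift 1 n ord0 = ord0 :> 'I_n.+1)//; exact/val_inj.
  move=> [h h0] i; rewrite /cons_rV; case: (@split_ordP 1 n i) => j ->.
    by rewrite (@row_mxEl _ 1 1 n) mxE ord1 (_ : @lshift 1 n ord0 = ord0 :> 'I_n.+1)//; exact/val_inj.
  by rewrite (@row_mxEr _ 1 1 n) (_ : rshift 1 j = lift ord0 j :> 'I_n.+1)//; exact/val_inj.
apply: etrans (product_measure1E (lebesgue_rV n) (@lebesgue_measure R) mB (mA ord0)) _.
rewrite big_ord_recl muleC; congr (_ * _)%E.
by apply: IH => i.
Qed.

End lebesgue_measure_rV.

Section euclidean.
Context {R : realType} {d : nat}.
Implicit Types x y : 'rV[R]_d.

Definition dotp x y : R := \sum_(i < d) x ord0 i * y ord0 i.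

(* The Euclidean norm: the library's `|x| on 'rV[R]_d is the sup norm. *)
Definition enorm x : R := Num.sqrt (dotp x x).

End euclidean.

Section complex_integral.
Context {R : realType}.

Definition expi (x : R) : R[i] := Complex (cos x) (sin x).

Definition Cintegral d (T : measurableType d) (mu : {measure set T -> \bar R})
    (D : set T) (f : T -> R[i]) : R[i] :=
  Complex (Rintegral mu D (fun x => complex.Re (f x)))
          (Rintegral mu D (fun x => complex.Im (f x))).

End complex_integral.

Section gaussian.
Context {R : realType}.

(* The normal law of mean m and variance v >= 0. The library's normal_prob is
   parametrized by the standard deviation, and normal_prob m 0 is the uniform
   law on [0, 1], not the Dirac mass at m. *)
Definition gaussian_law (m v : R) : probability (measurableTypeR R) R :=
  if v == 0 then \d_(m : measurableTypeR R) : probability (measurableTypeR R) R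
  else normal_prob m (Num.sqrt v).

Context {d : measure_display} {T : measurableType d} (P : probability T R).

Definition has_gaussian_law (X : T -> R) : Prop :=
  exists m v : R, 0 <= v /\
    forall A : set (measurableTypeR R), measurable A ->
      pushforward P (X : T -> measurableTypeR R) A = gaussian_law m v A.

(* X restricted to the index set D is a Gaussian process. *)
Definition gaussian_process (I : Type) (D : set I) (X : I -> T -> R) : Prop :=
  forall (N : nat) (j : 'I_N -> I) (a : 'I_N -> R), (forall k, D (j k)) ->
    has_gaussian_law (fun w => \sum_(k < N) a k * X (j k) w).

Definition cvg_in_distribution (X : nat -> T -> R)
    (mu : probability (measurableTypeR R) R) : Prop :=
  forall f : R -> R, continuous f -> bounded_fun (f : R -> R^o) ->
    'E_P[f \o X n]%E @[n --> \oo] --> (\int[mu]_x (f x)%:E)%E.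

End gaussian.

Section wave.
Context {R : realType} {d : nat} (theta beta : R).
Local Notation leb := (@lebesgue_measure R).
Local Notation leb_rV := (@lebesgue_rV R d).

(* At xi = 0 this is 0, by the convention x / 0 = 0, instead of its limit s;
   likewise 0 `^ (beta - d) = 0 below. Both concern a Lebesgue-null set. *)
Definition fourier_wave_kernel (s : R) (xi : 'rV[R]_d) : R :=
  sin (s * Num.sqrt theta * enorm xi) / (Num.sqrt theta * enorm xi).

Definition wave_covariance (t : R) (x : 'rV[R]_d) (s : R) (y : 'rV[R]_d) :
    R[i] :=
  ((2 * pi) ^- d)%:C%C *
  Cintegral leb `[0, Num.min t s] (fun r =>
    Cintegral leb_rV setT (fun xi =>
      expi (dotp (x - y) xi) *
      (fourier_wave_kernel (t - r) xi * fourier_wave_kernel (s - r) xi *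
       enorm xi `^ (beta - d%:R))%:C%C)).

Context {dO : measure_display} {Omega : measurableType dO}.
Variable P : probability Omega R.

(* u is indexed by all real times, but constrained only at times >= 0. *)
Definition is_wave_solution (u : R -> 'rV[R]_d -> {RV P >-> R}) : Prop :=
  [/\ gaussian_process P [set tx : R * 'rV[R]_d | 0 <= tx.1]
        (fun tx => u tx.1 tx.2),
      forall t x, 0 <= t -> ('E_P[u t x] = 0)%E &
      forall t x s y, 0 <= t -> 0 <= s ->
        (fine 'E_P[(u t x : Omega -> R) \* u s y])%:C%C
          = wave_covariance t x s y].

End wave.

Section spatial_variation.
Context {R : realType} {d : nat}.
Local Notation leb_rV := (@lebesgue_rV R d).

Section variation.
Context {Omega : Type} (u : R -> 'rV[R]_d -> Omega -> R).
Variables (t : R) (rho : 'rV[R]_d) (lambda : R).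

Definition obs_point (k : nat) : 'rV[R]_d := (lambda * k%:R) *: rho.

(* Used for k >= 1 only, so that k.-1 is k - 1. *)
Definition I_sp (k : nat) (w : Omega) : R :=
  u t (obs_point k.+1) w + u t (obs_point k.-1) w - 2 * u t (obs_point k) w.

Definition V_sp (n : nat) (w : Omega) : R :=
  \sum_(1 <= k < n.+1) I_sp k w ^+ 2.

End variation.

Section constants.
Variables (beta : R) (rho : 'rV[R]_d).

Definition g_sp (omega : 'rV[R]_d) : R :=
  sin (dotp rho omega / 2) ^+ 4 * enorm omega `^ (beta - d%:R - 2).

Definition Fc (f : 'rV[R]_d -> R) (xi : 'rV[R]_d) : R :=
  Rintegral leb_rV setT (fun omega => cos (dotp xi omega) * f omega).

Definition C_spE : R :=
  8 / (2 * pi) ^+ d * fine ('N[leb_rV]_1[EFin \o g_sp])%E.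

Definition C_spV : R :=
  128 / (2 * pi) ^+ (2 * d) *
  fine (\esum_(k in [set: int]) ((Fc g_sp (k%:~R *: rho)) ^+ 2)%:E).

End constants.

End spatial_variation.

(* Main.v *)
Require Import Defs.
From HB Require Import structures.
From mathcomp Require Import all_boot all_order all_algebra.
From mathcomp Require Import all_classical all_reals all_analysis measurable_realfun.
From mathcomp Require Import complex.
From mathcomp Require Import ring lra.
Import Order.TTheory GRing.Theory Num.Theory.
Import numFieldNormedType.Exports.

Set Implicit Arguments.
Unset Strict Implicit.
Unset Printing Implicit Defensive.

Local Open Scope classical_set_scope.
Local Open Scope ring_scope.

(** Rescaled by lambda^((beta-2)/2), the second differences form a centred stationary Gaussian
    sequence J with covariance matrix Gamma. Its entries are (2 pi)^(-d) times Fourier coefficients,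
    along rho, of an explicit density ([rescaled_diff2_cov]). Integrating the squared wave kernel in
    time splits this density into 8t/theta times [g_sp] and lambda times an oscillating remainder of
    frequency A = 2t sqrt(theta)/lambda ([wave_spectrum_scale]). The statistic is therefore W + b,
    where W is (|J|^2 - tr Gamma)/sqrt n and b is a deterministic bias.

    Bias. Averaging the remainder over dilations of the frequency variable and integrating by parts
    shows that its integral is O(1/A) ([gerr_bias]). With the prefactor lambda this makes b = O(sqrt
    n lambda^2), which tends to 0 because lambda = o(n^(-1/4)) ([bias_cvg0]).

    Fluctuations. Gaussian integration by parts gives E W^(k+2) = (k+1) E(Q W^k) with Q = (2/n) J^T
    Gamma J ([normalized_sqr_rec]). The mean of Q is (2/n) sum Gamma_ij^2, and its variance is at
    most 8 C^4/n when C bounds the operator norm of Gamma. Hence Q may be replaced by its mean, and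
    in the limit the moments of W satisfy the recursion of a normal law
    ([normalized_sqr_moment_rec], [moment_rec_cvg]). Convergence of moments yields weak convergence
    by Taylor expansion of sin(s x + c) and Bernstein approximation by trigonometric polynomials
    ([moments_cvg_in_distribution], [trig_cvg_in_distribution]).

    Two facts about Gamma remain: an operator norm bound uniform in n, and the limit of (2/n) sum
    Gamma_ij^2. Both rest on [spectral_bound]: the densities have a common majorant whose projection
    along rho, wrapped modulo 2 pi, is bounded. This bounds the Toeplitz forms and makes the Fourier
    coefficients square summable ([fco_bound]); Cesaro means of Toeplitz sums then produce the sum
    over the integers in [C_spV] ([toeplitz_mean_cvg]). *)

(** * Lebesgue integrals under affine maps, Tonelli and dilations *)

Section affine_change.
Context {R : realType}.
Local Notation mu := (@lebesgue_measure R).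

Lemma measurable_affine (a b : R) :
  measurable_fun [set: measurableTypeR R]
    ((fun x => a * x + b) : measurableTypeR R -> measurableTypeR R).
Proof.
by apply: measurable_funD => //; apply: measurable_funM.
Qed.

(** The image of Lebesgue measure under x -> a x + b, multiplied by a, gives every half-open
    interval its length, so by uniqueness it is Lebesgue measure. *)
Let ge0_integral_affine_gt0 (a b : R) (f : R -> \bar R) : 0 < a ->
  measurable_fun [set: R] f -> (forall x, 0 <= f x)%E ->
  (\int[mu]_x f (a * x + b)%R = a^-1%:E * \int[mu]_x f x)%E.
Proof.
move=> a0 mf f0.
have a0' : 0 <= a by exact: ltW.
pose phi := (fun x => a * x + b) : measurableTypeR R -> measurableTypeR R.
pose m : {measure set (measurableTypeR R) -> \bar R} :=
  mscale (NngNum a0')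
   (measure_function_pushforward__canonical__measure_function_Measure mu
      (measurable_affine a b : measurable_fun _ phi)).
have mE A : measurable A -> mu A = m A.
  apply: lebesgue_measure_unique => _ [[u v]] _ <-.
  rewrite /m/= /mscale/= /pushforward /phi.
  have -> : (fun x => a * x + b) @^-1` `]u, v] =
     `]((u - b) / a), ((v - b) / a)]%classic.
    apply/seteqP; split=> x /=; rewrite !in_itv/= ltr_pdivrMr// ler_pdivlMr//;
      by rewrite ltrBlDr lerBrDr mulrC.
  rewrite !lebesgue_measure_itv/= !lte_fin ltr_pM2r ?invr_gt0// ltrD2r.
  case: ifPn => _; last by rewrite mule0.
  rewrite -!EFinB -EFinM -mulrBl; congr (_%:E).
  by field; rewrite gt_eqF.
have -> : (\int[mu]_x f x = \int[m]_x f x)%E.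
  by apply: eq_measure_integral => A mA _; exact: mE.
rewrite /m ge0_integral_mscale//= muleA -EFinM mulVf ?gt_eqF// mul1e.
rewrite [RHS](_ : _ = (\int[pushforward mu phi]_(y in setT) f y)%E)//.
by rewrite (ge0_integral_pushforward (measurable_affine a b : measurable_fun _ phi)).
Qed.

Let ge0_integral_opp (f : R -> \bar R) :
  measurable_fun [set: R] f -> (forall x, 0 <= f x)%E ->
  (\int[mu]_x f (- x)%R = \int[mu]_x f x)%E.
Proof.
move=> mf f0.
have mN : measurable_fun [set: measurableTypeR R]
    (-%R : measurableTypeR R -> measurableTypeR R).
  exact: (measurable_funN (@measurable_id _ (measurableTypeR R) _)).
transitivity (\int[pushforward mu (-%R : _ -> measurableTypeR R)]_y f y)%E.
  by rewrite (ge0_integral_pushforward mN).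
by apply: eq_measure_integral => A mA _; exact: lebesgue_measureN.
Qed.

Lemma ge0_integral_affine (a b : R) (f : R -> \bar R) : a != 0 ->
  measurable_fun [set: R] f -> (forall x, 0 <= f x)%E ->
  (\int[mu]_x f (a * x + b)%R = `|a|^-1%:E * \int[mu]_x f x)%E.
Proof.
move=> a0 mf f0; have [ap|an] := ltP 0 a.
  by rewrite gtr0_norm// ge0_integral_affine_gt0.
have an' : a < 0 by rewrite lt_neqAle a0.
rewrite ltr0_norm// -ge0_integral_opp//.
  under eq_integral do rewrite mulrN -mulNr.
  by rewrite ge0_integral_affine_gt0// oppr_gt0.
exact: (measurableT_comp mf (measurable_affine a b)).
Qed.

End affine_change.

Section lebesgue_measure_rV.
Context {R : realType}.
Local Notation mu := (@lebesgue_measure R).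

(** A separate head symbol for [lebesgue_rV n], on which the sigma-finiteness instances required by
    Tonelli are declared. *)
Definition lebn (n : nat) : set 'rV[R]_n -> \bar R := lebesgue_rV n.

HB.instance Definition _ n := Measure.copy (@lebn n) (lebesgue_rV n).

Lemma sigma_finite_lebn n : sigma_finite [set: 'rV[R]_n] (@lebn n).
Proof.
exists (fun k : nat => [set x : 'rV[R]_n | forall i, `[- k%:R, k%:R]%classic (x ord0 i)]).
  apply/seteqP; split=> // x _.
  exists (Num.truncn (\sum_i `|x ord0 i|)).+1 => //= i.
  rewrite in_itv/= -ler_norml (le_trans _ (ltW (truncnS_gt _)))//.
  by rewrite (bigD1 i)//= lerDl sumr_ge0.
move=> k; split.
  rewrite (_ : mkset _ = \bigcap_(i in [set: 'I_n])
    ((fun x : 'rV[R]_n => x ord0 i) @^-1` `[- k%:R, k%:R]%classic)).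
    apply: fin_bigcap_measurable => [|i _]; first exact: finite_finset.
    rewrite -[X in measurable X]setTI.
    exact: measurable_coord_rV.
  by apply/seteqP; split=> x /= h i; [move=> _|]; exact: h.
rewrite /lebn (@lebesgue_rV_box R n (fun=> `[- k%:R, k%:R]%classic))//.
rewrite (eq_bigr (fun=> (k%:R + k%:R)%:E)) ?prodEFin ?ltry// => i _.
rewrite lebesgue_measure_itv/= lte_fin; case: ifPn; first by rewrite opprK.
rewrite -leNgt => h; congr (_%:E).
have : (k%:R : R) >= 0 by [].
by move: h; lra.
Qed.

HB.instance Definition _ n := @isSFinite.Build _ _ R (@lebn n)
  (sfinite_measure_sigma_finite (@sigma_finite_lebn n)).
HB.instance Definition _ n :=
  @isSigmaFinite.Build _ _ R (@lebn n) (@sigma_finite_lebn n).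

Lemma ge0_integral_lebn_recr n (f : 'rV[R]_n.+1 -> \bar R) :
  measurable_fun setT f -> (forall x, 0 <= f x)%E ->
  (\int[@lebn n.+1]_x f x = \int[@lebn n]_y \int[mu]_x f (cons_rV (y, x)))%E.
Proof.
move=> mf f0.
pose m := measure_function_pushforward__canonical__measure_function_Measure
  (@lebn n \x mu)%E (@measurable_cons_rV R n).
transitivity (\int[m]_x f x)%E.
  by apply: eq_measure_integral => A mA _.
transitivity (\int[(@lebn n \x mu)]_x (f \o @cons_rV R n) x)%E.
  by apply: (ge0_integral_pushforward (@measurable_cons_rV R n) _ measurableT mf).
rewrite fubini_tonelli1// => [|x]; last exact: f0.
by apply: (measurableT_comp mf); exact: measurable_cons_rV.
Qed.

Lemma ge0_integral_lebn_recl n (f : 'rV[R]_n.+1 -> \bar R) :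
  measurable_fun setT f -> (forall x, 0 <= f x)%E ->
  (\int[@lebn n.+1]_x f x = \int[mu]_x \int[@lebn n]_y f (cons_rV (y, x)))%E.
Proof.
move=> mf f0; rewrite ge0_integral_lebn_recr//.
rewrite (@fubini_tonelli _ _ _ _ _ (@lebn n) mu (f \o @cons_rV R n))// => [|x];
  last exact: f0.
by apply: (measurableT_comp mf); exact: measurable_cons_rV.
Qed.

Lemma ge0_integral_lebn0 (f : 'rV[R]_0 -> \bar R) :
  measurable_fun setT f -> (forall x, 0 <= f x)%E ->
  (\int[@lebn 0]_x f x)%E = f 0.
Proof.
move=> mf f0.
transitivity (\int[\d_(0%R : 'rV[R]_0)]_x f x)%E; first by apply: eq_measure_integral => A mA _.
by rewrite integral_dirac// diracT mul1e.
Qed.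

Lemma measurable_scale_rV n (s : R) :
  measurable_fun [set: 'rV[R]_n] (fun x : 'rV[R]_n => s *: x : 'rV[R]_n).
Proof.
apply: measurable_fun_rV => i.
rewrite (_ : (fun _ => _) = (fun x : 'rV[R]_n => s * x ord0 i)); last first.
  by apply/funext => x; rewrite mxE.
by apply: measurable_funM => //; exact: measurable_coord_rV.
Qed.

Lemma cons_rV_scale n (s : R) (p : 'rV[R]_n * R) :
  s *: cons_rV p = cons_rV (s *: p.1, s * p.2).
Proof.
rewrite /cons_rV (@scale_row_mx _ 1 1 n)/= (_ : s *: const_mx p.2 = const_mx (s * p.2))//.
by apply/matrixP => i j; rewrite !mxE.
Qed.

Lemma measurable_cons_rVl n (y : 'rV[R]_n) :
  measurable_fun [set: R] (fun x : R => cons_rV (y, x) : 'rV[R]_n.+1).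
Proof. by apply: (measurableT_comp (@measurable_cons_rV R n)). Qed.

Lemma measurable_cons_rVr n (x : R) :
  measurable_fun [set: 'rV[R]_n] (fun y => cons_rV (y, x) : 'rV[R]_n.+1).
Proof. by apply: (measurableT_comp (@measurable_cons_rV R n)). Qed.

(** Induction on the dimension: the innermost first coordinate contributes a factor s^-1, the
    remaining ones s^-n. *)
Lemma ge0_integral_lebn_scale n (s : R) (f : 'rV[R]_n -> \bar R) : 0 < s ->
  measurable_fun setT f -> (forall x, 0 <= f x)%E ->
  (\int[@lebn n]_x f (s *: x) = (s ^- n)%:E * \int[@lebn n]_x f x)%E.
Proof.
move=> s0; elim: n f => [|n IH] f mf f0.
  rewrite expr0 invr1 mul1e !ge0_integral_lebn0//; first by rewrite scaler0.
  by apply: (measurableT_comp mf); exact: (measurable_scale_rV _).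
rewrite !ge0_integral_lebn_recr//; last first.
  by apply: (measurableT_comp mf); exact: (measurable_scale_rV _).
have -> : (\int[@lebn n]_y \int[mu]_x f (s *: cons_rV (y, x)) =
  \int[@lebn n]_y (s^-1%:E * \int[mu]_x f (cons_rV (s *: y, x))))%E.
  apply: eq_integral => y _.
  under eq_integral do rewrite cons_rV_scale/=.
  transitivity (\int[mu]_x f (cons_rV (s *: y, s * x + 0)%R))%E.
    by under [RHS]eq_integral do rewrite addr0.
  rewrite (@ge0_integral_affine R s 0 (fun x => f (cons_rV (s *: y, x)))) ?gt_eqF//.
    by rewrite gtr0_norm.
  by apply: (measurableT_comp mf); exact: (measurable_cons_rVl _).
have mF : measurable_fun setT (fun y => \int[mu]_x f (cons_rV (y, x)))%E.
  apply: (@measurable_fun_fubini_tonelli_F _ _ _ _ _ mu (f \o @cons_rV R n)) => [|x]; last exact: f0.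
  by apply: (measurableT_comp mf); exact: (@measurable_cons_rV R n).
rewrite (@ge0_integralZl _ _ _ (@lebn n) setT measurableT
  (fun y => \int[mu]_x f (cons_rV (s *: y, x)))%E)//; last 3 first.
- by apply: (measurableT_comp mF); exact: (measurable_scale_rV _).
- by move=> y _; exact: integral_ge0.
- by rewrite lee_fin invr_ge0 ltW.
rewrite (IH (fun y => \int[mu]_x f (cons_rV (y, x)))%E)//; last first.
  by move=> y; exact: integral_ge0.
by rewrite muleA -EFinM -invfM -exprS.
Qed.

End lebesgue_measure_rV.

(** * Fundamental theorem of calculus and integrable power weights *)

Section calculus.
Context {R : realType}.
Local Notation mu := (@lebesgue_measure R).

Lemma integral_is_derive (f F : R -> R) (a b : R) : a < b ->
  (forall x, a <= x <= b -> is_derive x 1 F (f x)) ->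
  (forall x, a <= x <= b -> {for x, continuous f}) ->
  (\int[mu]_(x in `[a, b]) (f x)%:E = (F b - F a)%:E)%E.
Proof.
move=> ab dF cf; have aab : a <= a <= b by rewrite lexx ltW.
have bab : a <= b <= b by rewrite lexx ltW.
have cF x : a <= x <= b -> {for x, continuous F}.
  move=> xab; apply/differentiable_continuous/derivable1_diffP.
  by have [] := dF _ xab.
rewrite (@continuous_FTC2 _ f F)//.
- apply: continuous_in_subspaceT => x; rewrite inE/= in_itv/=; exact: cf.
- split.
  + by move=> x; rewrite in_itv/= => /andP[ax xb]; have [] := dF x; rewrite ?ltW.
  + by apply: cvg_at_right_filter; exact: cF.
  + by apply: cvg_at_left_filter; exact: cF.
- move=> x; rewrite in_itv/= => /andP[ax xb]; rewrite derive1E.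
  by have [] := dF x; rewrite ?ltW.
Qed.

Lemma ge0_integral_bigcup_le d (T : measurableType d) (m : {measure set T -> \bar R})
    (F : (set T)^nat) (f : T -> \bar R) (C : \bar R) :
  nondecreasing_seq F -> (forall i, measurable (F i)) ->
  measurable_fun setT f -> (forall x, 0 <= f x)%E ->
  (forall n, \int[m]_(x in F n) f x <= C)%E ->
  (\int[m]_(x in \bigcup_n F n) f x <= C)%E.
Proof.
move=> ndF mF mf f0 FC.
have h : (\int[m]_(x in F i) f x)%E @[i --> \oo] --> (\int[m]_(x in \bigcup_i F i) f x)%E.
  by apply: ge0_nondecreasing_set_cvg_integral => // i; exact: measurable_funTS.
rewrite -(cvg_lim _ h)//; apply: lime_le; last exact: nearW.
by apply/cvg_ex; eexists; exact: h.
Qed.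

Lemma integral_powR_itv (p u v : R) : p != 1 -> 0 < u -> u < v ->
  (\int[mu]_(x in `[u, v]) (x `^ (- p))%:E =
   ((v `^ (1 - p) - u `^ (1 - p)) / (1 - p))%:E)%E.
Proof.
move=> p1 u0 uv; have p1' : 1 - p != 0 by rewrite subr_eq0 eq_sym.
apply: etrans; first apply: (@integral_is_derive _ (fun x => x `^ (1 - p) / (1 - p))) => //.
- move=> x /andP[ux _]; have x0 := lt_le_trans u0 ux.
  have -> : x `^ (- p) = (1 - p)^-1 *: ((1 - p) * x `^ (1 - p - 1)).
    rewrite /GRing.scale/= mulrA mulVf// mul1r; congr (_ `^ _); ring.
  rewrite (_ : (fun _ => _) = (1 - p)^-1 *: (fun x => x `^ (1 - p))); last first.
    by apply/funext => y; rewrite mulrC.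
  by have := is_derive1_powR (1 - p) x0; exact: is_deriveZ.
- move=> x /andP[ux _]; have x0 := lt_le_trans u0 ux.
  by apply/differentiable_continuous/derivable1_diffP/derivable_powR; rewrite in_itv/= x0.
- by rewrite -mulrBl.
Qed.

Lemma measurable_powRl d (T : measurableType d) (f : T -> R) p :
  measurable_fun setT f -> measurable_fun setT (fun x => f x `^ p).
Proof. by move=> mf; apply: measurableT_comp (measurable_powR p) mf. Qed.

Lemma integral_powR_near0 (a : R) : a < 1 ->
  (\int[mu]_(x in `]0%R, 1%R]) (x `^ (- a))%:E <= ((1 - a)^-1)%:E)%E.
Proof.
move=> a1; have a1' : 0 < 1 - a by rewrite subr_gt0.
have -> : `]0, 1]%classic = \bigcup_n `[(n.+2%:R^-1 : R), 1]%classic.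
  apply/seteqP; split=> x /=; rewrite in_itv/=.
    move=> /andP[x0 x1]; exists (Num.truncn (x^-1)) => //=.
    rewrite in_itv/= x1 andbT invf_ple ?posrE//.
    by rewrite (le_trans (ltW (truncnS_gt _)))// ler_nat.
  move=> [n _ /=]; rewrite in_itv/= => /andP[nx ->]; rewrite andbT.
  by rewrite (lt_le_trans _ nx)// invr_gt0.
apply: ge0_integral_bigcup_le => //.
- apply/nondecreasing_seqP => n; rewrite subsetEset => x/=.
  rewrite !in_itv/= => /andP[h ->]; rewrite andbT (le_trans _ h)//.
  by rewrite lef_pV2 ?posrE// ler_nat.
- apply/measurable_EFinP; exact: measurable_powR.
- by move=> x; rewrite lee_fin powR_ge0.
- move=> n; rewrite integral_powR_itv ?lt_eqF ?invf_lt1 ?ltr1n//.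
  rewrite lee_fin powR1 ler_pdivrMr// mulVf ?gt_eqF// lerBlDr lerDl powR_ge0//.
Qed.

Lemma integral_powR_neary (b : R) : 1 < b ->
  (\int[mu]_(x in `[1%R, +oo[) (x `^ (- b))%:E <= ((b - 1)^-1)%:E)%E.
Proof.
move=> b1; have b1' : 0 < b - 1 by rewrite subr_gt0.
have -> : `[1, +oo[%classic = \bigcup_n `[1, (n.+2%:R : R)]%classic.
  apply/seteqP; split=> x /=; rewrite in_itv/= ?andbT.
    move=> x1; exists (Num.truncn x) => //=.
    rewrite in_itv/= x1/=.
    by rewrite (le_trans (ltW (truncnS_gt _)))// ler_nat.
  by move=> [n _ /=]; rewrite in_itv/= => /andP[].
apply: ge0_integral_bigcup_le => //.
- apply/nondecreasing_seqP => n; rewrite subsetEset => x/=.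
  rewrite !in_itv/= => /andP[-> h]; rewrite (le_trans h)//.
  by rewrite ler_nat.
- apply/measurable_EFinP; exact: measurable_powR.
- by move=> x; rewrite lee_fin powR_ge0.
- move=> n; rewrite integral_powR_itv ?gt_eqF ?ltr1n//.
  rewrite lee_fin powR1 -opprB -[1 - b]opprB invrN mulrNN.
  rewrite ler_pdivrMr// mulVf ?gt_eqF// lerBlDr lerDl powR_ge0//.
Qed.

(* The value at 0 is +oo so that products of such factors dominate radial
   singularities everywhere, coordinate hyperplanes included. *)
Definition powq (a b x : R) : \bar R :=
  if x == 0 then +oo%E else (`|x| `^ (- a) * (1 + `|x|) `^ (a - b))%:E.

Lemma measurable_powq a b : measurable_fun setT (powq a b).
Proof.
apply: measurable_fun_ifT => //.
  by apply: measurable_fun_eqr => //; exact: measurable_cst.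
apply/measurable_EFinP; apply: measurable_funM; apply: measurable_powRl => //.
exact: measurable_funD.
Qed.

Lemma powq_ge0 a b x : (0 <= powq a b x)%E.
Proof.
by rewrite /powq; case: ifP => _; rewrite ?leey// lee_fin mulr_ge0// powR_ge0.
Qed.

Lemma powqN a b x : powq a b (- x) = powq a b x.
Proof. by rewrite /powq oppr_eq0 normrN. Qed.

(** On (0, 1] the weight is at most x^(-a), on (1, +oo) at most x^(-b); the point 0 is null, and the
    negative half-line follows by symmetry. *)
Lemma integral_powq a b : 0 <= a -> a < 1 -> 1 < b ->
  (\int[mu]_x powq a b x < +oo)%E.
Proof.
move=> a0 a1 b1.
have mq := measurable_powq a b.
have : (\int[mu]_(x in `[0%R, +oo[) powq a b x < +oo)%E.
  have -> : `[0, +oo[%classic = [set (0:R)] `|` (`]0, 1]%classic `|` `]1, +oo[%classic).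
    apply/seteqP; split=> x /=; rewrite !in_itv/= ?andbT.
      rewrite le_eqVlt => /orP[/eqP <-|x0]; [by left|right].
      by case: (leP x 1) => h; [left|right]; rewrite ?x0.
    move=> [->//|[/andP[/ltW//]|x1]]; exact: (le_trans ler01 (ltW x1)).
  rewrite ge0_integral_setU//=; last 4 first.
  - exact: measurableU.
  - exact: measurable_funTS.
  - by move=> x _; exact: powq_ge0.
  - apply/disj_setPLR => x /= ->; rewrite !in_itv/= ltxx/= andbT => -[//|].
    by rewrite ltr10.
  rewrite integral_set1 add0e ge0_integral_setU//=; last 3 first.
  - exact: measurable_funTS.
  - by move=> x _; exact: powq_ge0.
  - apply/disj_setPLR => x /=; rewrite !in_itv/= andbT => /andP[_ x1].
    by move=> ?; lra.
  apply: lte_add_pinfty.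
  - apply: le_lt_trans (ltry (1 - a)^-1).
    apply: le_trans (integral_powR_near0 a1).
    apply: ge0_le_integral => //.
    + by move=> x _; exact: powq_ge0.
    + exact: measurable_funTS.
    + by apply: measurable_funTS; apply/measurable_EFinP; exact: measurable_powR.
    + move=> x; rewrite /= in_itv/= => /andP[x0 x1].
      rewrite /powq gt_eqF// lee_fin gtr0_norm//.
      rewrite ler_piMr ?powR_ge0//.
      rewrite -[leRHS](powRr0 (1 + x)) ler_powR ?lerDl ?ltW//.
      by move: a1 b1; lra.
  - apply: le_lt_trans (ltry (b - 1)^-1).
    apply: le_trans (integral_powR_neary b1).
    apply: (@le_trans _ _ (\int[mu]_(x in `[1%R, +oo[) powq a b x)%E).
      apply: ge0_subset_integral => //; first exact: measurable_funTS.
        by move=> x _; exact: powq_ge0.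
      by move=> x /=; rewrite !in_itv/= !andbT => /ltW.
    apply: ge0_le_integral => //.
    + by move=> x _; exact: powq_ge0.
    + exact: measurable_funTS.
    + by apply: measurable_funTS; apply/measurable_EFinP; exact: measurable_powR.
    + move=> x; rewrite /= in_itv/= andbT => x1.
      have x0 : 0 < x by rewrite (lt_le_trans _ x1).
      rewrite /powq gt_eqF// lee_fin gtr0_norm//.
      have -> : x `^ (- b) = x `^ (- a) * x `^ (a - b).
        rewrite -powRD; last by rewrite (gt_eqF x0) implybT.
        by congr (_ `^ _); ring.
      rewrite ler_wpM2l ?powR_ge0// -[a - b]opprB !powRN.
      rewrite lef_pV2 ?posrE ?powR_gt0//; last by rewrite addr_gt0.
      rewrite ge0_ler_powR ?nnegrE ?lerDr ?ler01//.
      * by move: a1 b1; lra.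
      * exact: ltW.
      * by rewrite addr_ge0 ?ltW.
move=> int_pos.
have int_neg : (\int[mu]_(x in `]-oo, 0%R]) powq a b x < +oo)%E.
  rewrite (@ge0_integration_by_substitution0 _ (powq a b)) ?powq_ge0// in int_pos;
    last by move=> r; exact: powq_ge0.
  by under eq_integral do rewrite -powqN.
rewrite (_ : setT = `]-oo, 0]%classic `|` `](0:R), +oo[%classic); last first.
  by apply/seteqP; split=> x//= _; rewrite !in_itv/= andbT; case: (leP x 0) => h; [left|right].
rewrite ge0_integral_setU//=; last 3 first.
- exact: measurable_funTS.
- by move=> x _; exact: powq_ge0.
- apply/disj_setPLR => x /=; rewrite !in_itv/= andbT => x0.
  by move=> ?; lra.
apply: lte_add_pinfty int_neg _; apply: le_lt_trans int_pos.
apply: ge0_subset_integral => //; first exact: measurable_funTS.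
  by move=> x _; exact: powq_ge0.
by move=> x /=; rewrite !in_itv/= !andbT => /ltW.
Qed.

End calculus.

(** * Integrals of products of one-dimensional weights *)

Section product_majorant.
Context {R : realType}.
Local Notation mu := (@lebesgue_measure R).
Local Open Scope ereal_scope.

Lemma cons_rV0 n (y : 'rV[R]_n) (x : R) : cons_rV (y, x) ord0 ord0 = x.
Proof.
rewrite /cons_rV (_ : ord0 = @lshift 1 n ord0 :> 'I_n.+1); last exact/val_inj.
by rewrite (@row_mxEl _ 1 1 n) mxE.
Qed.

Lemma cons_rVS n (y : 'rV[R]_n) (x : R) j :
  cons_rV (y, x) ord0 (lift ord0 j) = y ord0 j.
Proof.
rewrite /cons_rV (_ : lift ord0 j = rshift 1 j :> 'I_n.+1); last exact/val_inj.
by rewrite (@row_mxEr _ 1 1 n).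
Qed.

Lemma dotp_cons_rV n (rho : 'rV[R]_n.+1) (y : 'rV[R]_n) (x : R) :
  dotp rho (cons_rV (y, x)) =
  (rho ord0 ord0 * x + dotp (\row_j rho ord0 (lift ord0 j)) y)%R.
Proof.
rewrite /dotp big_ord_recl cons_rV0; congr (_ + _)%R.
by apply: eq_bigr => j _; rewrite cons_rVS mxE.
Qed.

Lemma measurable_dotp n (rho : 'rV[R]_n) : measurable_fun setT (dotp rho).
Proof.
apply: measurable_sum => i; apply: measurable_funM => //.
exact: measurable_coord_rV.
Qed.

Lemma measurable_eprod d (T : measurableType d) (I : Type) (s : seq I)
    (h : I -> T -> \bar R) : (forall j, measurable_fun setT (h j)) ->
  measurable_fun setT (fun x => \prod_(j <- s) h j x).
Proof.
move=> mh; elim: s => [|j s IH].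
  by under eq_fun do rewrite big_nil; exact: measurable_cst.
by under eq_fun do rewrite big_cons; exact: emeasurable_funM.
Qed.

Lemma measurable_eprod_rV n (g : 'I_n -> R -> \bar R) :
  (forall j, measurable_fun setT (g j)) ->
  measurable_fun setT (fun x : 'rV[R]_n => \prod_j g j (x ord0 j)).
Proof.
move=> mg; apply: measurable_eprod => j.
by apply: (measurableT_comp (mg j)); exact: measurable_coord_rV.
Qed.

Lemma eprod_ge0 n (g : 'I_n -> \bar R) : (forall j, 0 <= g j) -> 0 <= \prod_j g j.
Proof. by move=> g0; elim/big_ind : _ => // x y; exact: mule_ge0. Qed.

Lemma integral_lebn_prod n (g : 'I_n -> R -> \bar R) :
  (forall j, measurable_fun setT (g j)) -> (forall j x, 0 <= g j x) ->
  \int[@lebn R n]_x \prod_j g j (x ord0 j) = \prod_j \int[mu]_x g j x.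
Proof.
elim: n g => [g _ _|n IH g mg g0].
  rewrite big_ord0; under eq_integral do rewrite big_ord0.
  by rewrite ge0_integral_lebn0.
rewrite ge0_integral_lebn_recl//; last 2 first.
- exact: measurable_eprod_rV.
- by move=> x; exact: eprod_ge0.
rewrite big_ord_recl/= -IH// -ge0_integralZr; last 4 first.
- by [].
- exact: mg.
- by move=> x _; exact: g0.
- by apply: integral_ge0 => x _; exact: eprod_ge0.
apply: eq_integral => x _; rewrite -ge0_integralZl//; last 2 first.
- exact: (@measurable_eprod_rV _ (fun j => g (lift ord0 j))).
- by move=> y _; exact: eprod_ge0.
apply: eq_integral => y _; rewrite big_ord_recl cons_rV0.
by under eq_bigr do rewrite cons_rVS.
Qed.

(* Fubini with the coordinate i innermost, whatever its position. *)
Lemma slice_integral_le n (g : 'I_n -> R -> \bar R) (U : R -> \bar R)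
    (K : \bar R) (rho : 'rV[R]_n) (i : 'I_n) (c : R) :
  (forall j, measurable_fun setT (g j)) -> (forall j x, 0 <= g j x) ->
  measurable_fun setT U -> (forall x, 0 <= U x) -> 0 <= K ->
  (forall c', \int[mu]_x (U (rho ord0 i * x + c')%R * g i x) <= K) ->
  \int[@lebn R n]_x (U (dotp rho x + c)%R * \prod_j g j (x ord0 j)) <=
    \prod_j (if j == i then K else \int[mu]_x g j x).
Proof.
move=> + + mU U0 K0; elim: n g rho i c => [_ _ []//|n IH] g rho i c mg g0 UK.
set rho' := \row_j rho ord0 (lift ord0 j).
have mUc m (r : 'rV[R]_m) e : measurable_fun setT (fun x => U (dotp r x + e)%R).
  apply: (measurableT_comp mU); apply: measurable_funD => //.
  exact: measurable_dotp.
have mF m (r : 'rV[R]_m) e (h : 'I_m -> R -> \bar R) :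
    (forall j, measurable_fun setT (h j)) -> measurable_fun setT
  (fun x : 'rV_m => U (dotp r x + e)%R * \prod_j h j (x ord0 j)).
  by move=> mh; apply: emeasurable_funM; [exact: mUc|exact: measurable_eprod_rV].
have F0 m (r : 'rV[R]_m) e (h : 'I_m -> R -> \bar R) : (forall j x, 0 <= h j x) ->
    forall x : 'rV_m, 0 <= U (dotp r x + e)%R * \prod_j h j (x ord0 j).
  by move=> h0 x; rewrite mule_ge0// eprod_ge0.
have E x y : U (dotp rho (cons_rV (y, x)) + c)%R *
    \prod_j g j (cons_rV (y, x) ord0 j) =
    g ord0 x * (U (dotp rho' y + (rho ord0 ord0 * x + c))%R *
      \prod_j g (lift ord0 j) (y ord0 j)).
  rewrite dotp_cons_rV big_ord_recl cons_rV0 muleCA; congr (_ * (U _ * _)).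
    by rewrite addrCA addrA.
  by apply: eq_bigr => j _; rewrite cons_rVS.
case: (unliftP ord0 i) UK => [i'|] -> UK.
- rewrite ge0_integral_lebn_recl//; [|exact: mF|exact: F0].
  rewrite [leRHS]big_ord_recl/= -ge0_integralZr; last 4 first.
  + by [].
  + exact: mg.
  + by move=> x _; exact: g0.
  + by apply: eprod_ge0 => j; case: ifP => // _; exact: integral_ge0.
  apply: ge0_le_integral => //.
  + by move=> x _; apply: integral_ge0 => y _; exact: F0.
  + apply: (@measurable_fun_fubini_tonelli_G _ _ _ _ _ (@lebn R n)
      ((fun x => U (dotp rho x + c)%R * \prod_j g j (x ord0 j)) \o @cons_rV R n)).
      by apply: (measurableT_comp (mF _ _ _ _ mg)); exact: measurable_cons_rV.
    by move=> x; exact: F0.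
  + by apply: emeasurable_funM; [exact: mg|exact: measurable_cst].
  + move=> x _; under eq_integral do rewrite E.
    rewrite ge0_integralZl//; last 2 first.
      exact: (mF _ rho' _ (fun j => g (lift ord0 j))).
      by move=> y _; exact: (F0 _ rho' _ (fun j => g (lift ord0 j))).
    apply: lee_wpmul2l => //.
    have -> : (\prod_(j < n) (if lift ord0 j == lift ord0 i' then K
       else \int[mu]_x0 g (lift ord0 j) x0)) =
       (\prod_(j < n) (if j == i' then K else \int[mu]_x0 g (lift ord0 j) x0)).
      by apply: eq_bigr => j _; rewrite (inj_eq lift_inj).
    by apply: (IH (fun j => g (lift ord0 j)) rho' i') => // c'; have := UK c'; rewrite mxE.
- rewrite ge0_integral_lebn_recr//; [|exact: mF|exact: F0].
  rewrite [leRHS]big_ord_recl eqxx.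
  have -> : (\prod_(j < n) (if lift ord0 j == ord0 then K
       else \int[mu]_x0 g (lift ord0 j) x0)) =
       (\prod_(j < n) (\int[mu]_x0 g (lift ord0 j) x0)) by exact: eq_bigr.
  rewrite -integral_lebn_prod// -ge0_integralZl//; last 2 first.
  + exact: (@measurable_eprod_rV _ (fun j => g (lift ord0 j))).
  + by move=> y _; exact: eprod_ge0.
  apply: ge0_le_integral => //.
  + by move=> x _; apply: integral_ge0 => y _; exact: F0.
  + apply: (@measurable_fun_fubini_tonelli_F _ _ _ _ _ mu
      ((fun x => U (dotp rho x + c)%R * \prod_j g j (x ord0 j)) \o @cons_rV R n)).
      by apply: (measurableT_comp (mF _ _ _ _ mg)); exact: measurable_cons_rV.
    by move=> x; exact: F0.
  + by apply: emeasurable_funM; [exact: measurable_cst|exact: (@measurable_eprod_rV _ (fun j => g (lift ord0 j)))].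
  + move=> y _.
    have G0 : 0 <= \prod_(j < n) g (lift ord0 j) (y ord0 j) by exact: eprod_ge0.
    have -> : \int[mu]_x (U (dotp rho (cons_rV (y, x)) + c)%R *
        \prod_j g j (cons_rV (y, x) ord0 j)) =
      \int[mu]_x ((\prod_(j < n) g (lift ord0 j) (y ord0 j)) *
        (U (rho ord0 ord0 * x + (dotp rho' y + c))%R * g ord0 x)).
      apply: eq_integral => x _; rewrite E muleCA [RHS]muleC -muleA; congr (U _ * _).
      by rewrite addrCA.
    rewrite ge0_integralZl//; last 2 first.
    + apply: emeasurable_funM; last exact: mg.
      by apply: (measurableT_comp mU); exact: measurable_affine.
    + by move=> x _; rewrite mule_ge0.
    by rewrite muleC; apply: lee_wpmul2r.
Qed.

End product_majorant.

(** * Trigonometric sums and orthogonality over a period *)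

Section trigonometric_sums.
Context {R : realType}.
Local Notation mu := (@lebesgue_measure R).

Lemma is_derive_affine (a b x : R) : is_derive x 1 (fun y => a * y + b) a.
Proof.
have h : is_derive x 1 ((cst a * id) + cst b : R -> R) (a *: 1 + x *: 0 + 0).
  by apply: is_deriveD.
by move: h; rewrite scaler0 !addr0 /GRing.scale/= mulr1.
Qed.

Lemma is_derive_sin_affine (a b x : R) :
  is_derive x 1 (fun y => sin (a * y + b)) (cos (a * x + b) * a).
Proof.
by have h := is_derive_affine a b x; exact: (@is_derive1_comp _ sin (fun y => a * y + b)).
Qed.

Lemma is_derive_cos_affine (a b x : R) :
  is_derive x 1 (fun y => cos (a * y + b)) (- sin (a * x + b) * a).
Proof.
by have h := is_derive_affine a b x; exact: (@is_derive1_comp _ cos (fun y => a * y + b)).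
Qed.

Lemma is_derive_scalel (k : R) (f : R -> R) (x d : R) : is_derive x 1 f d ->
  is_derive x 1 (fun y => k * f y) (k * d).
Proof. by move=> h; exact: (@is_deriveZ _ _ _ f k). Qed.

Lemma is_derive_bigsum n (f : 'I_n -> R -> R) (x : R) (d : 'I_n -> R) :
  (forall i, is_derive x 1 (f i) (d i)) ->
  is_derive x 1 (fun y => \sum_i f i y) (\sum_i d i).
Proof.
move=> h; rewrite (_ : (fun _ => _) = \sum_i f i); first exact: is_derive_sum.
by apply/funext => y; rewrite fct_sumE.
Qed.

Lemma is_derive_continuous (f : R -> R) (x d : R) :
  is_derive x 1 f d -> {for x, continuous f}.
Proof. by case=> h _; apply/differentiable_continuous/derivable1_diffP. Qed.

Lemma sin_intmul_period (x : R) (j k : nat) :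
  sin (x + (j%:R - k%:R) * (pi *+ 2)) = sin x.
Proof.
set T := pi *+ 2; rewrite -(periodicn (@sinD2pi R) k).
rewrite (_ : x + (j%:R - k%:R) * T + T *+ k = x + T *+ j).
  by rewrite (periodicn (@sinD2pi R)).
by rewrite -[T *+ k]mulr_natl -[T *+ j]mulr_natl; ring.
Qed.

Variables (N : nat) (g : 'I_N -> R).

(** The squared modulus of sum_k g_k e^(iky), without complex numbers. *)
Definition tsum (y : R) : R :=
  (\sum_k g k * cos (k%:R * y)) ^+ 2 + (\sum_k g k * sin (k%:R * y)) ^+ 2.

Lemma tsum_ge0 y : 0 <= tsum y.
Proof. by rewrite addr_ge0// sqr_ge0. Qed.

Lemma tsumE y : tsum y =
  \sum_j \sum_k g j * g k * cos ((j%:R - k%:R) * y).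
Proof.
rewrite /tsum !expr2 !big_distrlr/= -big_split; apply: eq_bigr => j _.
rewrite -big_split; apply: eq_bigr => k _.
by rewrite mulrBl cosB /=; ring.
Qed.

Lemma measurable_tsum : measurable_fun setT tsum.
Proof.
apply: measurable_funD; apply: measurable_funX; apply: measurable_sum => k;
  apply: measurable_funM => //.
- apply: measurableT_comp; first exact: (continuous_measurable_fun (@continuous_cos R)).
  exact: measurable_funM.
- apply: measurableT_comp; first exact: (continuous_measurable_fun (@continuous_sin R)).
  exact: measurable_funM.
Qed.

Let prim (a c : R) (j k : nat) (x : R) : R :=
  if j == k then x
  else ((j%:R - k%:R) * a)^-1 * sin ((j%:R - k%:R) * a * x + (j%:R - k%:R) * c).

Let is_derive_prim (a c : R) (j k : nat) (x : R) : a != 0 ->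
  is_derive x 1 (prim a c j k) (cos ((j%:R - k%:R) * (a * x + c))).
Proof.
move=> a0; rewrite /prim; have [->|jk] := eqVneq j k.
  by rewrite subrr mul0r cos0; exact: is_derive_id.
have m0 : (j%:R - k%:R) * a != 0 by rewrite mulf_neq0// subr_eq0 eqr_nat.
have h := is_derive_scalel ((j%:R - k%:R) * a)^-1
  (is_derive_sin_affine ((j%:R - k%:R) * a) ((j%:R - k%:R) * c) x).
by apply: (is_derive_eq h); rewrite mulrCA mulVf// mulr1 mulrDr mulrA.
Qed.

(** Orthogonality of characters: the interval has length 2 pi/|a|, a full period of the integrand,
    so only the diagonal terms of [tsumE] survive. *)
Lemma integral_tsum (a c z : R) : a != 0 ->
  (\int[mu]_(x in `[(z - pi / `|a|)%R, (z + pi / `|a|)%R]) (tsum (a * x + c))%:E =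
   (pi *+ 2 / `|a| * \sum_k g k ^+ 2)%:E)%E.
Proof.
move=> a0; have L0 : 0 < pi / `|a| by rewrite divr_gt0 ?pi_gt0 ?normr_gt0.
have dF (x : R) : is_derive x 1
    (fun x => \sum_j \sum_k g j * g k * prim a c j k x) (tsum (a * x + c)).
  rewrite tsumE; apply: is_derive_bigsum => j; apply: is_derive_bigsum => k.
  exact/is_derive_scalel/is_derive_prim.
have dT (x : R) : is_derive x 1 (fun x => tsum (a * x + c))
    (\sum_j \sum_k g j * g k *
       (- sin ((j%:R - k%:R) * a * x + (j%:R - k%:R) * c) * ((j%:R - k%:R) * a))).
  rewrite (_ : (fun _ => _) = (fun y => \sum_j \sum_k g j * g k *
      cos ((j%:R - k%:R) * a * y + (j%:R - k%:R) * c))); last first.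
    apply/funext => y; rewrite tsumE; apply: eq_bigr => j _; apply: eq_bigr => k _.
    by rewrite mulrDr mulrA.
  apply: is_derive_bigsum => j; apply: is_derive_bigsum => k.
  exact/is_derive_scalel/is_derive_cos_affine.
apply: etrans.
  apply: (@integral_is_derive _ (fun x => tsum (a * x + c)) (fun x => \sum_j \sum_k g j * g k * prim a c j k x)).
  - by rewrite ltrD2l; move: L0; lra.
  - by move=> x _; exact: is_derive_continuous (dT x).
congr (_%:E); rewrite -sumrB mulr_sumr; apply: eq_bigr => j _.
rewrite -sumrB (bigD1 j)//= big1 ?addr0 => [|k kj].
  rewrite -mulrBr /prim eqxx expr2 mulrC; congr (_ * _).
  by rewrite mulr2n; lra.
rewrite -mulrBr /prim; case: eqP => [/val_inj jk|/eqP jk]; first by rewrite jk eqxx in kj.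
(* The two endpoints differ by a whole number of periods of the off-diagonal primitive, which takes
   the same value at both. *)
set m := j%:R - k%:R.
have -> : m * a * (z + pi / `|a|) + m * c = m * a * (z - pi / `|a|) + m * c +
   m * a * ((pi *+ 2) / `|a|) by rewrite mulr2n; field; rewrite normr_eq0.
suff -> : sin (m * a * (z - pi / `|a|) + m * c + m * a * ((pi *+ 2) / `|a|)) =
  sin (m * a * (z - pi / `|a|) + m * c) by rewrite subrr mulr0.
have [a_gt0|a_lt0] := ltP 0 a.
  rewrite gtr0_norm// -[m * a * (_ / _)]mulrA (mulrC a) divfK ?gt_eqF//.
  exact: sin_intmul_period.
have an : a < 0 by rewrite lt_neqAle a0.
rewrite ltr0_norm// (_ : m * a * (_ / - a) = (k%:R - j%:R) * (pi *+ 2)); last first.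
  by rewrite /m mulr2n; field.
exact: sin_intmul_period.
Qed.

(* 1 + |x| varies by a factor at most 1 + L over distance L, so the weight may
   be averaged over a period of tsum, where orthogonality applies. *)
Lemma integral_tsum_weight (a b c : R) : a != 0 -> 0 < b ->
  (\int[mu]_x ((tsum (a * x + c))%:E * ((1 + `|x|) `^ (- b))%:E) <=
   ((1 + pi / `|a|) `^ b * \sum_k g k ^+ 2)%:E *
     \int[mu]_x ((1 + `|x|) `^ (- b))%:E)%E.
Proof.
move=> a0 b0; set L := pi / `|a|.
have L0 : 0 < L by rewrite divr_gt0 ?pi_gt0 ?normr_gt0.
pose w (x : R) : R := (1 + `|x|) `^ (- b).
have w0 x : 0 <= w x by exact: powR_ge0.
have mw : measurable_fun setT w by apply: measurable_powRl; exact: measurable_funD.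
pose k (x z : R) : R := ((`|x - z| <= L)%R : nat)%:R.
pose C := (1 + L) `^ b / (L *+ 2).
have L2 : 0 <= L *+ 2 by rewrite mulrn_wge0// ltW.
have L2' : L *+ 2 != 0 by rewrite mulrn_eq0/= gt_eqF.
have C0 : 0 <= C by rewrite divr_ge0 ?powR_ge0.
have kE (x : R) : k x = \1_(`[(x - L)%R, (x + L)%R]).
  by apply/funext => z; rewrite indicE /k mem_setE in_itv/= -ler_distl distrC.
have mk (x : R) : measurable_fun setT (k x) by rewrite kE; exact: measurable_indic.
have kC (x z : R) : k x z = k z x by rewrite /k distrC.
have mT : measurable_fun setT (fun x => tsum (a * x + c)).
  by apply: (measurableT_comp measurable_tsum); exact: measurable_affine.
pose F (p : measurableTypeR R * measurableTypeR R) : \bar R :=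
  (C * (tsum (a * p.1 + c) * (w p.2 * k p.1 p.2)))%:E.
have mF : measurable_fun setT F.
  apply/measurable_EFinP; apply: measurable_funM => //; apply: measurable_funM.
    exact: (measurableT_comp mT measurable_fst).
  apply: measurable_funM; first exact: (measurableT_comp mw measurable_snd).
  rewrite /k; apply: (@measurableT_comp _ _ _ _ _ _ (fun b : bool => b%:R : R)) => //.
  apply: measurable_fun_ler => //.
  by apply: measurableT_comp => //; apply: measurable_funB.
have F0 p : (0 <= F p)%E.
  by rewrite lee_fin mulr_ge0// mulr_ge0 ?tsum_ge0// mulr_ge0.
(* If |x - z| <= L then 1 + |z| <= (1 + L)(1 + |x|), so w x is at most (1 + L)^b times the mean of w
   over [x - L, x + L]. After exchanging the integrals, the inner one runs over a single period of
   [tsum]. *)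
apply: (@le_trans _ _ (\int[mu]_x \int[mu]_z F (x, z))%E).
  apply: ge0_le_integral => //.
  - by move=> x _; rewrite -EFinM lee_fin mulr_ge0 ?tsum_ge0.
  - by apply: emeasurable_funM; apply/measurable_EFinP.
  - exact: measurable_fun_fubini_tonelli_F.
  - move=> x _; rewrite -EFinM.
    apply: (@le_trans _ _ (\int[mu]_z (tsum (a * x + c) * w x / (L *+ 2) * k x z)%:E)%E).
      under eq_integral do rewrite EFinM.
      rewrite ge0_integralZl//; last 3 first.
      + apply/measurable_EFinP; exact: mk.
      + by move=> z _; rewrite lee_fin.
      + by rewrite lee_fin divr_ge0// mulr_ge0 ?tsum_ge0.
      under eq_integral do rewrite kE.
      rewrite integral_indic//= setIT lebesgue_measure_itv/= lte_fin.
      rewrite ifT; last by rewrite ltrD2l; move: L0; lra.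
      rewrite -EFinB -EFinM lee_fin (_ : x + L - (x - L) = L *+ 2); last first.
        by rewrite mulr2n; ring.
      by rewrite divfK.
    apply: ge0_le_integral => //.
    + by move=> z _; rewrite lee_fin mulr_ge0// divr_ge0// mulr_ge0 ?tsum_ge0.
    + apply/measurable_EFinP; apply: measurable_funM => //; exact: mk.
    + exact: (measurableT_comp mF (measurable_pair1 _)).
    + move=> z _; rewrite lee_fin/= [leRHS]mulrCA /C -!mulrA.
      rewrite ler_wpM2l ?tsum_ge0// /k; case: (leP `|x - z| L) => [xz|_]; last by rewrite !mulr0.
      rewrite !mulr1 [leRHS]mulrCA mulrC ler_wpM2l ?invr_ge0//.
      have p1 (y : R) : 0 < 1 + `|y| by rewrite ltr_wpDr.
      rewrite /w !powRN -[leRHS]/(_ / _) ler_pdivlMr ?powR_gt0//.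
      rewrite mulrC ler_pdivrMr ?powR_gt0// -powRM ?addr_ge0 ?(ltW L0)//.
      rewrite ge0_ler_powR ?nnegrE ?mulr_ge0 ?addr_ge0 ?(ltW L0) ?(ltW b0)//.
      have zx : `|z| <= `|x| + `|x - z|.
        by rewrite -[z in `|z|](subKr x) (le_trans (ler_normB _ _)).
      by have := mulr_ge0 (ltW L0) (normr_ge0 x); move: zx xz; lra.
rewrite fubini_tonelli//.
have -> : (\int[mu]_z \int[mu]_x F (x, z) =
   \int[mu]_z (((1 + L) `^ b * \sum_k0 g k0 ^+ 2)%:E * (w z)%:E))%E.
  apply: eq_integral => z _.
  transitivity (\int[mu]_x ((C * w z)%:E * ((tsum (a * x + c) * k z x)%:E)))%E.
    apply: eq_integral => x _; rewrite -EFinM /F/= kC; congr (_%:E); ring.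
  rewrite ge0_integralZl//; last 3 first.
  - apply/measurable_EFinP; apply: measurable_funM => //; exact: mk.
  - by move=> x _; rewrite lee_fin mulr_ge0 ?tsum_ge0.
  - by rewrite lee_fin mulr_ge0.
  have -> : (\int[mu]_x (tsum (a * x + c) * k z x)%:E =
    \int[mu]_(x in `[(z - L)%R, (z + L)%R]) (tsum (a * x + c))%:E)%E.
    rewrite [RHS]integral_mkcond; apply: eq_integral => x _.
    rewrite patchE kE indicE.
    by case: ifP => _; rewrite ?mulr1 ?mulr0.
  rewrite integral_tsum// -!EFinM; congr (_%:E); rewrite /C.
  have -> : pi *+ 2 / `|a| = L *+ 2 by rewrite /L !mulr2n mulrDl.
  move: L2'; move: (L *+ 2) => D D0; by field.
rewrite ge0_integralZl//.
- by apply/measurable_EFinP.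
- by move=> x _; rewrite lee_fin.
- by rewrite lee_fin mulr_ge0 ?powR_ge0// sumr_ge0// => k0 _; exact: sqr_ge0.
Qed.

End trigonometric_sums.

(** * Euclidean norm and inner product *)

Section euclidean_norm.
Context {R : realType} {d : nat}.
Implicit Types w rho : 'rV[R]_d.

Lemma dotpp_ge0 w : 0 <= dotp w w.
Proof. by apply: sumr_ge0 => i _; rewrite -expr2 sqr_ge0. Qed.

Lemma enorm_ge0 w : 0 <= enorm w.
Proof. exact: sqrtr_ge0. Qed.

Lemma sqr_enorm w : enorm w ^+ 2 = dotp w w.
Proof. by rewrite sqr_sqrtr// dotpp_ge0. Qed.

Lemma coord_le_enorm w j : `|w ord0 j| <= enorm w.
Proof.
rewrite -(@ler_pXn2r _ 2)// ?nnegrE ?enorm_ge0// sqr_enorm real_normK ?num_real//.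
rewrite /dotp (bigD1 j)//= -expr2 lerDl sumr_ge0// => i _.
by rewrite -expr2 sqr_ge0.
Qed.

Lemma enorm_scale (s : R) w : 0 <= s -> enorm (s *: w) = s * enorm w.
Proof.
move=> s0; rewrite /enorm (_ : dotp _ _ = s ^+ 2 * dotp w w).
  by rewrite sqrtrM ?sqr_ge0// sqrtr_sqr ger0_norm.
by rewrite /dotp mulr_sumr; apply: eq_bigr => i _; rewrite !mxE; ring.
Qed.

Lemma dotp_scaler rho (s : R) w : dotp rho (s *: w) = s * dotp rho w.
Proof. by rewrite /dotp mulr_sumr; apply: eq_bigr => i _; rewrite !mxE; ring. Qed.

Lemma dotp_scalel rho (s : R) w : dotp (s *: rho) w = s * dotp rho w.
Proof. by rewrite /dotp mulr_sumr; apply: eq_bigr => i _; rewrite !mxE; ring. Qed.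

Lemma dotpC rho w : dotp rho w = dotp w rho.
Proof. by apply: eq_bigr => i _; rewrite mulrC. Qed.

Lemma dotpBr rho w w' : dotp rho (w - w') = dotp rho w - dotp rho w'.
Proof. by rewrite /dotp -sumrB; apply: eq_bigr => i _; rewrite !mxE; ring. Qed.

Lemma dotpBl rho w w' : dotp (w - w') rho = dotp w rho - dotp w' rho.
Proof. by rewrite dotpC dotpBr !(dotpC rho). Qed.

(** Cauchy-Schwarz for a unit vector, from the nonnegativity of |w - (rho.w) rho|^2. *)
Lemma dotp_le_enorm rho w : enorm rho = 1 -> `|dotp rho w| <= enorm w.
Proof.
move=> rho1; have r1 : dotp rho rho = 1 by rewrite -sqr_enorm rho1 expr1n.
rewrite -(@ler_pXn2r _ 2)// ?nnegrE ?enorm_ge0// sqr_enorm real_normK ?num_real//.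
have : 0 <= dotp (w - dotp rho w *: rho) (w - dotp rho w *: rho) by exact: dotpp_ge0.
by rewrite dotpBl !dotpBr !dotp_scalel !dotp_scaler r1 (dotpC w rho) mulr1 subrr subr0 subr_ge0 expr2.
Qed.

Lemma measurable_enorm : measurable_fun setT (enorm : 'rV[R]_d -> R).
Proof.
apply: measurableT_comp; first exact: (continuous_measurable_fun (@sqrt_continuous R)).
apply: measurable_sum => i.
by apply: measurable_funM; exact: measurable_coord_rV.
Qed.

Lemma enorm_neq0_coord rho : enorm rho = 1 -> exists i, rho ord0 i != 0.
Proof.
move=> rho1; apply/existsP; apply: contraT; rewrite negb_exists => /forallP h.
have : enorm rho = 0.
  rewrite /enorm /dotp big1 ?sqrtr0// => i _.
  by have := h i; rewrite negbK => /eqP ->; rewrite mul0r.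
by rewrite rho1 => /eqP; rewrite oner_eq0.
Qed.

End euclidean_norm.

(** * Radial majorants and the uniform spectral bound *)

Section radial_majorants.
Context {R : realType} {d : nat} (beta : R).
Hypotheses (beta_gt0 : 0 < beta) (beta_lt2 : beta < 2) (beta_ltd : beta < d%:R).
Local Notation mu := (@lebesgue_measure R).
Local Notation leb := (@lebn R d).

(** Exponents per coordinate: d [wexp0] = d - beta and d [wexpy] = d + 2 - beta. A product of d
    factors thus has the order |w|^(beta-d) at 0 and |w|^(beta-d-2) at infinity, while [wexp0] < 1 <
    [wexpy] makes each factor integrable on the line. *)
Definition wexp0 : R := 1 - beta / d%:R.
Definition wexpy : R := 1 + (2 - beta) / d%:R.

Let d_gt0 : 0 < d%:R :> R. Proof. exact: lt_trans beta_gt0 beta_ltd. Qed.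

Lemma wexp0_ge0 : 0 <= wexp0.
Proof. by rewrite subr_ge0 ler_pdivrMr// mul1r ltW. Qed.

Lemma wexp0_lt1 : wexp0 < 1.
Proof. by rewrite gtrDl oppr_lt0 divr_gt0. Qed.

Lemma wexpy_gt1 : 1 < wexpy.
Proof. by rewrite ltrDl divr_gt0// subr_gt0. Qed.

Definition wt1 (r : R) : R := (1 + r) `^ (- wexpy).
Definition wt2 (r : R) : R := r `^ (- wexp0) * (1 + r) `^ (wexp0 - wexpy).

(* majK dominates the spectral density |xi|^(beta - d) (1 /\ |xi|^-2); majH has
   one factor without singularity and dominates the densities of the second
   differences. *)
Definition majK (w : 'rV[R]_d) : R := wt2 (enorm w) ^+ d.
Definition majH (w : 'rV[R]_d) : R := wt1 (enorm w) * wt2 (enorm w) ^+ d.-1.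

Lemma wt1_ge0 r : 0 <= wt1 r. Proof. exact: powR_ge0. Qed.
Lemma wt2_ge0 r : 0 <= wt2 r. Proof. by rewrite mulr_ge0// powR_ge0. Qed.
Lemma majK_ge0 w : 0 <= majK w. Proof. by rewrite exprn_ge0// wt2_ge0. Qed.
Lemma majH_ge0 w : 0 <= majH w.
Proof. by rewrite mulr_ge0 ?wt1_ge0// exprn_ge0// wt2_ge0. Qed.

Lemma measurable_wt1 dT (T : measurableType dT) (f : T -> R) :
  measurable_fun setT f -> measurable_fun setT (fun x => wt1 (f x)).
Proof. by move=> mf; apply: measurable_powRl; apply: measurable_funD. Qed.

Lemma measurable_wt2 dT (T : measurableType dT) (f : T -> R) :
  measurable_fun setT f -> measurable_fun setT (fun x => wt2 (f x)).
Proof.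
move=> mf; apply: measurable_funM; apply: measurable_powRl => //.
exact: measurable_funD.
Qed.

Lemma measurable_majK : measurable_fun setT majK.
Proof. by apply: measurable_funX; apply: measurable_wt2; exact: measurable_enorm. Qed.

Lemma measurable_majH : measurable_fun setT majH.
Proof.
apply: measurable_funM; first by apply: measurable_wt1; exact: measurable_enorm.
by apply: measurable_funX; apply: measurable_wt2; exact: measurable_enorm.
Qed.

Lemma powRN_anti (p x y : R) : 0 <= p -> 0 < x -> x <= y -> y `^ (- p) <= x `^ (- p).
Proof.
move=> p0 x0 xy; rewrite !powRN lef_pV2 ?posrE ?powR_gt0//; last exact: lt_le_trans xy.
by rewrite ge0_ler_powR// nnegrE ltW// (lt_le_trans x0).
Qed.

Lemma wt1_le (r x : R) : `|x| <= r -> wt1 r <= (1 + `|x|) `^ (- wexpy).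
Proof.
move=> xr; apply: powRN_anti; first by rewrite (le_trans ler01)// ltW// wexpy_gt1.
- by rewrite ltr_wpDr.
- by rewrite lerD2l.
Qed.

(** The weight decreases in r and each coordinate is at most |w|, so a radial factor is dominated by
    the same factor of any single coordinate. This turns a radial majorant into a product. *)
Lemma wt2_le (r x : R) : `|x| <= r -> ((wt2 r)%:E <= powq wexp0 wexpy x)%E.
Proof.
move=> xr; rewrite /powq; have [_|x0] := eqVneq x 0; first by rewrite leey.
have x0' : 0 < `|x| by rewrite normr_gt0.
rewrite lee_fin ler_pM ?powR_ge0//; first exact: powRN_anti wexp0_ge0 _ _.
rewrite -opprB; apply: powRN_anti.
- by rewrite subr_ge0 (le_trans (ltW wexp0_lt1))// ltW// wexpy_gt1.
- by rewrite ltr_wpDr.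
- by rewrite lerD2l.
Qed.

Let w1 (x : R) : \bar R := ((1 + `|x|) `^ (- wexpy))%:E.
Let w2 := powq wexp0 wexpy.

Let mw1 : measurable_fun setT w1.
Proof. by apply/measurable_EFinP; apply: measurable_powRl; exact: measurable_funD. Qed.

Let w1_ge0 x : (0 <= w1 x)%E. Proof. by rewrite lee_fin powR_ge0. Qed.

Lemma integral_w1 : (\int[mu]_x w1 x < +oo)%E.
Proof.
apply: le_lt_trans (@integral_powq R 0 wexpy (lexx 0) ltr01 wexpy_gt1).
apply: ge0_le_integral => //.
- exact: measurable_powq.
- move=> x _; rewrite /powq; case: ifP => _; first by rewrite leey.
  by rewrite oppr0 powRr0 mul1r sub0r.
Qed.

Lemma integral_w2 : (\int[mu]_x w2 x < +oo)%E.
Proof. exact: integral_powq wexp0_ge0 wexp0_lt1 wexpy_gt1. Qed.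

Lemma le_prod_EFin n (f : 'I_n -> R) (g : 'I_n -> \bar R) :
  (forall j, 0 <= f j) -> (forall j, (f j)%:E <= g j)%E ->
  ((\prod_j f j)%:E <= \prod_j g j)%E.
Proof.
move=> f0 fg.
suff /andP[] : (0 <= \prod_j f j) && ((\prod_j f j)%:E <= \prod_j g j)%E by [].
elim/big_rec2 : _ => [|j y x _ /andP[x0 xy]]; first by rewrite ler01 lexx.
by rewrite mulr_ge0//= EFinM lee_pmul// lee_fin.
Qed.

Lemma majK_le_prod w : ((majK w)%:E <= \prod_(j < d) w2 (w ord0 j))%E.
Proof.
rewrite /majK -{2}(card_ord d) -prodr_const.
apply: le_prod_EFin => j; [exact: wt2_ge0|apply: wt2_le; exact: coord_le_enorm].
Qed.

Let wsel (i : 'I_d) (j : 'I_d) : R -> \bar R := if j == i then w1 else w2.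

Let mwsel i j : measurable_fun setT (wsel i j).
Proof. by rewrite /wsel; case: ifP => _ //; exact: measurable_powq. Qed.

Let wsel_ge0 i j x : (0 <= wsel i j x)%E.
Proof. by rewrite /wsel; case: ifP => _ //; exact: powq_ge0. Qed.

(** The factor without singularity may be assigned to any chosen coordinate i. *)
Lemma majH_le_prod (i : 'I_d) w :
  ((majH w)%:E <= \prod_(j < d) wsel i j (w ord0 j))%E.
Proof.
have -> : majH w = \prod_(j < d) (if j == i then wt1 (enorm w) else wt2 (enorm w)).
  rewrite (bigD1 i)//= eqxx /majH; congr (_ * _).
  rewrite (eq_bigr (fun=> wt2 (enorm w))) => [|j /negbTE ->//].
  by rewrite prodr_const cardC1 card_ord.
apply: le_prod_EFin => j; rewrite /wsel; case: ifP => _.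
- exact: wt1_ge0.
- exact: wt2_ge0.
- by rewrite lee_fin; apply: wt1_le; exact: coord_le_enorm.
- by apply: wt2_le; exact: coord_le_enorm.
Qed.

Lemma eprod_lty n (g : 'I_n -> \bar R) : (forall j, 0 <= g j < +oo)%E ->
  (\prod_j g j < +oo)%E.
Proof.
move=> g01; suff /andP[] : (0 <= \prod_j g j)%E && (\prod_j g j < +oo)%E by [].
elim/big_ind : _ => [|x y /andP[x0 xy] /andP[y0 yy]|j _]; last exact: g01.
  by rewrite lee_fin ler01 ltry.
rewrite mule_ge0//=; apply: lte_mul_pinfty => //.
by rewrite ge0_fin_numE.
Qed.

Lemma integrable_majK : leb.-integrable setT (EFin \o majK).
Proof.
apply/integrableP; split; first by apply/measurable_EFinP; exact: measurable_majK.
apply: (@le_lt_trans _ _ (\int[leb]_w \prod_(j < d) w2 (w ord0 j))%E).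
  apply: ge0_le_integral => //.
  - by apply: measurableT_comp => //; apply/measurable_EFinP; exact: measurable_majK.
  - by apply: (@measurable_eprod_rV R d (fun=> w2)) => j; exact: measurable_powq.
  - by move=> w _ /=; rewrite ger0_norm ?majK_ge0//; exact: majK_le_prod.
rewrite (@integral_lebn_prod R d (fun=> w2)).
- by apply: eprod_lty => j; rewrite integral_w2 integral_ge0// => x _; exact: powq_ge0.
- by move=> j; exact: measurable_powq.
- by move=> j x; exact: powq_ge0.
Qed.

Let d0 : 'I_d.
Proof. by exists 0%N; move: d_gt0; rewrite ltr0n. Qed.

Lemma integrable_majH : leb.-integrable setT (EFin \o majH).
Proof.
apply/integrableP; split; first by apply/measurable_EFinP; exact: measurable_majH.
apply: (@le_lt_trans _ _ (\int[leb]_w \prod_(j < d) wsel d0 j (w ord0 j))%E).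
  apply: ge0_le_integral => //.
  - by apply: measurableT_comp => //; apply/measurable_EFinP; exact: measurable_majH.
  - exact: (@measurable_eprod_rV R d (wsel d0)).
  - by move=> w _ /=; rewrite ger0_norm ?majH_ge0//; exact: majH_le_prod.
rewrite (@integral_lebn_prod R d (wsel d0))//.
apply: eprod_lty => j; rewrite integral_ge0//= /wsel; case: ifP => _.
- exact: integral_w1.
- exact: integral_w2.
Qed.

(** Some coordinate of rho is nonzero, say the i-th. Give it the nonsingular weight and integrate
    along it first: there [tsum] is periodic, and [integral_tsum_weight] bounds the slice uniformly
    in the other coordinates, whose weights have finite integrals. In other words, the image of
    [majH] dw under w -> rho.w, wrapped modulo 2 pi, has a bounded density. *)
Lemma spectral_bound (rho : 'rV[R]_d) : enorm rho = 1 ->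
  exists2 M : R, 0 <= M & forall N (g : 'I_N -> R),
  (\int[leb]_w (tsum g (dotp rho w) * majH w)%:E <= (M * \sum_k g k ^+ 2)%:E)%E.
Proof.
move=> /enorm_neq0_coord[i ri].
pose a := rho ord0 i.
pose J := fine (\int[mu]_x w1 x).
have J0 : 0 <= J by apply: fine_ge0; exact: integral_ge0.
have JE : (\int[mu]_x w1 x = J%:E)%E.
  by rewrite fineK// ge0_fin_numE ?integral_w1//; exact: integral_ge0.
pose Q := fine (\prod_(j < d | j != i) \int[mu]_x wsel i j x)%E.
have q_lty j : (0 <= \int[mu]_x wsel i j x < +oo)%E.
  rewrite integral_ge0//= /wsel; case: ifP => _; [exact: integral_w1|exact: integral_w2].
have QE : (\prod_(j < d | j != i) \int[mu]_x wsel i j x)%E = Q%:E.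
  rewrite fineK//; elim/big_ind : _ => // [x y|j _]; first exact: fin_numM.
  by case/andP: (q_lty j) => *; rewrite ge0_fin_numE.
have Q0 : 0 <= Q.
  apply: fine_ge0; elim/big_ind : _ => // [x y|j _]; first exact: mule_ge0.
  by case/andP: (q_lty j).
exists ((1 + pi / `|a|) `^ wexpy * J * Q) => [|N g].
  by rewrite !mulr_ge0// powR_ge0.
have S0 : 0 <= \sum_k g k ^+ 2 by apply: sumr_ge0 => k _; exact: sqr_ge0.
pose K := ((1 + pi / `|a|) `^ wexpy * (\sum_k g k ^+ 2) * J)%:E.
have K0 : (0 <= K)%E.
  rewrite /K lee_fin; apply: mulr_ge0 => //; apply: mulr_ge0 => //; exact: powR_ge0.
have mU : measurable_fun setT (EFin \o tsum g) by apply/measurable_EFinP; exact: measurable_tsum.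
have U0 x : (0 <= (EFin \o tsum g) x)%E by rewrite lee_fin tsum_ge0.
have h := @slice_integral_le R d (wsel i) (EFin \o tsum g) K rho i 0
  (mwsel i) (wsel_ge0 i) mU U0 K0.
apply: (@le_trans _ _ (\prod_j (if j == i then K else \int[mu]_x wsel i j x))%E).
  apply: le_trans (h _).
    apply: ge0_le_integral => //.
    - by move=> w _; rewrite lee_fin mulr_ge0 ?tsum_ge0 ?majH_ge0.
    - apply/measurable_EFinP; apply: measurable_funM; last exact: measurable_majH.
      by apply: (measurableT_comp (measurable_tsum g)); exact: measurable_dotp.
    - apply: emeasurable_funM; last exact: (@measurable_eprod_rV R d (wsel i)).
      apply: (measurableT_comp mU); apply: measurable_funD => //; exact: measurable_dotp.
    - move=> w _; rewrite EFinM addr0; apply: lee_wpmul2l.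
        by rewrite lee_fin tsum_ge0.
      exact: majH_le_prod.
  move=> c; rewrite /wsel eqxx /K EFinM -JE.
  by apply: integral_tsum_weight => //; rewrite (lt_trans ltr01) ?wexpy_gt1.
rewrite (bigD1 i)//= eqxx (eq_bigr (fun j => \int[mu]_x wsel i j x)%E); last first.
  by move=> j /negbTE ->.
by rewrite QE -EFinM lee_fin; rewrite le_eqVlt; apply/orP; left; apply/eqP; rewrite /K; ring.
Qed.

End radial_majorants.

(** * Integrals of real functions, with values in R *)

Section real_integrals.
Context {R : realType} {d : measure_display} {T : measurableType d}.
Variable m : {measure set T -> \bar R}.
Implicit Types f g : T -> R.

Definition rintegrable f := m.-integrable setT (EFin \o f).
Definition rint f : R := Rintegral m setT f.

Lemma rintegrable_measurable f : rintegrable f -> measurable_fun setT f.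
Proof. by move=> /integrableP[mf _]; apply/measurable_EFinP. Qed.

Lemma rintegrable_le f g : measurable_fun setT f ->
  (forall x, `|f x| <= g x) -> rintegrable g -> rintegrable f.
Proof.
move=> mf fg ig; apply: le_integrable ig => //; first exact/measurable_EFinP.
by move=> x _; rewrite /= lee_fin (le_trans (fg x))// ler_norm.
Qed.

Lemma rintegrableD f g : rintegrable f -> rintegrable g ->
  rintegrable (fun x => f x + g x).
Proof. exact: integrableD. Qed.

Lemma rintegrableZ (k : R) f : rintegrable f -> rintegrable (fun x => k * f x).
Proof. exact: integrableZl. Qed.

Lemma rintegrableB f g : rintegrable f -> rintegrable g ->
  rintegrable (fun x => f x - g x).
Proof. exact: integrableB. Qed.

Lemma rintegrable_norm f : rintegrable f -> rintegrable (fun x => `|f x|).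
Proof. exact: integrable_norm. Qed.

Lemma rintegrable0 : rintegrable (fun=> 0).
Proof. exact: integrable0. Qed.

Lemma rintegrable_sum I (s : seq I) (P : pred I) (f : I -> T -> R) :
  (forall i, P i -> rintegrable (f i)) ->
  rintegrable (fun x => \sum_(i <- s | P i) f i x).
Proof.
move=> h; elim: s => [|i s IH].
  by under eq_fun do rewrite big_nil; exact: rintegrable0.
have [Pi|/negbTE Pi] := boolP (P i); under eq_fun do rewrite big_cons Pi.
  exact: rintegrableD (h i Pi) IH.
exact: IH.
Qed.

Lemma eq_rint f g : f =1 g -> rint f = rint g.
Proof. by move=> fg; rewrite /rint; apply: eq_Rintegral => x _; exact: fg. Qed.

Lemma rintD f g : rintegrable f -> rintegrable g ->
  rint (fun x => f x + g x) = rint f + rint g.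
Proof. exact: RintegralD. Qed.

Lemma rintB f g : rintegrable f -> rintegrable g ->
  rint (fun x => f x - g x) = rint f - rint g.
Proof. exact: RintegralB. Qed.

Lemma rintZ (k : R) f : rintegrable f -> rint (fun x => k * f x) = k * rint f.
Proof. by move=> ?; exact: RintegralZl. Qed.

Lemma rint0 : rint (fun=> 0) = 0.
Proof. by rewrite /rint /Rintegral integral0. Qed.

Lemma rint_sum I (s : seq I) (P : pred I) (f : I -> T -> R) :
  (forall i, P i -> rintegrable (f i)) ->
  rint (fun x => \sum_(i <- s | P i) f i x) = \sum_(i <- s | P i) rint (f i).
Proof.
move=> h; elim: s => [|i s IH].
  by rewrite big_nil -[RHS]rint0; apply: eq_rint => x; rewrite big_nil.
rewrite big_cons -IH; case: ifPn => Pi.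
  rewrite -rintD; [|exact: h|exact: rintegrable_sum].
  by apply: eq_rint => x; rewrite big_cons Pi.
by apply: eq_rint => x; rewrite big_cons (negbTE Pi).
Qed.

Lemma le_rint f g : rintegrable f -> rintegrable g -> (forall x, f x <= g x) ->
  rint f <= rint g.
Proof. by move=> ? ? fg; apply: le_Rintegral => // x _; exact: fg. Qed.

Lemma rint_ge0 f : (forall x, 0 <= f x) -> 0 <= rint f.
Proof. by move=> f0; apply: Rintegral_ge0. Qed.

Lemma le_rint_bound f g : measurable_fun setT f -> (forall x, `|f x| <= g x) ->
  rintegrable g -> `|rint f| <= rint g.
Proof.
move=> mf fg ig; have intf := rintegrable_le mf fg ig.
apply: (le_trans (le_normr_Rintegral measurableT intf)).
by apply: le_rint => //; exact: rintegrable_norm.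
Qed.

Lemma rintE f : rintegrable f -> (\int[m]_x (f x)%:E = (rint f)%:E)%E.
Proof.
by move=> intf; rewrite /rint /Rintegral fineK//; exact: integrable_fin_num.
Qed.

Lemma rint_le_ereal f (r : R) : rintegrable f ->
  (\int[m]_x (f x)%:E <= r%:E)%E -> rint f <= r.
Proof. by move=> intf; rewrite rintE// lee_fin. Qed.

End real_integrals.

(** * Fourier coefficients along rho: Toeplitz forms and square summability *)

Section fourier_coefficients.
Context {R : realType} {d : nat} (beta : R).
Hypotheses (beta_gt0 : 0 < beta) (beta_lt2 : beta < 2) (beta_ltd : beta < d%:R).
Variable rho : 'rV[R]_d.
Hypothesis rho1 : enorm rho = 1.
Local Notation leb := (@lebn R d).
Local Notation H := (majH beta : 'rV[R]_d -> R).

(** At an integer y this is a Fourier coefficient of the image of G dw under w -> rho.w, wrapped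
    modulo 2 pi. *)
Definition fco (G : 'rV[R]_d -> R) (y : R) : R :=
  rint leb (fun w => cos (y * dotp rho w) * G w).

Lemma fcoN G y : fco G (- y) = fco G y.
Proof. by apply: eq_rint => w; rewrite mulNr cosN. Qed.

Lemma measurable_cos_dotp y : measurable_fun setT (fun w => cos (y * dotp rho w)).
Proof.
apply: measurableT_comp; first exact: (continuous_measurable_fun (@continuous_cos R)).
by apply: measurable_funM => //; exact: measurable_dotp.
Qed.

Section coefficients.
Variables (G : 'rV[R]_d -> R) (C : R).
Hypotheses (mG : measurable_fun setT G) (GC : forall w, `|G w| <= C * H w).

Lemma rintegrable_dominated : rintegrable leb G.
Proof.
apply: (rintegrable_le mG GC); apply: rintegrableZ.
exact: integrable_majH.
Qed.

Lemma rintegrable_cos_dominated y :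
  rintegrable leb (fun w => cos (y * dotp rho w) * G w).
Proof.
apply: (rintegrable_le _ _ (rintegrable_norm rintegrable_dominated)).
  by apply: measurable_funM => //; exact: measurable_cos_dotp.
by move=> w; rewrite normrM ler_piMl// cos_max.
Qed.

Lemma rintegrable_tsum_majH N (g : 'I_N -> R) :
  rintegrable leb (fun w => tsum g (dotp rho w) * H w).
Proof.
apply/integrableP; split.
  apply/measurable_EFinP; apply: measurable_funM; last exact: measurable_majH.
  by apply: (measurableT_comp (measurable_tsum g)); exact: measurable_dotp.
have [M M0 hM] := spectral_bound beta_gt0 beta_lt2 beta_ltd rho1.
apply: le_lt_trans (ltry (M * \sum_k g k ^+ 2)).
apply: le_trans (hM N g); rewrite le_eqVlt; apply/orP; left; apply/eqP.
apply: eq_integral => w _; rewrite /= ger0_norm// mulr_ge0 ?tsum_ge0//.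
exact: majH_ge0.
Qed.

Lemma fco_quadratic_form N (g : 'I_N -> R) :
  \sum_j \sum_k g j * g k * fco G (j%:R - k%:R) =
  rint leb (fun w => tsum g (dotp rho w) * G w).
Proof.
have intjk j k : rintegrable leb
    (fun w => g j * g k * (cos ((j%:R - k%:R) * dotp rho w) * G w)).
  exact/rintegrableZ/rintegrable_cos_dominated.
transitivity (rint leb (fun w => \sum_j \sum_k
    g j * g k * (cos ((j%:R - k%:R) * dotp rho w) * G w))).
  rewrite rint_sum => [|j _]; last by apply: rintegrable_sum.
  apply: eq_bigr => j _; rewrite rint_sum//; apply: eq_bigr => k _.
  by rewrite rintZ//; exact: rintegrable_cos_dominated.
apply: eq_rint => w; rewrite tsumE mulr_suml; apply: eq_bigr => j _.
by rewrite mulr_suml; apply: eq_bigr => k _; rewrite mulrA.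
Qed.

End coefficients.

(** The first claim bounds the Toeplitz matrix of the coefficients of G in operator norm. The second
    is Bessel's inequality by duality: with g_k the k-th coefficient, the sum of squares S is the
    integral of G times a trigonometric sum with coefficients g_k, whose square integrates against
    [majH] to at most M S. *)
Lemma fco_bound (M : R) : 0 < M ->
  (forall N (g : 'I_N -> R),
   (\int[leb]_w (tsum g (dotp rho w) * H w)%:E <= (M * \sum_k g k ^+ 2)%:E)%E) ->
  forall (G : 'rV[R]_d -> R) (C : R), 0 <= C ->
  measurable_fun setT G -> (forall w, `|G w| <= C * H w) ->
  (forall N (g : 'I_N -> R), 
    \sum_j \sum_k g j * g k * fco G (j%:R - k%:R) <= C * M * \sum_k g k ^+ 2) /\
  (forall N, \sum_(k < N) fco G k%:R ^+ 2 <= C ^+ 2 * M * rint leb H).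
Proof.
move=> M0 hM G C C0 mG GC.
have hM' N (g : 'I_N -> R) :
    rint leb (fun w => tsum g (dotp rho w) * H w) <= M * \sum_k g k ^+ 2.
  by apply: rint_le_ereal => //; exact: rintegrable_tsum_majH.
split=> [N g|N].
  rewrite (fco_quadratic_form mG GC) -mulrA (le_trans _ (ler_wpM2l C0 (hM' N g)))//.
  rewrite -rintZ; last exact: rintegrable_tsum_majH.
  apply: le_trans (ler_norm _) _; apply: le_rint_bound.
  - apply: measurable_funM => //.
    by apply: (measurableT_comp (measurable_tsum g)); exact: measurable_dotp.
  - move=> w; rewrite normrM ger0_norm ?tsum_ge0// mulrCA.
    by rewrite ler_wpM2l ?tsum_ge0.
  - exact/rintegrableZ/rintegrable_tsum_majH.
pose S := \sum_(k < N) fco G k%:R ^+ 2.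
pose g (k : 'I_N) := fco G k%:R.
have intH : rintegrable leb H by exact: integrable_majH.
(* Young's inequality |A| <= (tau A^2 + 1/tau)/2 in place of Cauchy-Schwarz. *)
have key (tau : R) : 0 < tau ->
    S <= C / 2 * (tau * (M * S) + tau^-1 * rint leb H).
  move=> tau0.
  have SE : S = rint leb (fun w => \sum_k g k * (cos (k%:R * dotp rho w) * G w)).
    rewrite rint_sum => [|k _]; last exact/rintegrableZ/(rintegrable_cos_dominated mG GC).
    apply: eq_bigr => k _; rewrite rintZ ?expr2//.
    exact: (rintegrable_cos_dominated mG GC).
  rewrite {1}SE.
  apply: (@le_trans _ _ (rint leb (fun w => C / 2 *
      (tau * (tsum g (dotp rho w) * H w) + tau^-1 * H w)))); last first.
    rewrite rintZ; last first.
      by apply: rintegrableD; apply: rintegrableZ => //; exact: rintegrable_tsum_majH.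
    rewrite ler_wpM2l ?divr_ge0// rintD; last 2 first.
    - by apply: rintegrableZ; exact: rintegrable_tsum_majH.
    - exact: rintegrableZ.
    rewrite !rintZ//; last exact: rintegrable_tsum_majH.
    by rewrite lerD2r ler_wpM2l ?(ltW tau0)//; exact: (hM' N g).
  apply: le_rint.
  - by apply: rintegrable_sum => k _; exact/rintegrableZ/(rintegrable_cos_dominated mG GC).
  - apply: rintegrableZ; apply: rintegrableD; apply: rintegrableZ => //.
    exact: rintegrable_tsum_majH.
  - move=> w; set A := \sum_k g k * cos (k%:R * dotp rho w).
    have -> : \sum_k g k * (cos (k%:R * dotp rho w) * G w) = A * G w.
      by rewrite /A mulr_suml; apply: eq_bigr => k _; rewrite mulrA.
    have AT : A ^+ 2 <= tsum g (dotp rho w) by rewrite lerDl sqr_ge0.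
    apply: (le_trans (ler_norm _)); rewrite normrM.
    apply: (@le_trans _ _ (`|A| * (C * H w))); first by rewrite ler_wpM2l.
    have AM : `|A| <= 2^-1 * (tau * A ^+ 2 + tau^-1).
      have : 0 <= tau^-1 * (tau * `|A| - 1) ^+ 2.
        by rewrite mulr_ge0 ?invr_ge0 ?(ltW tau0)// sqr_ge0.
      have -> : tau^-1 * (tau * `|A| - 1) ^+ 2 = tau * `|A| ^+ 2 - 2 * `|A| + tau^-1.
        by field; rewrite gt_eqF.
      rewrite real_normK ?num_real//; lra.
    have H0 : 0 <= H w by exact: majH_ge0.
    have CH0 : 0 <= C * H w by rewrite mulr_ge0.
    apply: (le_trans (ler_wpM2r CH0 AM)).
    have : tau * A ^+ 2 <= tau * tsum g (dotp rho w) by rewrite ler_wpM2l ?(ltW tau0).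
    move=> /(ler_wpM2r CH0); lra.
have hlin (x y : R) : x <= x / 2 + y / 2 -> x <= y by lra.
move: C0; rewrite le_eqVlt => /predU1P[C0|C0].
  by have := key 1 ltr01; rewrite -C0 mul0r expr0n !mul0r.
(* The choice tau = 1/(C M) turns the term containing S into S/2, which is absorbed on the left. *)
have CM0 : 0 < C * M by rewrite mulr_gt0.
have := key (C * M)^-1; rewrite invr_gt0 => /(_ CM0).
rewrite invrK (_ : C / 2 * _ = S / 2 + C ^+ 2 * M * rint leb H / 2); last first.
  by field; rewrite !gt_eqF.
exact: hlin.
Qed.

End fourier_coefficients.

(** * Fubini for integrands dominated by a product *)

Section dominated_fubini.
Context {R : realType} {d1 d2 : measure_display}
  {T1 : measurableType d1} {T2 : measurableType d2}.
Variables (m1 : {sigma_finite_measure set T1 -> \bar R})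
  (m2 : {sigma_finite_measure set T2 -> \bar R}).
Variables (f : T1 * T2 -> R) (h1 : T1 -> R) (h2 : T2 -> R).
Hypotheses (mf : measurable_fun setT f) (ih1 : rintegrable m1 h1)
  (ih2 : rintegrable m2 h2) (fh : forall p, `|f p| <= h1 p.1 * h2 p.2).

Lemma rintegrable_section1 y : rintegrable m1 (fun x => f (x, y)).
Proof.
apply: (@rintegrable_le _ _ _ m1 _ (fun x => h2 y * h1 x)).
- exact: (measurableT_comp mf (measurable_pair2 y)).
- by move=> x; rewrite mulrC; exact: (fh (x, y)).
- exact: rintegrableZ.
Qed.

Lemma rintegrable_section2 x : rintegrable m2 (fun y => f (x, y)).
Proof.
apply: (@rintegrable_le _ _ _ m2 _ (fun y => h1 x * h2 y)).
- exact: (measurableT_comp mf (measurable_pair1 x)).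
- by move=> y; exact: (fh (x, y)).
- exact: rintegrableZ.
Qed.

Let intf : (m1 \x m2)%E.-integrable setT (EFin \o f).
Proof.
apply/integrable12ltyP; first exact/measurable_EFinP.
apply: (@le_lt_trans _ _ (\int[m1]_x (h1 x * rint m2 h2)%:E)%E).
  apply: ge0_le_integral => //.
  - by move=> x _; apply: integral_ge0.
  - apply: (@measurable_fun_fubini_tonelli_F _ _ _ _ _ m2 (fun p => `|(f p)%:E|%E)) => //.
    by apply: measurableT_comp => //; exact/measurable_EFinP.
  - apply/measurable_EFinP; apply: measurable_funM => //.
    exact: (rintegrable_measurable ih1).
  - move=> x _.
    apply: (@le_trans _ _ (\int[m2]_y (h1 x * h2 y)%:E)%E).
      apply: ge0_le_integral => //.
      + apply: measurableT_comp => //; apply/measurable_EFinP.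
        exact: (measurableT_comp mf (measurable_pair1 x)).
      + apply/measurable_EFinP; apply: measurable_funM => //.
        exact: (rintegrable_measurable ih2).
      + by move=> y _; rewrite /= lee_fin; exact: (fh (x, y)).
    by rewrite rintE ?rintZ//; exact: rintegrableZ.
rewrite (_ : \int[m1]_x _ = (rint m1 (fun x => h1 x * rint m2 h2))%:E)%E ?ltry//.
rewrite -rintE//; under eq_fun do rewrite mulrC; exact: rintegrableZ.
Qed.

Lemma rint_fubini : rint m1 (fun x => rint m2 (fun y => f (x, y))) =
  rint m2 (fun y => rint m1 (fun x => f (x, y))).
Proof.
have := Fubini intf => /= h.
rewrite /rint [LHS]/Rintegral [RHS]/Rintegral; congr fine.
transitivity (\int[m1]_x \int[m2]_y (f (x, y))%:E)%E.
  by apply: eq_integral => x _; rewrite rintE//; exact: rintegrable_section2.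
by rewrite h; apply: eq_integral => y _; rewrite rintE//; exact: rintegrable_section1.
Qed.

Lemma rintegrable_fubini2 : rintegrable m2 (fun y => rint m1 (fun x => f (x, y))).
Proof.
apply: (@rintegrable_le _ _ _ m2 _ (fun y => rint m1 h1 * h2 y)).
- apply/measurable_EFinP.
  apply: (@eq_measurable_fun _ _ _ _ _ (fubini_G m1 (EFin \o f))).
    by move=> y _; rewrite /fubini_G/= rintE//; exact: rintegrable_section1.
  exact: measurable_fubini_G intf.
- move=> y; rewrite mulrC -rintZ//; apply: le_rint_bound.
  + exact: rintegrable_measurable (rintegrable_section1 y).
  + by move=> x; rewrite mulrC; exact: (fh (x, y)).
  + exact: rintegrableZ.
- exact: rintegrableZ.
Qed.

Lemma rintegrable_fubini1 : rintegrable m1 (fun x => rint m2 (fun y => f (x, y))).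
Proof.
have := @integrable_fubini_F _ _ _ _ _ m1 m2 (EFin \o f) intf.
apply: eq_integrable => // x _.
by rewrite /fubini_F/= rintE//; exact: rintegrable_section2.
Qed.

End dominated_fubini.

(** * Pointwise domination by the radial majorants *)

Section domination.
Context {R : realType}.

Lemma sin_le_norm (x : R) : `|sin x| <= `|x|.
Proof.
wlog x0 : x / 0 <= x => [h|].
  have [|/ltW x0] := leP 0 x; first exact: h.
  by rewrite -normrN -sinN -[leRHS]normrN; apply: h; rewrite oppr_ge0.
have [c _] : exists2 c, c \in `[0, x]%R & sin x - sin 0 = cos c * (x - 0).
  apply: MVT_segment => //; apply: continuous_subspaceT; exact: continuous_sin.
by rewrite sin0 !subr0 => ->; rewrite normrM ler_piMl// cos_max.
Qed.

Lemma powR_exprn (x p : R) n : (x `^ p) ^+ n = x `^ (p * n%:R).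
Proof. by rewrite powRrM powR_mulrn// powR_ge0. Qed.

(** Near 0 the factor 1 + r is at most 2, and for r >= 1 it is at most 2 r; both cost at most
    2^s. *)
Lemma powR_le_weight (q s p f r : R) : 0 < r -> 0 <= s -> - q <= p ->
  (r < 1 -> f <= r `^ p) -> (1 <= r -> f <= r `^ (- (q + s))) ->
  f <= 2 `^ s * (r `^ (- q) * (1 + r) `^ (- s)).
Proof.
move=> r0 s0 qp fnear ffar; have r0' := ltW r0.
have [r1|r1] := ltP r 1.
  apply: (le_trans (fnear r1)); apply: (@le_trans _ _ (r `^ (- q))).
    by apply: ger_powR => //; rewrite r0/= ltW.
  rewrite mulrCA ler_peMr ?powR_ge0// powRN -[_ * _]/(_ / _) ler_pdivlMr; last first.
    by rewrite powR_gt0// addr_gt0.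
  rewrite mul1r ge0_ler_powR ?nnegrE ?addr_ge0//.
  by rewrite (_ : 2 = 1 + 1)// lerD2l ltW.
apply: (le_trans (ffar r1)); rewrite opprD powRD; last by rewrite (gt_eqF r0) implybT.
rewrite mulrCA ler_wpM2l ?powR_ge0// !powRN -[leRHS]/(_ / _) ler_pdivlMr; last first.
  by rewrite powR_gt0// addr_gt0.
rewrite mulrC ler_pdivrMr ?powR_gt0// -powRM// ge0_ler_powR ?nnegrE ?addr_ge0 ?mulr_ge0//.
by rewrite mulr_natl mulr2n lerD2r.
Qed.

End domination.

Section densities.
Context {R : realType} {d : nat} (beta : R).
Hypotheses (beta_gt0 : 0 < beta) (beta_lt2 : beta < 2) (beta_ltd : beta < d%:R).
Variable rho : 'rV[R]_d.
Hypothesis rho1 : enorm rho = 1.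
Local Notation leb := (@lebn R d).
Local Notation wa := (wexp0 (d := d) beta).
Local Notation wb := (wexpy (d := d) beta).

Let d_gt0 : 0 < d%:R :> R. Proof. exact: lt_trans beta_gt0 beta_ltd. Qed.

Let d1E : (d.-1)%:R = d%:R - 1 :> R.
Proof. by move: d_gt0; rewrite ltr0n => d0; rewrite -subn1 natrB. Qed.

(** [majH] and [majK] have the form |w|^(-q) (1 + |w|)^(-s). In both cases q + s = d + 2 - beta
    gives the decay at infinity. *)
Let qH := wa * (d%:R - 1).
Let sH := wb + (wb - wa) * (d%:R - 1).
Let qK := wa * d%:R.
Let sK := (wb - wa) * d%:R.

Let wab : wa < wb.
Proof. by rewrite (lt_trans (wexp0_lt1 beta_gt0 beta_ltd))// wexpy_gt1. Qed.

Let d1_ge0 : 0 <= d%:R - 1 :> R. Proof. by rewrite -d1E. Qed.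

Let sH_ge0 : 0 <= sH.
Proof.
rewrite addr_ge0//; first by rewrite (le_trans ler01)// ltW// wexpy_gt1.
by rewrite mulr_ge0// subr_ge0 ltW.
Qed.

Let sK_ge0 : 0 <= sK.
Proof. by rewrite mulr_ge0 ?(ltW d_gt0)// subr_ge0 ltW. Qed.

Let qsH : qH + sH = d%:R + 2 - beta.
Proof. by rewrite /qH /sH /wexp0 /wexpy; field; rewrite gt_eqF. Qed.

Let qsK : qK + sK = d%:R + 2 - beta.
Proof. by rewrite /qK /sK /wexp0 /wexpy; field; rewrite gt_eqF. Qed.

Let qK_E : - qK = beta - d%:R.
Proof. by rewrite /qK /wexp0; field; rewrite gt_eqF. Qed.

Let qH_le : - qH <= beta + 1 - d%:R.
Proof.
have -> : - qH = beta + 1 - d%:R - beta / d%:R.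
  by rewrite /qH /wexp0; field; rewrite gt_eqF.
by rewrite gerDl oppr_le0 divr_ge0 ?ltW.
Qed.

Let majHE (w : 'rV[R]_d) :
  majH beta w = enorm w `^ (- qH) * (1 + enorm w) `^ (- sH).
Proof.
have r0 : 0 < 1 + enorm w by rewrite ltr_wpDr ?enorm_ge0.
rewrite /majH /wt1 /wt2 exprMn !powR_exprn d1E mulrCA -powRD ?(gt_eqF r0) ?implybT//.
by congr (_ `^ _ * _ `^ _); rewrite /qH /sH; ring.
Qed.

Let majKE (w : 'rV[R]_d) :
  majK beta w = enorm w `^ (- qK) * (1 + enorm w) `^ (- sK).
Proof.
rewrite /majK /wt2 exprMn !powR_exprn.
by congr (_ `^ _ * _ `^ _); rewrite /qK /sK; ring.
Qed.

Definition constH : R := 2 `^ sH.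
Definition constK : R := 2 `^ sK.

Lemma constH_ge0 : 0 <= constH. Proof. exact: powR_ge0. Qed.
Lemma constK_ge0 : 0 <= constK. Proof. exact: powR_ge0. Qed.

(** At the origin [majH] has order |w|^(beta + 1 - d - beta/d). Giving up one singular factor thus
    demands from f an extra power of |w| near 0, up to the slack beta/d. *)
Lemma le_majH (p f : R) (w : 'rV[R]_d) : beta + 1 - d%:R <= p ->
  (enorm w = 0 -> f <= 0) ->
  (enorm w < 1 -> f <= enorm w `^ p) ->
  (1 <= enorm w -> f <= enorm w `^ (beta - d%:R - 2)) ->
  f <= constH * majH beta w.
Proof.
move=> hp f0 fnear ffar; have [r0|r0] := eqVneq (enorm w) 0.
  by rewrite (le_trans (f0 r0))// mulr_ge0 ?constH_ge0// majH_ge0.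
rewrite majHE; apply: (@powR_le_weight _ _ _ p) => //.
- by rewrite lt_neqAle eq_sym r0 enorm_ge0.
- exact: le_trans hp.
- by rewrite qsH (_ : - _ = beta - d%:R - 2)//; ring.
Qed.

(** With all d singular factors kept, the order |w|^(beta-d) at the origin is admissible. *)
Lemma le_majK (p f : R) (w : 'rV[R]_d) : beta - d%:R <= p ->
  (enorm w = 0 -> f <= 0) ->
  (enorm w < 1 -> f <= enorm w `^ p) ->
  (1 <= enorm w -> f <= enorm w `^ (beta - d%:R - 2)) ->
  f <= constK * majK beta w.
Proof.
move=> hp f0 fnear ffar; have [r0|r0] := eqVneq (enorm w) 0.
  by rewrite (le_trans (f0 r0))// mulr_ge0 ?constK_ge0// majK_ge0.
rewrite majKE; apply: (@powR_le_weight _ _ _ p) => //.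
- by rewrite lt_neqAle eq_sym r0 enorm_ge0.
- by rewrite qK_E.
- by rewrite qsK (_ : - _ = beta - d%:R - 2)//; ring.
Qed.

End densities.

(** * Integrals over an interval, written with its indicator *)

Section interval_integrals.
Context {R : realType}.
Local Notation mu := (@lebesgue_measure R).

Lemma rintegrable_indic_itv (a b : R) : rintegrable mu (\1_(`[a, b])).
Proof.
apply/integrableP; split; first by apply/measurable_EFinP; exact: measurable_indic.
under eq_integral do rewrite /= ger0_norm//.
rewrite integral_indic//= setIT lebesgue_measure_itv/=.
by case: ifPn => _; rewrite -?EFinB ltry.
Qed.

Lemma norm_indic_itv_mul (a b C : R) (f : R -> R) x :
  (a <= x <= b -> `|f x| <= C) ->
  `|\1_(`[a, b]) x * f x| <= C * \1_(`[a, b]) x.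
Proof.
move=> fC; rewrite normrM indicE mem_setE in_itv/=.
case: (boolP (a <= x <= b)) => [xab|_]; last by rewrite normr0 mul0r mulr0.
by rewrite normr1 mul1r mulr1 fC.
Qed.

Lemma rintegrable_itv_bounded (a b C : R) (f : R -> R) : measurable_fun setT f ->
  (forall x, a <= x <= b -> `|f x| <= C) ->
  rintegrable mu (fun x => \1_(`[a, b]) x * f x).
Proof.
move=> mf fC; apply: (rintegrable_le _ _ (rintegrableZ C (rintegrable_indic_itv a b))).
  by apply: measurable_funM => //; exact: measurable_indic.
by move=> x; apply: norm_indic_itv_mul; exact: fC.
Qed.

Lemma rint_indic_itv (a b : R) (f : R -> R) :
  rint mu (fun x => \1_(`[a, b]) x * f x) = (\int[mu]_(x in `[a, b]) f x)%R.
Proof.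
rewrite [RHS]Rintegral_mkcond; apply: (@eq_rint _ _ _ mu) => x.
by rewrite patchE indicE; case: ifP => _; rewrite ?mul1r ?mul0r.
Qed.

Lemma rint_indic_itv_derive (a b : R) (f F : R -> R) : a < b ->
  (forall x : R, is_derive x 1 F (f x)) -> continuous f ->
  rint mu (fun x => \1_(`[a, b]) x * f x) = F b - F a.
Proof.
move=> ab dF cf; rewrite rint_indic_itv /Rintegral.
by rewrite (integral_is_derive ab (fun x _ => dF x) (fun x _ => cf x)).
Qed.

End interval_integrals.

(** * Decay of the oscillating remainder *)

Section oscillation.
Context {R : realType} {d : nat} (beta : R).
Hypotheses (beta_gt0 : 0 < beta) (beta_lt2 : beta < 2) (beta_ltd : beta < d%:R).
Variable rho : 'rV[R]_d.
Hypothesis rho1 : enorm rho = 1.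
Local Notation mu := (@lebesgue_measure R).
Local Notation leb := (@lebn R d).
Local Notation g := (g_sp beta rho).

(** The part of the spectral density of the second differences that comes from the oscillating term
    in the time integral of the squared wave kernel. *)
Definition gerr (A : R) (w : 'rV[R]_d) : R :=
  sin (dotp rho w / 2) ^+ 4 * enorm w `^ (beta - d%:R - 3) * sin (A * enorm w).

Lemma measurable_sin_dotp (s : R) n :
  measurable_fun setT (fun w : 'rV[R]_d => sin (s * dotp rho w) ^+ n).
Proof.
apply: measurable_funX; apply: measurableT_comp.
  exact: (continuous_measurable_fun (@continuous_sin R)).
by apply: measurable_funM => //; exact: measurable_dotp.
Qed.

Lemma measurable_g_sp : measurable_fun setT (g : 'rV[R]_d -> R).
Proof.
apply: measurable_funM; last exact: measurable_powRl (@measurable_enorm _ _).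
by under eq_fun do rewrite mulrC; exact: measurable_sin_dotp.
Qed.

Lemma g_sp_ge0 w : 0 <= g w.
Proof. by rewrite mulr_ge0 ?powR_ge0// exprn_even_ge0. Qed.

Lemma sin_dotp_le (s : R) (w : 'rV[R]_d) n : 0 <= s <= 1 ->
  `|sin (s * dotp rho w)| ^+ n <= enorm w ^+ n.
Proof.
move=> /andP[s0 s1]; rewrite lerXn2r ?nnegrE ?enorm_ge0//.
rewrite (le_trans (sin_le_norm _))// normrM ger0_norm//.
rewrite (le_trans _ (dotp_le_enorm w rho1))//.
by rewrite ler_piMl.
Qed.

Lemma sin_exp_le1 (x : R) n : `|sin x| ^+ n <= 1.
Proof. by rewrite exprn_ile1// sin_max. Qed.

Let half01 : 0 <= (2^-1 : R) <= 1.
Proof. by apply/andP; split; lra. Qed.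

Lemma powR_expn_add (r p : R) n : 0 < r -> r ^+ n * r `^ p = r `^ (n%:R + p).
Proof.
by move=> r0; rewrite powRD ?(gt_eqF r0) ?implybT// powR_mulrn// ltW.
Qed.

(** Near 0 the bound sin^4 <= |w|^4 leaves the exponent beta + 2 - d; far from 0 the sine is bounded
    by 1. *)
Lemma g_sp_le_majH w : `|g w| <= constH (d := d) beta * majH beta w.
Proof.
rewrite ger0_norm ?g_sp_ge0//.
have s4 : sin (dotp rho w / 2) ^+ 4 = `|sin (2^-1 * dotp rho w)| ^+ 4.
  by rewrite mulrC -normrX ger0_norm// exprn_even_ge0.
apply: (@le_majH _ _ _ _ _ _ (beta + 2 - d%:R)) => //.
- by lra.
- move=> r0; rewrite /g_sp s4.
  by have := sin_dotp_le w 4 half01; rewrite r0 expr0n/= => h; rewrite mulr_le0_ge0// powR_ge0.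
- move=> r1; have [r0|r0] := eqVneq (enorm w) 0.
    rewrite /g_sp s4 (le_trans _ (powR_ge0 _ _))//.
    by have := sin_dotp_le w 4 half01; rewrite r0 expr0n/= => h; rewrite mulr_le0_ge0// powR_ge0.
  have r0' : 0 < enorm w by rewrite lt_neqAle eq_sym r0 enorm_ge0.
  rewrite (_ : beta + 2 - d%:R = 4%:R + (beta - d%:R - 2)); last by ring.
  by rewrite -powR_expn_add// /g_sp s4 ler_wpM2r ?powR_ge0// sin_dotp_le.
- by move=> _; rewrite /g_sp s4 ler_piMl ?powR_ge0// sin_exp_le1.
Qed.

Lemma measurable_gerr A : measurable_fun setT (gerr A).
Proof.
apply: measurable_funM; last first.
  apply: measurableT_comp; first exact: (continuous_measurable_fun (@continuous_sin R)).
  by apply: measurable_funM => //; exact: measurable_enorm.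
apply: measurable_funM; last exact: measurable_powRl (@measurable_enorm _ _).
by under eq_fun do rewrite mulrC; exact: measurable_sin_dotp.
Qed.

(** As for [g_sp], but with the borderline exponent 4 + (beta - d - 3) = beta + 1 - d near 0. The
    bound is uniform in the dilation s and in the frequency A. *)
Lemma gerr_dilated_le (s A : R) w : 0 <= s <= 1 ->
  `|sin (s * dotp rho w) ^+ 4 * enorm w `^ (beta - d%:R - 3) * sin (A * enorm w)|
    <= constH (d := d) beta * majH beta w.
Proof.
move=> s01; apply: (@le_trans _ _
  (`|sin (s * dotp rho w)| ^+ 4 * enorm w `^ (beta - d%:R - 3))).
  rewrite 2!normrM normrX [`|_ `^ _|]ger0_norm ?powR_ge0// ler_piMr ?sin_max//.
  by rewrite mulr_ge0 ?powR_ge0// exprn_ge0.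
apply: (@le_majH _ _ _ _ _ _ (beta + 1 - d%:R)) => //.
- move=> r0.
  by have := sin_dotp_le w 4 s01; rewrite r0 expr0n/= => h; rewrite mulr_le0_ge0// powR_ge0.
- move=> r1; have [r0|r0] := eqVneq (enorm w) 0.
    rewrite (le_trans _ (powR_ge0 _ _))//.
    by have := sin_dotp_le w 4 s01; rewrite r0 expr0n/= => h; rewrite mulr_le0_ge0// powR_ge0.
  have r0' : 0 < enorm w by rewrite lt_neqAle eq_sym r0 enorm_ge0.
  rewrite (_ : beta + 1 - d%:R = 4%:R + (beta - d%:R - 3)); last by ring.
  by rewrite -powR_expn_add// ler_wpM2r ?powR_ge0// sin_dotp_le.
- move=> r1; apply: (@le_trans _ _ (enorm w `^ (beta - d%:R - 3))).
    by rewrite ler_piMl ?powR_ge0// sin_exp_le1.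
  by rewrite ler_powR//; lra.
Qed.

Lemma gerr_le_majH A w : `|gerr A w| <= constH (d := d) beta * majH beta w.
Proof. by rewrite /gerr [dotp _ _ / 2]mulrC; exact: gerr_dilated_le. Qed.

(* One integration by parts in s. *)
Lemma oscillating_integral (eta kappa r : R) : 0 < kappa -> `|eta| <= r / 2 ->
  `|rint mu (fun s => \1_(`[1%R, 2%R]) s * (sin (eta * s) ^+ 4 * sin (kappa * s)))|
    <= 4 / kappa * (r * Num.min 1 r ^+ 3).
Proof.
move=> k0 etar; set m := Num.min 1 r.
have r0 : 0 <= r by have := le_trans (normr_ge0 _) etar; lra.
have m0 : 0 <= m by rewrite le_min ler01.
have mr : m <= r by rewrite ge_min lexx orbT.
have sin_m s : 1 <= s <= 2 -> `|sin (eta * s)| <= m.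
  move=> /andP[s1 s2]; rewrite le_min sin_max/= (le_trans (sin_le_norm _))// normrM.
  rewrite (le_trans (ler_wpM2r (normr_ge0 s) etar))// ger0_norm ?(le_trans ler01)//.
  by rewrite -mulrA ler_piMr// mulrC ler_pdivrMr// mul1r.
(* With W the derivative of sin^4(eta s), D' = h - e. On [1, 2] the bounds |sin(eta s)| <= m and
   |eta| <= r/2 give D the size r m^3/kappa and e twice that: the two endpoints of D and the
   integral of e add up to the constant 4. The summands [+ 0] fit the derivative lemmas for affine
   arguments. *)
pose D (s : R) := - kappa^-1 * (cos (kappa * s + 0) * sin (eta * s + 0) ^+ 4).
pose W (s : R) := 4 * sin (eta * s + 0) ^+ 3 * (cos (eta * s + 0) * eta).
pose h (s : R) := sin (eta * s + 0) ^+ 4 * sin (kappa * s + 0).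
pose e (s : R) := kappa^-1 * (cos (kappa * s + 0) * W s).
have dsin4 (s : R) : is_derive s 1 (fun s => sin (eta * s + 0) ^+ 4) (W s).
  have ds := is_derive_sin_affine eta 0 s.
  rewrite (_ : (fun s => sin (eta * s + 0) ^+ 4) = (fun s => sin (eta * s + 0)) ^+ 4).
    2: by apply/funext => y; rewrite exprfctE.
  apply: (is_derive_eq (@is_deriveX _ _ _ 4 _ _ _ ds)).
  by rewrite /W /GRing.scale/= -mulr_natl; ring.
have dD (s : R) : is_derive s 1 D (h s - e s).
  have dc := is_derive_cos_affine kappa 0 s.
  have := is_derive_scalel (- kappa^-1) (is_deriveM dc (dsin4 s)).
  move=> h'; apply: (is_derive_eq h'); rewrite /h /e /GRing.scale/=.
  by field; rewrite gt_eqF.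
have cs a : continuous (fun s : R => sin (a * s + 0)).
  by move=> s; exact: is_derive_continuous (is_derive_sin_affine a 0 s).
have cc a : continuous (fun s : R => cos (a * s + 0)).
  by move=> s; exact: is_derive_continuous (is_derive_cos_affine a 0 s).
have cX n : continuous (fun s : R => sin (eta * s + 0) ^+ n).
  elim: n => [|n IH] s; first by under eq_fun do rewrite expr0; exact: cvg_cst.
  by under eq_fun do rewrite exprS; apply: cvgM; [exact: cs|exact: IH].
have cW : continuous W.
  move=> s; apply: cvgM; first by apply: cvgM; [exact: cvg_cst|exact: cX].
  by apply: cvgM; [exact: cc|exact: cvg_cst].
have ch : continuous h by move=> s; apply: cvgM; [exact: cX|exact: cs].
have ce : continuous e.
  by move=> s; apply: cvgM; [exact: cvg_cst|apply: cvgM; [exact: cc|exact: cW]].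
have che : continuous (fun s => h s - e s) by move=> s; apply: cvgB; [exact: ch|exact: ce].
have hW s : 1 <= s <= 2 -> `|W s| <= 2 * (r * m ^+ 3).
  move=> s12; rewrite /W !addr0 normrM [`|4 * _|]normrM [`|cos _ * _|]normrM ger0_norm// normrX.
  have h1 : `|cos (eta * s)| * `|eta| <= r / 2.
    by rewrite (le_trans _ etar)// ler_piMl// cos_max.
  have h2 : `|sin (eta * s)| ^+ 3 <= m ^+ 3 by rewrite lerXn2r ?nnegrE// sin_m.
  apply: (@le_trans _ _ (4 * m ^+ 3 * (r / 2))); last by rewrite le_eqVlt; apply/orP; left; apply/eqP; field.
  apply: ler_pM; [|by rewrite mulr_ge0|by rewrite ler_wpM2l|exact: h1].
  by rewrite mulr_ge0// exprn_ge0.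
have he s : 1 <= s <= 2 -> `|e s| <= kappa^-1 * (2 * (r * m ^+ 3)).
  move=> s12; rewrite /e normrM ger0_norm ?invr_ge0 ?(ltW k0)//.
  rewrite ler_wpM2l ?invr_ge0 ?(ltW k0)// normrM (le_trans _ (hW s s12))//.
  by rewrite ler_piMl// cos_max.
have hD s : 1 <= s <= 2 -> `|D s| <= kappa^-1 * (r * m ^+ 3).
  move=> s12; have -> : `|D s| = kappa^-1 * (`|cos (kappa * s)| * `|sin (eta * s) ^+ 4|).
    by rewrite /D !addr0 mulNr normrN normrM [`|cos _ * _|]normrM gtr0_norm// invr_gt0.
  rewrite ler_wpM2l ?invr_ge0 ?(ltW k0)//.
  apply: (@le_trans _ _ (`|sin (eta * s) ^+ 4|)); first by rewrite ler_piMl// cos_max.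
  rewrite normrX exprS ler_pM ?exprn_ge0//; first exact: le_trans (sin_m _ s12) mr.
  by rewrite lerXn2r ?nnegrE// sin_m.
have hh s : 1 <= s <= 2 -> `|h s| <= 1.
  move=> _; rewrite /h normrM normrX.
  by rewrite (le_trans (ler_pM _ _ (sin_exp_le1 _ _) (sin_max _))) ?mulr1// exprn_ge0.
have ih := rintegrable_itv_bounded (continuous_measurable_fun ch) hh.
have ie := rintegrable_itv_bounded (continuous_measurable_fun ce) he.
have key := rint_indic_itv_derive (ltr1n R 2 : 1 < 2) dD che.
have -> : rint mu (fun s => \1_(`[1%R, 2%R]) s * (sin (eta * s) ^+ 4 * sin (kappa * s))) =
   D 2 - D 1 + rint mu (fun s => \1_(`[1%R, 2%R]) s * e s).
  rewrite -key -rintD//; last first.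
    by rewrite (_ : (fun _ => _) = (fun s => \1_(`[1%R, 2%R]) s * h s - \1_(`[1%R, 2%R]) s * e s));
     [exact: rintegrableB|apply/funext => s; rewrite mulrBr].
  by apply: eq_rint => s; rewrite /h !addr0; ring.
have s11 : 1 <= (1 : R) <= 2 by rewrite lexx ler1n.
have s22 : 1 <= (2 : R) <= 2 by rewrite lexx ler1n.
have l1 : rint mu (\1_(`[1%R, 2%R])) = 1 :> R.
  have h1 := @rint_indic_itv_derive R 1 2 (fun=> 1) id (ltr1n R 2 : 1 < 2)
    (fun x => is_derive_id _ _) (fun x => cvg_cst _).
  transitivity (rint mu (fun x : R => \1_(`[1%R, 2%R]) x * 1 : R)).
    by apply: eq_rint => x; rewrite mulr1.
  by rewrite h1 /=; ring.
have be : `|rint mu (fun s => \1_(`[1%R, 2%R]) s * e s)| <= kappa^-1 * (2 * (r * m ^+ 3)).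
  set K := kappa^-1 * _; have KE : rint mu (fun s : R => K * \1_(`[1%R, 2%R]) s : R) = K.
    by rewrite rintZ ?l1 ?mulr1//; exact: rintegrable_indic_itv.
  rewrite -[leRHS]KE.
  apply: le_rint_bound.
  - by apply: measurable_funM; [exact: measurable_indic|exact: continuous_measurable_fun].
  - by move=> s; apply: norm_indic_itv_mul; exact: he.
  - by apply: rintegrableZ; exact: rintegrable_indic_itv.
apply: (le_trans (ler_normD _ _)); apply: (le_trans (lerD (ler_normB _ _) be)).
apply: (le_trans (lerD (lerD (hD 2 s22) (hD 1 s11)) (lexx _))).
by rewrite le_eqVlt; apply/orP; left; apply/eqP; field; rewrite gt_eqF.
Qed.

Lemma rint_scale (f : 'rV[R]_d -> R) (s : R) : 0 < s -> rintegrable leb f ->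
  rint leb (fun w => f (s *: w)) = s ^- d * rint leb f.
Proof.
move=> s0 intf.
have mf : measurable_fun setT (EFin \o f) by case/integrableP: intf.
rewrite /rint /Rintegral.
have -> : (\int[leb]_w (f (s *: w))%:E = (s ^- d)%:E * \int[leb]_w (f w)%:E)%E.
  rewrite [LHS]integralE [in RHS]integralE muleBr//; last exact: integrable_add_def.
  rewrite -(ge0_integral_lebn_scale s0 (measurable_funepos mf)); last first.
    by move=> x; exact: funepos_ge0.
  rewrite -(ge0_integral_lebn_scale s0 (measurable_funeneg mf)); last first.
    by move=> x; exact: funeneg_ge0.
  by congr (_ - _)%E; apply: eq_integral => x _; rewrite ?funeposE ?funenegE.
by rewrite fineM//; exact: integrable_fin_num.
Qed.

Lemma rintegrable_scale (f : 'rV[R]_d -> R) (s : R) : 0 < s -> rintegrable leb f ->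
  rintegrable leb (fun w => f (s *: w)).
Proof.
move=> s0 /integrableP[mf intf]; apply/integrableP; split.
  exact: (measurableT_comp mf (measurable_scale_rV s)).
have mnf : measurable_fun setT (fun w => `|(EFin \o f) w|)%E by exact: measurableT_comp.
rewrite (ge0_integral_lebn_scale s0 mnf)// lte_mul_pinfty//.
by rewrite lee_fin invr_ge0 exprn_ge0// ltW.
Qed.

(** Let I be the integral. By homogeneity the integrand dilated by s integrates to s^(3 - beta) I,
    so I is controlled by the integral of this over s in [1, 2]. After Fubini, for fixed w the
    variable s multiplies the frequency A |w|, and integration by parts in s gains 1/(A |w|). What
    remains is |w|^(beta-d-3) min(1, |w|)^3, which [majK] dominates. *)
Lemma gerr_bias : exists2 C : R, 0 <= C &
  forall A, 0 < A -> `|rint leb (gerr A)| <= C / A.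
Proof.
exists (4 * constK (d := d) beta * rint leb (majK beta)).
  rewrite mulr_ge0// ?mulr_ge0 ?constK_ge0//.
  by apply: rint_ge0 => w; exact: majK_ge0.
move=> A A0.
pose ind (s : R) : R := \1_(`[1%R, 2%R]) s.
pose phi (p : measurableTypeR R * 'rV[R]_d) : R := ind p.1 *
  (sin (p.1 / 2 * dotp rho p.2) ^+ 4 * enorm p.2 `^ (beta - d%:R - 3) *
   sin (A * p.1 * enorm p.2)).
have ind01 s : ind s = 0 \/ (1 <= s <= 2 /\ ind s = 1).
  rewrite /ind indicE mem_setE in_itv/=.
  by case: (boolP (1 <= s <= 2)) => h; [right|left].
have ind_ge0 s : 0 <= ind s by case: (ind01 s) => [->|[_ ->]].
have mind : measurable_fun setT ind by exact: measurable_indic.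
have iind : rintegrable mu ind by exact: rintegrable_indic_itv.
have msin : measurable_fun setT (@sin R).
  exact: (continuous_measurable_fun (@continuous_sin R)).
have mphi : measurable_fun setT phi.
  have m1 : measurable_fun setT (fun p : measurableTypeR R * 'rV[R]_d => p.1 : R).
    exact: measurable_fst.
  have me : measurable_fun setT (fun p : measurableTypeR R * 'rV[R]_d => enorm p.2).
    by apply: (measurableT_comp (@measurable_enorm R d)); exact: measurable_snd.
  apply: measurable_funM; first exact: measurableT_comp.
  apply: measurable_funM; last first.
    by apply: (measurableT_comp msin); apply: measurable_funM => //; apply: measurable_funM.
  apply: measurable_funM; last exact: measurable_powRl.
  apply: measurable_funX; apply: (measurableT_comp msin).
  apply: measurable_funM; first exact: measurable_funM.
  by apply: (measurableT_comp (measurable_dotp rho)); exact: measurable_snd.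
have phi_le p : `|phi p| <= ind p.1 * (constH (d := d) beta * majH beta p.2).
  rewrite normrM ger0_norm//; case: (ind01 p.1) => [->|[/andP[s1 s2] ->]].
    by rewrite !mul0r.
  by rewrite !mul1r gerr_dilated_le//; apply/andP; split; lra.
have iH : rintegrable leb (fun w => constH (d := d) beta * majH beta w).
  by apply: rintegrableZ; exact: integrable_majH.
have fub := @rint_fubini _ _ _ _ _ mu leb phi ind
  (fun w => constH (d := d) beta * majH beta w) mphi iind iH phi_le.
have ifub2 := @rintegrable_fubini2 _ _ _ _ _ mu leb phi ind
  (fun w => constH (d := d) beta * majH beta w) mphi iind iH phi_le.
set I := rint leb (gerr A).
have igerr : rintegrable leb (gerr A).
  apply: rintegrable_le iH; [exact: measurable_gerr|exact: gerr_le_majH].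
(* Dilation by s: the Jacobian s^(-d) and the homogeneity of |w|^(beta-d-3) combine to s^(3 -
   beta). *)
have phiE s : rint leb (fun w => phi (s, w)) = ind s * s `^ (3 - beta) * I.
  rewrite /phi/=; case: (ind01 s) => [->|[/andP[s1 s2] ->]].
    by rewrite !mul0r -[RHS](rint0 leb); apply: eq_rint => w; rewrite mul0r.
  have s0 : 0 < s by exact: lt_le_trans s1.
  rewrite mul1r.
  transitivity (s `^ (d%:R + 3 - beta) * rint leb (fun w => gerr A (s *: w))).
    rewrite -rintZ; last exact: rintegrable_scale.
    apply: eq_rint => w; rewrite /gerr mul1r enorm_scale ?ltW// dotp_scaler.
    rewrite powRM ?enorm_ge0 ?ltW//.
    have sp : s `^ (d%:R + 3 - beta) * s `^ (beta - d%:R - 3) = 1.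
      rewrite -powRD; last by rewrite (gt_eqF s0) implybT.
      by rewrite (_ : d%:R + 3 - beta + _ = 0) ?powRr0//; ring.
    rewrite -[LHS]mul1r -{1}sp [s * _ / 2]mulrAC [A * (s * _)]mulrA; ring.
  rewrite rint_scale// -powR_invn ?ltW// mulrA -powRD; last by rewrite (gt_eqF s0) implybT.
  by congr (_ `^ _ * _); ring.
(* For s >= 1 and beta < 2 the weight s^(3 - beta) is at least 1, and [1, 2] has length 1. *)
have lower : `|I| <= `|rint mu (fun s => rint leb (fun w => phi (s, w)))|.
  have mp : measurable_fun setT (fun s : R => s `^ (3 - beta)) by exact: measurable_powR.
  have bp s : 1 <= s <= 2 -> `|s `^ (3 - beta)| <= 2 `^ (3 - beta).
    move=> /andP[s1 s2]; rewrite ger0_norm ?powR_ge0// ge0_ler_powR ?nnegrE//.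
    - by move: beta_lt2; lra.
    - exact: le_trans s1.
  have ip := rintegrable_itv_bounded mp bp.
  have -> : rint mu (fun s => rint leb (fun w => phi (s, w))) =
      I * rint mu (fun s : R => ind s * s `^ (3 - beta)).
    by rewrite -rintZ//; apply: eq_rint => s; rewrite phiE mulrC.
  rewrite normrM ler_peMr// ger0_norm; last first.
    by apply: rint_ge0 => s; rewrite mulr_ge0 ?powR_ge0.
  have h1 := @rint_indic_itv_derive R 1 2 (fun=> 1) id (ltr1n R 2 : 1 < 2)
    (fun x => is_derive_id _ _) (fun x => cvg_cst _).
  have h2 : rint mu (fun s : R => \1_(`[1%R, 2%R]) s * 1 : R) = 1.
    by rewrite h1 /=; ring.
  rewrite -[leLHS]h2.
  apply: le_rint => //.
    by rewrite (_ : (fun _ => _) = ind)//; apply/funext => s; rewrite mulr1.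
  move=> s; case: (ind01 s) => [|[/andP[s1 _]]]; rewrite /ind => ->; rewrite ?mul0r// !mul1r.
  rewrite -[leLHS](powRr0 s) ler_powR//.
  by move: beta_lt2; lra.
apply: (le_trans lower); rewrite fub.
have -> : 4 * constK (d := d) beta * rint leb (majK beta) / A =
    rint leb (fun w => 4 / A * (constK (d := d) beta * majK beta w)).
  rewrite rintZ; last by apply: rintegrableZ; exact: integrable_majK.
  rewrite rintZ; last exact: integrable_majK.
  by field; rewrite gt_eqF.
apply: le_rint_bound.
- exact: rintegrable_measurable ifub2.
- move=> w; set r := enorm w; set eta := dotp rho w / 2.
  have r0 : 0 <= r by exact: enorm_ge0.
  have -> : rint mu (fun s => phi (s, w)) = r `^ (beta - d%:R - 3) *
      rint mu (fun s => \1_(`[1%R, 2%R]) s * (sin (eta * s) ^+ 4 * sin (A * r * s))).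
    rewrite -rintZ.
      apply: eq_rint => s; rewrite /phi /ind /= -/r.
      rewrite (_ : s / 2 * dotp rho w = eta * s); last by rewrite /eta; field.
      by rewrite [A * s * r]mulrAC; ring.
    apply: (@rintegrable_itv_bounded _ _ _ 1).
      apply: measurable_funM; last by apply: (measurableT_comp msin); exact: measurable_funM.
      by apply: measurable_funX; apply: (measurableT_comp msin); exact: measurable_funM.
    move=> s _; rewrite normrM normrX.
    by rewrite (le_trans (ler_pM _ _ (sin_exp_le1 _ _) (sin_max _))) ?mulr1// exprn_ge0.
  have [r00|rn0] := eqVneq r 0.
    rewrite r00 powR0; last by move: beta_ltd; lra.
    rewrite mul0r normr0; apply: mulr_ge0; first by rewrite divr_ge0// ltW.
    by rewrite mulr_ge0 ?constK_ge0 ?majK_ge0.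
  have rp : 0 < r by rewrite lt_neqAle eq_sym rn0.
  have etar : `|eta| <= r / 2.
    rewrite /eta normrM ler_pM//; first exact: dotp_le_enorm.
    by rewrite ger0_norm.
  rewrite normrM ger0_norm ?powR_ge0//.
  apply: (le_trans (ler_wpM2l (powR_ge0 _ _) (oscillating_integral (mulr_gt0 A0 rp) etar))).
  (* The factor r in the oscillation bound cancels against the frequency A r. *)
  rewrite [leLHS](_ : _ = 4 / A * (r `^ (beta - d%:R - 3) * Num.min 1 r ^+ 3)); last first.
    by field; rewrite !gt_eqF.
  rewrite ler_wpM2l ?divr_ge0 ?(ltW A0)//.
  apply: (@le_majK _ _ _ _ _ _ (beta - d%:R)) => //; rewrite -/r.
  + by move=> r00; rewrite r00 eqxx in rn0.
  + move=> r1; rewrite min_r ?(ltW r1)// mulrC powR_expn_add//.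
    by rewrite (_ : 3%:R + (_ - 3) = beta - d%:R)//; ring.
  + move=> r1; rewrite min_l// expr1n mulr1 ler_powR//.
    by lra.
- by apply: rintegrableZ; apply: rintegrableZ; exact: integrable_majK.
Qed.

End oscillation.

(** * Taylor bound for the sine *)

Section sine_taylor.
Context {R : realType}.

(** Taylor polynomial at 0 of x -> sin(x + c), since the j-th derivative of sin at c is sin(c + j
    pi/2). *)
Definition sin_taylor (n : nat) (c x : R) : R :=
  \sum_(j < n) sin (c + j%:R * (pi / 2)) * (x ^+ j / j`!%:R).

Let fact_neq0 (n : nat) : (n`!%:R : R) != 0.
Proof. by rewrite pnatr_eq0 -lt0n fact_gt0. Qed.

Lemma is_derive_exprn_fact (n : nat) (x : R) :
  is_derive x 1 (fun y => y ^+ n.+1 / n.+1`!%:R) (x ^+ n / n`!%:R).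
Proof.
have h := @is_deriveX R R id n.+1 x 1 1 (is_derive_id _ _).
have := is_derive_scalel (n.+1`!%:R)^-1 h.
rewrite (_ : (fun y => _) = (fun y : R => y ^+ n.+1 / n.+1`!%:R)); last first.
  by apply/funext => y; rewrite exprfctE mulrC.
move=> h'; apply: (is_derive_eq h'); rewrite /GRing.scale/= mulr1 factS natrM.
have n0 : (n.+1%:R : R) != 0 by rewrite pnatr_eq0.
by rewrite invfM mulrACA mulVf// mul1r mulrC.
Qed.

Lemma is_derive_sin_taylor (n : nat) (c x : R) :
  is_derive x 1 (sin_taylor n.+1 c) (sin_taylor n (c + pi / 2) x).
Proof.
rewrite (_ : sin_taylor n.+1 c = (fun y => sin c +
    \sum_(j < n) sin (c + j.+1%:R * (pi / 2)) * (y ^+ j.+1 / j.+1`!%:R))); last first.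
  apply/funext => y; rewrite /sin_taylor big_ord_recl/= mul0r addr0 expr0 fact0 divr1 mulr1.
  by congr (_ + _); apply: eq_bigr => j _; rewrite /bump/= add1n.
have h : is_derive x 1 (fun y => \sum_(j < n) sin (c + j.+1%:R * (pi / 2)) *
     (y ^+ j.+1 / j.+1`!%:R)) (sin_taylor n (c + pi / 2) x).
  apply: is_derive_bigsum => j.
  rewrite (_ : c + pi / 2 + j%:R * (pi / 2) = c + j.+1%:R * (pi / 2)); last first.
    by rewrite -natr1; ring.
  exact/is_derive_scalel/is_derive_exprn_fact.
have := is_deriveD (is_derive_cst (sin c) x 1) h.
by rewrite add0r.
Qed.

(** Induction on n: the derivative of the remainder is the remainder of order one less with phase c
    + pi/2, and the mean value theorem applied to x^(n+1)/(n+1)! minus or plus the remainder carries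
    the bound up. *)
Let sin_taylor_ge0 (n : nat) (c x : R) : 0 <= x ->
  `|sin (x + c) - sin_taylor n c x| <= x ^+ n / n`!%:R.
Proof.
elim: n c x => [|n IH] c x x0.
  by rewrite /sin_taylor big_ord0 subr0 expr0 fact0 divr1 sin_max.
pose g (y : R) := sin (1 * y + c) - sin_taylor n.+1 c y.
pose m (y : R) := y ^+ n.+1 / n.+1`!%:R.
have dg (y : R) : is_derive y 1 g (sin (y + (c + pi / 2)) - sin_taylor n (c + pi / 2) y).
  have h := is_deriveB (is_derive_sin_affine 1 c y) (is_derive_sin_taylor n c y).
  by apply: (is_derive_eq h); rewrite addrA sinDpihalf mul1r mulr1.
have g0 : g 0 = 0.
  rewrite /g mulr0 add0r /sin_taylor big_ord_recl/= mul0r addr0 expr0 fact0 divr1 mulr1.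
  by rewrite big1 ?addr0 ?subrr// => j _; rewrite exprS !mul0r mulr0.
have m0 : m 0 = 0 by rewrite /m exprS !mul0r.
have key (e : R) : `|e| = 1 -> e * g x <= m x.
  move=> e1.
  have dh (y : R) : is_derive y 1 (fun y => m y - e * g y)
    (y ^+ n / n`!%:R - e * (sin (y + (c + pi / 2)) - sin_taylor n (c + pi / 2) y)).
    exact: is_deriveB (is_derive_exprn_fact n y) (is_derive_scalel e (dg y)).
  have [xi] : exists2 xi, xi \in `[0, x]%R & (m x - e * g x) - (m 0 - e * g 0) =
     (xi ^+ n / n`!%:R - e * (sin (xi + (c + pi / 2)) - sin_taylor n (c + pi / 2) xi)) * (x - 0).
    apply: (@MVT_segment _ (fun y => m y - e * g y) (fun y => y ^+ n / n`!%:R -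
       e * (sin (y + (c + pi / 2)) - sin_taylor n (c + pi / 2) y))) => //.
    by apply: continuous_subspaceT => y; exact: is_derive_continuous (dh y).
  rewrite in_itv/= => /andP[xi0 _]; rewrite g0 m0 mulr0 !subr0 => E.
  rewrite -subr_ge0 E mulr_ge0// subr_ge0.
  apply: le_trans (IH (c + pi / 2) xi xi0).
  by rewrite (le_trans (ler_norm _))// normrM e1 mul1r.
have gE : g x = sin (x + c) - sin_taylor n.+1 c x by rewrite /g mul1r.
rewrite -gE ler_norml; apply/andP; split.
  by have := key (-1); rewrite normrN1 mulN1r lerNl; exact.
by have := key 1; rewrite normr1 mul1r; exact.
Qed.

Lemma sin_taylor_le (n : nat) (c x : R) :
  `|sin (x + c) - sin_taylor n c x| <= `|x| ^+ n / n`!%:R.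
Proof.
have [x0|x0] := leP 0 x; first by rewrite [`|x|]ger0_norm//; exact: sin_taylor_ge0.
(* Negative x reduces to positive x by the reflection x -> -x, c -> pi - c. *)
have -> : sin (x + c) = sin (- x + (pi - c)).
  by rewrite (_ : - x + (pi - c) = - (x + c) + pi) ?sinDpi ?sinN ?opprK//; ring.
have -> : sin_taylor n c x = sin_taylor n (pi - c) (- x).
  apply: eq_bigr => j _.
  have -> : sin (pi - c + j%:R * (pi / 2)) = sin (c - j%:R * (pi / 2)).
    rewrite (_ : pi - c + j%:R * (pi / 2) = - (c - j%:R * (pi / 2)) + pi); last by ring.
    by rewrite sinDpi sinN opprK.
  rewrite (_ : c + j%:R * (pi / 2) = c - j%:R * (pi / 2) + pi *+ j); last first.
    by rewrite -[pi *+ j]mulr_natl; field.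
  rewrite (alternatingn (@sinDpi R)) [(- x) ^+ _]exprNn; ring.
by rewrite [`|x|]ltr0_norm//; apply: sin_taylor_ge0; rewrite oppr_ge0 ltW.
Qed.

End sine_taylor.

(** * Bernstein approximation *)

Section bernstein.
Context {R : realType}.

(* bern N phi y is the expectation of phi at a binomial (N, y) variable. *)
Fixpoint bern (N : nat) (phi : nat -> R) (y : R) : R :=
  if N is N'.+1 then (1 - y) * bern N' phi y + y * bern N' (phi \o S) y
  else phi 0%N.

(** Mean N y and variance N y (1 - y) of the binomial law. *)
Lemma bern_quadratic N (a b c y : R) :
  bern N (fun k => a + b * k%:R + c * k%:R ^+ 2) y =
  a + b * (N%:R * y) + c * (N%:R * y * (1 - y) + (N%:R * y) ^+ 2).
Proof.
elim: N a b c => [|N IH] a b c /=; first by ring.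
have -> : (fun k => a + b * k%:R + c * k%:R ^+ 2) \o S =
    (fun k : nat => (a + b + c) + (b + 2 * c) * k%:R + c * k%:R ^+ 2).
  by apply/funext => k /=; rewrite -natr1; ring.
by rewrite !IH -natr1; ring.
Qed.

Lemma ler_bern N (phi psi : nat -> R) (y : R) : 0 <= y <= 1 ->
  (forall k, phi k <= psi k) -> bern N phi y <= bern N psi y.
Proof.
move=> /andP[y0 y1]; elim: N phi psi => [|N IH] phi psi h /=; first exact: h.
rewrite lerD// ler_wpM2l ?subr_ge0//; first exact: IH.
by apply: IH => k; exact: h.
Qed.

Lemma bernZB N (phi psi : nat -> R) (y : R) :
  bern N (fun k => phi k - psi k) y = bern N phi y - bern N psi y.
Proof.
elim: N phi psi => [//|N IH] phi psi /=.
by rewrite IH (IH (phi \o S) (psi \o S)); ring.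
Qed.

(** Bernstein's proof of the Weierstrass theorem: |h(y) - h(k/N)| is at most e/2 within distance
    delta and at most 2F (y - k/N)^2/delta^2 beyond it; the variance y(1 - y)/N makes the second
    term small on average. *)
Lemma bern_uniform (h : R -> R) (F e : R) : continuous h ->
  (forall y, `|h y| <= F) -> 0 < e ->
  exists N, forall y, 0 <= y <= 1 -> `|h y - bern N (fun k => h (k%:R / N%:R)) y| <= e.
Proof.
move=> ch hF e0.
have F0 : 0 <= F by exact: le_trans (hF 0).
have [delta delta0 hd] : exists2 delta : R, 0 < delta & forall x y : R, 0 <= x <= 1 ->
    `|x - y| < delta -> `|h x - h y| <= e / 2.
  (* Uniform continuity by compactness of [0, 1]; only x is confined to the interval. *)
  have /compact_near_coveringP cpt := @segment_compact R 0 1.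
  have : \forall delta \near 0^'+, `[0, 1]%classic `<=`
      [set x : R | forall y, `|x - y| < delta -> `|h x - h y| <= e / 2].
    apply: cpt => x _.
    have e4 : 0 < e / 4 by rewrite divr_gt0.
    have /cvgrPdist_lt/(_ _ e4)/nbhs_ballP[eta /= eta0 heta] := ch x.
    exists (ball x (eta / 2), [set delta : R | delta < eta / 2]).
      split => /=; first by apply: nbhsx_ballx; rewrite divr_gt0.
      by apply: nbhs_right_lt; rewrite divr_gt0.
    move=> [x' delta] /= [xx' dd] y xy.
    have h1 := heta x'; have h2 := heta y.
    have l1 : `|h x - h x'| < e / 4.
      apply: h1; rewrite /ball/= in xx' *; apply: (lt_le_trans xx').
      by move: eta0; lra.
    have l2 : `|h x - h y| < e / 4.
      apply: h2; rewrite /ball/= in xx' *.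
      have := ler_distD x' x y; move: xx' xy dd; lra.
    have := ler_distD (h x) (h x') (h y); rewrite (distrC (h x') (h x)).
    move: l1 l2; lra.
  move=> near_d; near (0 : R)^'+ => delta; exists delta; first by near: delta; exact: nbhs_right_gt.
  move=> x y x01; have : `[0, 1]%classic `<=`
      [set x : R | forall y, `|x - y| < delta -> `|h x - h y| <= e / 2] by near: delta.
  by move=> /(_ x); apply; rewrite /= in_itv.
pose B := 2 * F / delta ^+ 2.
have B0 : 0 <= B by apply: divr_ge0; [exact: mulr_ge0|exact: sqr_ge0].
(* N exceeds 2B/e, so that B/N <= e/2. *)
pose N := (Num.truncn (B * 2 / e)).+1.
have N0 : 0 < N%:R :> R by rewrite ltr0n.
exists N => y y01.
have hy : h y = bern N (fun=> h y) y.
  have := bern_quadratic N (h y) 0 0 y; rewrite !mul0r !addr0 => {1}<-.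
  by congr (bern _ _ _); apply/funext => k; rewrite !mul0r !addr0.
have bound k : `|h y - h (k%:R / N%:R)| <= e / 2 + B * (y - k%:R / N%:R) ^+ 2.
  have [yk|yk] := ltP `|y - k%:R / N%:R| delta.
    by rewrite (le_trans (hd _ _ y01 yk))// lerDl mulr_ge0// sqr_ge0.
  apply: (@le_trans _ _ (2 * F)).
    by rewrite (le_trans (ler_normB _ _))// mulr2n mulrDl mul1r lerD.
  apply: (@le_trans _ _ (B * (y - k%:R / N%:R) ^+ 2)); last by rewrite lerDr divr_ge0 ?ltW.
  rewrite /B -mulrA ler_peMr ?mulr_ge0// mulrC ler_pdivlMr ?exprn_gt0// mul1r.
  by rewrite -[leRHS]real_normK ?num_real// lerXn2r ?nnegrE// ltW.
have q (s : R) : bern N (fun k => s * (e / 2 + B * (y - k%:R / N%:R) ^+ 2)) y =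
    s * (e / 2 + B * (y * (1 - y) / N%:R)).
  have -> : (fun k => s * (e / 2 + B * (y - k%:R / N%:R) ^+ 2)) = (fun k : nat =>
     s * (e / 2 + B * y ^+ 2) + (- 2 * s * B * y / N%:R) * k%:R + (s * B / N%:R ^+ 2) * k%:R ^+ 2).
    by apply/funext => k; field; rewrite gt_eqF.
  by rewrite bern_quadratic; field; rewrite gt_eqF.
have y1 : y * (1 - y) <= 1.
  by case/andP: y01 => y0 y1; apply: le_trans y1; rewrite ler_piMr//; lra.
have tail : e / 2 + B * (y * (1 - y) / N%:R) <= e.
  have : B * (y * (1 - y) / N%:R) <= e / 2; last by lra.
  rewrite mulrA ler_pdivrMr// (le_trans (ler_wpM2l B0 y1))// mulr1.
  have /ltW := truncnS_gt (B * 2 / e); rewrite -/N ler_pdivrMr// => h2.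
  by rewrite (_ : e / 2 * N%:R = N%:R * e / 2) ?ler_pdivlMr//; field.
rewrite {1}hy -bernZB ler_norml; apply/andP; split.
- rewrite (le_trans (_ : - e <= bern N (fun k => (-1) * (e / 2 + B * (y - k%:R / N%:R) ^+ 2)) y))//.
    by rewrite q mulN1r lerN2.
  apply: ler_bern => // k; rewrite mulN1r.
  by have := bound k; rewrite ler_norml => /andP[].
- rewrite (le_trans _ (_ : bern N (fun k => 1 * (e / 2 + B * (y - k%:R / N%:R) ^+ 2)) y <= e))//.
    apply: ler_bern => // k; rewrite mul1r.
    by have := bound k; rewrite ler_norml => /andP[].
  by rewrite q mul1r.
Unshelve. all: by end_near.
Qed.

End bernstein.

(** * Trigonometric polynomials *)

Section trigonometric_polynomials.
Context {R : realType}.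

(** The span of all phase-shifted sines. Frequencies are arbitrary reals; constants and cosines are
    included through the phase. *)
Inductive trigp : (R -> R) -> Prop :=
| trigp_sin a s c : trigp (fun x => a * sin (s * x + c))
| trigp_add f g : trigp f -> trigp g -> trigp (fun x => f x + g x).

Lemma trigp_ext f g : f =1 g -> trigp f -> trigp g.
Proof. by move=> /funext ->. Qed.

Lemma trigp_cst a : trigp (fun=> a).
Proof.
apply: trigp_ext (trigp_sin a 0 (pi / 2)) => x.
by rewrite mul0r add0r sin_pihalf mulr1.
Qed.

Lemma trigp_scale b f : trigp f -> trigp (fun x => b * f x).
Proof.
elim=> {f} [a s c|f g _ hf _ hg].
  by apply: trigp_ext (trigp_sin (b * a) s c) => x; rewrite mulrA.
by apply: trigp_ext (trigp_add hf hg) => x; rewrite mulrDr.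
Qed.

Lemma trigp_mul_sin t f : trigp f -> trigp (fun x => sin (t * x) * f x).
Proof.
elim=> {f} [a s c|f g _ hf _ hg].
  apply: trigp_ext (trigp_add (trigp_sin (a / 2) (s - t) (c + pi / 2))
    (trigp_sin (- (a / 2)) (s + t) (c + pi / 2))) => x.
  rewrite !addrA !sinDpihalf.
  rewrite (_ : (s - t) * x + c = (s * x + c) - t * x); last by ring.
  rewrite (_ : (s + t) * x + c = (s * x + c) + t * x); last by ring.
  by rewrite (cosB (s * x + c)) (cosD (s * x + c)); field.
by apply: trigp_ext (trigp_add hf hg) => x; rewrite mulrDr.
Qed.

(** The Bernstein recursion multiplies by sin(s x) and adds, and [trigp] is closed under both by the
    product-to-sum formula. *)
Lemma trigp_bern N (phi : nat -> R) (s : R) :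
  trigp (fun x => bern N phi ((1 + sin (s * x)) / 2)).
Proof.
elim: N phi => [|N IH] phi /=; first exact: trigp_cst.
apply: trigp_ext (trigp_add (trigp_add (trigp_scale 2^-1 (IH phi))
   (trigp_scale (- 2^-1) (trigp_mul_sin s (IH phi))))
  (trigp_add (trigp_scale 2^-1 (IH (phi \o S)))
   (trigp_scale 2^-1 (trigp_mul_sin s (IH (phi \o S)))))) => x /=.
by field.
Qed.

Lemma trigp_continuous f : trigp f -> continuous f.
Proof.
elim=> {f} [a s c|f g _ hf _ hg] x.
  by apply: is_derive_continuous; exact/is_derive_scalel/is_derive_sin_affine.
by apply: cvgD; [exact: hf|exact: hg].
Qed.

Lemma trigp_bounded f : trigp f -> exists C, forall x, `|f x| <= C.
Proof.
elim=> {f} [a s c|f g _ [C hC] _ [D hD]].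
  by exists `|a| => x; rewrite normrM ler_piMr// sin_max.
by exists (C + D) => x; rewrite (le_trans (ler_normD _ _))// lerD.
Qed.

End trigonometric_polynomials.

(** * Weak convergence tested on sines *)

Section probability_integrals.
Context {R : realType} {d : measure_display} {T : measurableType d}.

Lemma rintegrable_bounded (P : probability T R) (f : T -> R) (C : R) :
  measurable_fun setT f -> (forall x, `|f x| <= C) -> rintegrable P f.
Proof.
move=> mf fC; apply: (@rintegrable_le _ _ _ P _ (fun=> C)) => //.
exact: finite_measure_integrable_cst.
Qed.

Lemma rint_cst (P : probability T R) (c : R) : rint P (fun=> c) = c.
Proof. by rewrite /rint Rintegral_cst//= probability_setT mulr1. Qed.

Lemma rint_approx (P : probability T R) (f g : T -> R) (Z : T -> R) (a b : R) :
  rintegrable P f -> rintegrable P g -> rintegrable P Z ->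
  (forall x, `|f x - g x| <= a + b * Z x) ->
  `|rint P f - rint P g| <= a + b * rint P Z.
Proof.
move=> intf intg iZ fg; rewrite -rintB//.
have iC : rintegrable P (fun=> a) by exact: finite_measure_integrable_cst.
have -> : a + b * rint P Z = rint P (fun x => a + b * Z x).
  rewrite rintD; [|exact: iC|exact: rintegrableZ].
  by rewrite rintZ// rint_cst.
apply: le_rint_bound => //.
- by apply: measurable_funB; [exact: rintegrable_measurable intf|exact: rintegrable_measurable intg].
- by apply: rintegrableD => //; exact: rintegrableZ.
Qed.

End probability_integrals.

Section weak_convergence.
Context {R : realType} {d : measure_display} {T : measurableType d}.
Variables (P : probability T R) (X : nat -> T -> R)
  (nu : probability (measurableTypeR R) R).
Hypothesis mX : forall n, measurable_fun setT (X n).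
Hypothesis cvg_sin : forall s c : R,
  rint P (fun w => sin (s * X n w + c)) @[n --> \oo] --> rint nu (fun x : R => sin (s * x + c)).

Lemma cvg_trigp (f : R -> R) : trigp f ->
  rint P (fun w => f (X n w)) @[n --> \oo] --> rint nu f.
Proof.
have mc (g : R -> R) : trigp g -> forall n, measurable_fun setT (fun w => g (X n w)).
  move=> /trigp_continuous/continuous_measurable_fun mg n.
  exact: measurableT_comp.
have intP (g : R -> R) : trigp g -> forall n, rintegrable P (fun w => g (X n w)).
  move=> tg n; have [C hC] := trigp_bounded tg.
  by apply: rintegrable_bounded (mc _ tg n) _ => w; exact: hC.
have intnu (g : R -> R) : trigp g -> rintegrable nu g.
  move=> tg; have [C hC] := trigp_bounded tg.
  apply: (@rintegrable_bounded _ _ _ nu _ C) => //.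
  exact: (continuous_measurable_fun (trigp_continuous tg)).
elim=> {f} [a s c|f g tf hf tg hg].
  have ts : trigp (fun x : R => sin (s * x + c)).
    by apply: trigp_ext (trigp_sin 1 s c) => x; rewrite mul1r.
  rewrite rintZ; last exact: intnu ts.
  under eq_fun => n do rewrite (rintZ a (intP _ ts n)).
  by apply: cvgM; [exact: cvg_cst|exact: cvg_sin].
rewrite rintD; [|exact: intnu|exact: intnu].
under eq_fun => n do rewrite (rintD (intP _ tf n) (intP _ tg n)).
exact: cvgD.
Qed.

(** Clipping to [-1/2, 1/2] before taking the arcsine gives a left inverse of sin near 0 that is
    continuous on the whole line. *)
Lemma continuous_inverse_sin :
  exists2 k : R -> R, continuous k & forall x, `|x| <= 2^-1 -> k (sin x) = x.
Proof.
pose clip (z : R) := (`|z + 2^-1| - `|z - 2^-1|) / 2.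
exists (fun z => asin (clip z)).
  move=> y; apply: (@continuous_comp _ _ _ clip asin); last first.
    apply: continuous_asin; rewrite -ltr_norml /clip normrM.
    have := ler_dist_dist (y + 2^-1) (y - 2^-1).
    rewrite (_ : y + 2^-1 - (y - 2^-1) = 1); last by field.
    rewrite normr1 => h; rewrite [`|2^-1|]ger0_norm ?invr_ge0//.
    by rewrite ltr_pdivrMr// mul1r (le_lt_trans h)// ltr1n.
  apply: cvgM; last exact: cvg_cst.
  by apply: cvgB; apply: cvg_norm; [apply: cvgD|apply: cvgB];
    do ?[exact: cvg_id|exact: cvg_cst].
move=> x x2; have sx : `|sin x| <= 2^-1 by exact: le_trans (sin_le_norm _) x2.
have -> : clip (sin x) = sin x.
  move: sx; rewrite ler_norml /clip => /andP[s1 s2].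
  rewrite ger0_norm; last by lra.
  by rewrite ler0_norm; [field|lra].
rewrite sinK// in_itv/=; have := pihalf_ge1 R; move: x2; rewrite ler_norml => /andP[].
by move=> *; apply/andP; split; lra.
Qed.

Hypothesis iX2 : forall n, rintegrable P (fun w => X n w ^+ 2).
Hypothesis inu2 : rintegrable nu (fun x : R => x ^+ 2).

(** On [-K, K] the function f is a continuous function of sin(x/(2K)), so a Bernstein polynomial in
    this sine, which is a trigonometric polynomial G, approximates it uniformly. Outside, |f - G| is
    bounded by a constant A, hence by A x^2/K^2, whose expectation is small by the bound V on second
    moments. Convergence for G is [cvg_trigp]. *)
Lemma trig_cvg_in_distribution (V : R) :
  (\forall n \near \oo, rint P (fun w => X n w ^+ 2) <= V) -> rint nu (fun x : R => x ^+ 2) <= V ->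
  cvg_in_distribution P X nu.
Proof.
move=> PV nuV f cf [F0 [_ hF0]].
have [F F1 hF] : exists2 F : R, 1 <= F & forall x, `|f x| <= F.
  exists (Num.max 1 (F0 + 1)); first by rewrite le_max lexx.
  by move=> x; apply: (hF0 (Num.max 1 (F0 + 1))) => //; rewrite lt_max ltrDl ltr01 orbT.
have mf := continuous_measurable_fun cf.
have mfX n : measurable_fun setT (fun w => f (X n w)) by exact: measurableT_comp.
have ifX n : rintegrable P (fun w => f (X n w)).
  by apply: rintegrable_bounded (mfX n) _ => w; exact: hF.
have ifnu : rintegrable nu f by exact: (@rintegrable_bounded _ _ _ nu f F).
have V0 : 0 <= V by apply: le_trans nuV; apply: rint_ge0 => x; exact: sqr_ge0.
rewrite (_ : (\int[nu]_x (f x)%:E)%E = (rint nu f)%:E); last by rewrite rintE.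
rewrite (_ : (fun n => _) = EFin \o (fun n => rint P (fun w => f (X n w)))); last first.
  by apply/funext => n; rewrite unlock /= rintE.
apply: cvg_EFin; first exact: nearW.
apply/cvgrPdist_le => /= e e0.
(* A bounds |f - G| everywhere: 2F for two values of f, and 1 for the Bernstein error, which is why
   e' is at most 1. *)
pose A := 2 * F + 1.
have A0 : 0 < A by rewrite addr_gt0// mulr_gt0// (lt_le_trans _ F1).
pose e' := Num.min 1 (e / 8).
have e'0 : 0 < e' by rewrite lt_min ltr01 divr_gt0.
(* K is so large that A V/K^2 <= e/4. *)
pose K := 1 + 4 * A * V / e.
have K1 : 1 <= K by rewrite lerDl divr_ge0 ?(ltW e0)// !mulr_ge0 ?(ltW A0).
have K0 : 0 < K by exact: lt_le_trans K1.
have AKV : A / K ^+ 2 * V <= e / 4.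
  rewrite mulrAC ler_pdivrMr ?exprn_gt0//.
  have KK : K <= K ^+ 2 by rewrite expr2 ler_peMr// ltW.
  have : 4 * A * V / e <= K by rewrite lerDr.
  rewrite ler_pdivrMr// => h; have := ler_wpM2r (ltW e0) KK; move: h.
  rewrite -[4 * A * V]mulrA; move: (A * V) (K * e) (K ^+ 2) => u v w h1 h2.
  have -> : e / 4 * w = w * e / 4 by field.
  by move: (w * e) h2 => z; lra.
have [k ck hk] := continuous_inverse_sin.
(* This keeps |s x| <= 1/2 on [-K, K], the range where the sine is inverted. *)
pose s := (2 * K)^-1.
have s0 : 0 < s by rewrite invr_gt0 mulr_gt0.
pose h (y : R) := f (k (2 * y - 1) / s).
have ch : continuous h.
  move=> y; rewrite (_ : h = f \o ((fun z => k z / s) \o (fun y : R => 2 * y - 1)))//.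
  apply: continuous_comp; last exact: cf.
  apply: continuous_comp; last by apply: cvgM; [exact: ck|exact: cvg_cst].
  by apply: cvgB; [apply: cvgM; [exact: cvg_cst|exact: cvg_id]|exact: cvg_cst].
have [N hN] := bern_uniform ch (fun y => hF _) e'0.
pose G (x : R) := bern N (fun k => h (k%:R / N%:R)) ((1 + sin (s * x)) / 2).
have tG : trigp G by exact: trigp_bern.
have fG x : `|f x - G x| <= e' + A / K ^+ 2 * x ^+ 2.
  set y := (1 + sin (s * x)) / 2.
  have y01 : 0 <= y <= 1.
    by rewrite /y; have := sin_le1 (s * x); have := sin_geN1 (s * x) => *; apply/andP; split; lra.
  have hy := hN y y01; have [xK|xK] := leP `|x| K.
    have <- : h y = f x.
      rewrite /h (_ : 2 * y - 1 = sin (s * x)); last by rewrite /y; field.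
      rewrite hk ?[s * x]mulrC ?mulfK ?gt_eqF//.
      rewrite normrM (gtr0_norm s0) /s invfM mulrCA ler_piMr// ler_pdivrMr// mul1r//.
    by rewrite (le_trans hy)// lerDl mulr_ge0 ?sqr_ge0// divr_ge0 ?exprn_ge0// ltW.
  have fg : `|f x - G x| <= A.
    have -> : f x - G x = (f x - h y) + (h y - G x) by ring.
    rewrite (le_trans (ler_normD _ _))// /A lerD//.
      rewrite (le_trans (ler_normB _ _))// mulr2n mulrDl mul1r; apply: lerD => //.
      exact: hF.
    by rewrite (le_trans hy)// ge_min lexx.
  rewrite (le_trans fg)// (le_trans (_ : A <= A / K ^+ 2 * x ^+ 2))//; last by rewrite lerDr ltW.
  rewrite mulrAC ler_pdivlMr ?exprn_gt0// ler_wpM2l ?(ltW A0)//.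
  by rewrite -[leRHS]real_normK ?num_real// lerXn2r ?nnegrE// ltW.
have mG := continuous_measurable_fun (trigp_continuous tG).
have [C hC] := trigp_bounded tG.
have inuG : rintegrable nu G by exact: (@rintegrable_bounded _ _ _ nu G C).
have iPG n : rintegrable P (fun w => G (X n w)).
  by apply: (@rintegrable_bounded _ _ _ P _ C) => [|w]; [exact: measurableT_comp|exact: hC].
have AK0 : 0 <= A / K ^+ 2 by rewrite divr_ge0 ?exprn_ge0 ?ltW.
have d1 : `|rint nu f - rint nu G| <= 3 / 8 * e.
  have e8 : e' <= e / 8 by rewrite ge_min lexx orbT.
  apply: (le_trans (@rint_approx _ _ _ nu f G (fun x => x ^+ 2) e' (A / K ^+ 2) ifnu inuG inu2 fG)).
  by have := ler_wpM2l AK0 nuV; move: AKV e8; lra.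
have d2 n : rint P (fun w => X n w ^+ 2) <= V -> `|rint P (fun w => f (X n w)) - rint P (fun w => G (X n w))| <= 3 / 8 * e.
  move=> PVn; have e8 : e' <= e / 8 by rewrite ge_min lexx orbT.
  apply: (le_trans (@rint_approx _ _ _ P _ _ (fun w => X n w ^+ 2) e' (A / K ^+ 2) (ifX n) (iPG n) (iX2 n) (fun w => fG _))).
  by have := ler_wpM2l AK0 PVn; move: AKV e8; lra.
have e4 : 0 < e / 4 by rewrite divr_gt0.
have /cvgrPdist_le/(_ _ e4) := cvg_trigp tG.
apply: filterS2 PV => n PVn h3.
have -> : rint nu f - rint P (fun w => f (X n w)) = (rint nu f - rint nu G) +
  (rint nu G - rint P (fun w => G (X n w))) -
  (rint P (fun w => f (X n w)) - rint P (fun w => G (X n w))) by ring.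
apply: (le_trans (ler_normB _ _)); apply: (le_trans (lerD (ler_normD _ _) (lexx _))).
by move: d1 (d2 n PVn) h3; lra.
Qed.

End weak_convergence.

(** * Method of moments *)

Lemma cvg_sum_seq {R : realType} (I : Type) (r : seq I) (u : I -> nat -> R) (l : I -> R) :
  (forall i, u i n @[n --> \oo] --> l i) ->
  \sum_(i <- r) u i n @[n --> \oo] --> \sum_(i <- r) l i.
Proof.
move=> ul; elim: r => [|i r IH].
  by rewrite big_nil; under eq_fun do rewrite big_nil; exact: cvg_cst.
by rewrite big_cons; under eq_fun do rewrite big_cons; exact: cvgD.
Qed.

Section method_of_moments.
Context {R : realType} {d : measure_display} {T : measurableType d}.
Variables (P : probability T R) (W : nat -> T -> R) (b : nat -> R)
  (nu : probability (measurableTypeR R) R).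
Hypothesis mW : forall n, measurable_fun setT (W n).
Hypothesis iW : forall n k, rintegrable P (fun w => W n w ^+ k).
Hypothesis inu : forall k, rintegrable nu (fun x : R => x ^+ k).
Hypothesis cvg_moments : forall k,
  rint P (fun w => W n w ^+ k) @[n --> \oo] --> rint nu (fun x : R => x ^+ k).
Hypothesis moments_small : forall s : R,
  s ^+ m.*2 * rint nu (fun x : R => x ^+ m.*2) / (m.*2)`!%:R @[m --> \oo] --> (0 : R).
Hypothesis cvg_b : b n @[n --> \oo] --> (0 : R).

(** Taylor expansion to the even order 2m, so that the remainder is a moment without absolute
    value. *)
Let taylor_approx dd (S : measurableType dd) (Q : probability S R) (Z : S -> R)
    (s c : R) m : measurable_fun setT Z -> (forall k, rintegrable Q (fun w => Z w ^+ k)) ->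
  `|rint Q (fun w => sin (s * Z w + c)) -
    \sum_(j < m.*2) sin (c + j%:R * (pi / 2)) * (s ^+ j / j`!%:R * rint Q (fun w => Z w ^+ j))|
  <= s ^+ m.*2 * rint Q (fun w => Z w ^+ m.*2) / (m.*2)`!%:R.
Proof.
move=> mZ iZ.
have iT (j : 'I_m.*2) : rintegrable Q
    (fun w => sin (c + j%:R * (pi / 2)) * (s ^+ j / j`!%:R * Z w ^+ j)).
  by apply: rintegrableZ; apply: rintegrableZ.
have -> : \sum_(j < m.*2) sin (c + j%:R * (pi / 2)) *
     (s ^+ j / j`!%:R * rint Q (fun w => Z w ^+ j)) =
   rint Q (fun w => \sum_(j < m.*2) sin (c + j%:R * (pi / 2)) * (s ^+ j / j`!%:R * Z w ^+ j)).
  rewrite rint_sum => [|j _]; last exact: iT.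
  by apply: eq_bigr => j _; rewrite rintZ ?rintZ//; exact: rintegrableZ.
have ms : measurable_fun setT (fun w => sin (s * Z w + c)).
  apply: measurableT_comp; first exact: (continuous_measurable_fun (@continuous_sin R)).
  by apply: measurable_funD => //; exact: measurable_funM.
have iS : rintegrable Q (fun w => sin (s * Z w + c)).
  by apply: (@rintegrable_bounded _ _ _ Q _ 1) => // w; exact: sin_max.
have := @rint_approx _ _ _ Q (fun w => sin (s * Z w + c))
  (fun w => \sum_(j < m.*2) sin (c + j%:R * (pi / 2)) * (s ^+ j / j`!%:R * Z w ^+ j))
  (fun w => Z w ^+ m.*2) 0 (s ^+ m.*2 / (m.*2)`!%:R) iS.
rewrite add0r mulrAC; apply => //; first by apply: rintegrable_sum => j _; exact: iT.
move=> w; rewrite add0r; have := sin_taylor_le m.*2 c (s * Z w).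
rewrite (_ : sin_taylor _ _ _ = \sum_(j < m.*2) sin (c + j%:R * (pi / 2)) *
  (s ^+ j / j`!%:R * Z w ^+ j)); last first.
  by apply: eq_bigr => j _; rewrite exprMn [s ^+ j / _ * _]mulrAC.
by rewrite -normrX [`|(s * Z w) ^+ _|]ger0_norm ?exprn_even_ge0 ?odd_double// exprMn [X in _ <= X -> _]mulrAC.
Qed.

(** First fix m with a small Taylor remainder under the limit law, by [moments_small]. The remainder
    for W n and the Taylor sums involve finitely many moments and converge. *)
Let cvg_sin_W (s c : R) :
  rint P (fun w => sin (s * W n w + c)) @[n --> \oo] --> rint nu (fun x : R => sin (s * x + c)).
Proof.
apply/cvgrPdist_le => /= e e0.
have e8 : 0 < e / 8 by rewrite divr_gt0.
have /cvgrPdist_le/(_ _ e8)[m _ /(_ m (leqnn m))] := moments_small s.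
rewrite sub0r normrN => hm.
have hn := @taylor_approx _ _ nu (fun x : R => x) s c m (@measurable_id _ _ _) inu.
pose S (Q : nat -> R) := \sum_(j < m.*2) sin (c + j%:R * (pi / 2)) * (s ^+ j / j`!%:R * Q j).
have cS : S (fun j => rint P (fun w => W n w ^+ j)) @[n --> \oo] -->
    S (fun j => rint nu (fun x : R => x ^+ j)).
  apply: cvg_sum_seq => j; apply: cvgM; first exact: cvg_cst.
  by apply: cvgM; [exact: cvg_cst|exact: cvg_moments].
have cm : s ^+ m.*2 * rint P (fun w => W n w ^+ m.*2) / (m.*2)`!%:R @[n --> \oo] -->
    s ^+ m.*2 * rint nu (fun x : R => x ^+ m.*2) / (m.*2)`!%:R.
  by apply: cvgM; [apply: cvgM; [exact: cvg_cst|exact: cvg_moments]|exact: cvg_cst].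
move/cvgrPdist_le/(_ _ e8) : cS; move/cvgrPdist_le/(_ _ e8) : cm.
apply: filterS2 => n h1 h2.
have hP := @taylor_approx _ _ P (W n) s c m (mW n) (iW n).
rewrite -/(S (fun j => rint nu (fun x : R => x ^+ j))) in hn.
rewrite -/(S (fun j => rint P (fun w => W n w ^+ j))) in hP.
move: hn hP h1 h2 hm.
set u := s ^+ _ * rint nu _ / _; set v := s ^+ _ * rint P _ / _.
set Su := S _; set Sv := S _.
set x := rint nu _; set y := rint P _.
rewrite !ler_norml => /andP[? ?] /andP[? ?] /andP[? ?] /andP[? ?] /andP[? ?].
by apply/andP; split; lra.
Qed.

(** The deterministic shift b n changes each sine by at most |s b n|, and the second moments of W n
    + b n are eventually at most that of the limit plus 1. *)
Lemma moments_cvg_in_distribution :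
  cvg_in_distribution P (fun n w => W n w + b n) nu.
Proof.
have msin (f : T -> R) : measurable_fun setT f -> measurable_fun setT (fun w => sin (f w)).
  by move=> mf; apply: measurableT_comp mf; exact: (continuous_measurable_fun (@continuous_sin R)).
have iX2 n : rintegrable P (fun w => (W n w + b n) ^+ 2).
  rewrite (_ : (fun _ => _) = (fun w => (W n w ^+ 2 + 2 * b n * W n w ^+ 1) + b n ^+ 2 * W n w ^+ 0)).
    by apply: rintegrableD; [apply: rintegrableD => //|]; exact: rintegrableZ.
  by apply/funext => w; rewrite expr1 expr0; ring.
have mX n : measurable_fun setT (fun w => W n w + b n) by exact: measurable_funD.
apply: (@trig_cvg_in_distribution _ _ _ P (fun n w => W n w + b n) nu _ _ iX2 _
  (rint nu (fun x : R => x ^+ 2) + 1)) => //.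
- move=> s c; apply/cvgrPdist_le => /= e e0.
  have e2 : 0 < e / 2 by rewrite divr_gt0.
  have csb : s * b n @[n --> \oo] --> (0 : R).
    by rewrite -[X in _ --> X](mulr0 s); apply: cvgM; [exact: cvg_cst|exact: cvg_b].
  move/cvgrPdist_le/(_ _ e2) : csb; move/cvgrPdist_le/(_ _ e2) : (@cvg_sin_W s c).
  apply: filterS2 => n h1; rewrite sub0r normrN => h2.
  have h3 : `|rint P (fun w => sin (s * (W n w + b n) + c)) -
      rint P (fun w => sin (s * W n w + c))| <= `|s * b n|.
    have m1 : measurable_fun setT (fun w => sin (s * (W n w + b n) + c)).
      by apply: msin; apply: measurable_funD => //; exact: measurable_funM.
    have m2 : measurable_fun setT (fun w => sin (s * W n w + c)).
      by apply: msin; apply: measurable_funD => //; exact: measurable_funM.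
    suff : `|rint P (fun w => sin (s * (W n w + b n) + c)) -
        rint P (fun w => sin (s * W n w + c))| <= `|s * b n| + 0 * rint P (fun=> 1).
      by rewrite mul0r addr0.
    apply: rint_approx.
    - by apply: (@rintegrable_bounded _ _ _ P _ 1) => // w; exact: sin_max.
    - by apply: (@rintegrable_bounded _ _ _ P _ 1) => // w; exact: sin_max.
    - exact: finite_measure_integrable_cst.
    - move=> w; rewrite mul0r addr0.
      have := sin_taylor_le 1 (s * W n w + c) (s * b n).
      rewrite /sin_taylor big_ord_recl big_ord0 mul0r !addr0 expr0 expr1 divr1 !mulr1 divr1.
      by rewrite (_ : s * b n + (s * W n w + c) = s * (W n w + b n) + c)//; ring.
  have -> : rint nu (fun x : R => sin (s * x + c)) -
      rint P (fun w => sin (s * (W n w + b n) + c)) =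
    (rint nu (fun x : R => sin (s * x + c)) - rint P (fun w => sin (s * W n w + c))) -
    (rint P (fun w => sin (s * (W n w + b n) + c)) - rint P (fun w => sin (s * W n w + c))).
    by ring.
  apply: (le_trans (ler_normB _ _)).
  apply: (le_trans (lerD h1 (le_trans h3 h2))).
  by rewrite -splitr.
- have cX : rint P (fun w => (W n w + b n) ^+ 2) @[n --> \oo] -->
      rint nu (fun x : R => x ^+ 2) + 2 * 0 * rint nu (fun x : R => x ^+ 1) + 0 * 0.
    rewrite (_ : (fun n => _) = (fun n => rint P (fun w => W n w ^+ 2) +
        2 * b n * rint P (fun w => W n w ^+ 1) + b n * b n)).
      apply: cvgD; last exact: cvgM.
      apply: cvgD; first exact: cvg_moments.
      by apply: cvgM; [apply: cvgM; [exact: cvg_cst|exact: cvg_b]|exact: cvg_moments].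
    apply/funext => n; rewrite -[b n * b n](rint_cst P) -rintZ// -rintD//; last exact: rintegrableZ.
    rewrite -rintD.
    - by apply: eq_rint => w; rewrite expr1; ring.
    - by apply: rintegrableD => //; exact: rintegrableZ.
    - exact: finite_measure_integrable_cst.
  move: cX; rewrite mulr0 !mul0r !addr0 => /cvgrPdist_le/(_ 1 ltr01).
  by apply: filterS => n; rewrite ler_norml => /andP[h _]; move: h; lra.
- by rewrite lerDl.
Qed.

End method_of_moments.

(** * Moments of the normal law *)

Section normal_moments.
Context {R : realType}.
Variables (m sigma : R).
Hypothesis sigma0 : 0 < sigma.
Local Notation mu := (@lebesgue_measure R).
Local Notation nu := (normal_prob m sigma).
Local Notation pdf := (normal_pdf m sigma).

Let s_neq0 : sigma != 0. Proof. by rewrite gt_eqF. Qed.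

(** The Radon-Nikodym derivative of the normal law agrees almost everywhere with [normal_pdf],
    because both have the same integral over every measurable set. *)
Lemma ge0_integral_normal_prob (f : R -> \bar R) : measurable_fun setT f ->
  (forall x, 0 <= f x)%E ->
  (\int[nu]_x f x = \int[mu]_x (f x * (pdf x)%:E))%E.
Proof.
move=> mf f0; have dom := normal_prob_dominates m sigma.
rewrite -(@Radon_Nikodym_SigmaFinite.change_of_variables _ _ _ nu mu dom f setT)//.
have mrn := @Radon_Nikodym_SigmaFinite.f_integrable _ _ _ nu mu dom.
apply: ae_eq_integral => //.
- by apply: emeasurable_funM => //; exact: measurable_int mrn.
- by apply: emeasurable_funM => //; apply/measurable_EFinP; exact: measurable_normal_pdf.
- apply: ae_eqe_mul2l; apply: integral_ae_eq => //.
  + by apply/measurable_EFinP; exact: measurable_normal_pdf.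
  + by move=> E _ mE; rewrite -(@Radon_Nikodym_SigmaFinite.f_integral _ _ _ nu mu dom).
Qed.

Lemma rintegrable_normal_prob (f : R -> R) : measurable_fun setT f ->
  rintegrable mu (fun x => f x * pdf x) -> rintegrable nu f.
Proof.
move=> mf /integrableP[_ intf]; apply/integrableP; split; first exact/measurable_EFinP.
rewrite ge0_integral_normal_prob//; last by apply: measurableT_comp => //; exact/measurable_EFinP.
rewrite (le_lt_trans _ intf)// le_eqVlt; apply/orP; left; apply/eqP.
apply: eq_integral => x _ /=.
by rewrite normrM [`|pdf x|]ger0_norm ?normal_pdf_ge0.
Qed.

Lemma rint_normal_prob (f : R -> R) : measurable_fun setT f ->
  rintegrable mu (fun x => f x * pdf x) -> rint nu f = rint mu (fun x => f x * pdf x).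
Proof.
move=> mf intf; have iF := rintegrable_normal_prob mf intf.
have mF : measurable_fun setT (EFin \o f) by exact/measurable_EFinP.
rewrite /rint /Rintegral; congr fine.
rewrite [LHS]integralE [RHS]integralE; congr (_ - _)%E.
- rewrite ge0_integral_normal_prob; [|exact: measurable_funepos|by move=> x; exact: funepos_ge0].
  apply: eq_integral => x _; rewrite !funeposE/= -!EFin_max -EFinM.
  by rewrite maxr_pMl ?mul0r// normal_pdf_ge0.
- rewrite ge0_integral_normal_prob; [|exact: measurable_funeneg|by move=> x; exact: funeneg_ge0].
  apply: eq_integral => x _; rewrite !funenegE/= -!EFin_max -EFinM.
  by rewrite maxr_pMl ?mul0r ?mulNr// normal_pdf_ge0.
Qed.

Let q (y : R) := expR (- y ^+ 2 / (sigma ^+ 2 *+ 2)).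

Let pdfE x : pdf x = normal_peak sigma * q (x - m).
Proof. by rewrite normal_pdfE. Qed.

(** Powers are absorbed by doubling the standard deviation, which gives integrability of all moments
    by comparison with another normal density. *)
Let pow_exp_bound (j : nat) : exists2 C : R, 0 <= C &
  forall y, `|y| ^+ j * q y <= C * expR (- y ^+ 2 / ((2 * sigma) ^+ 2 *+ 2)).
Proof.
(* With t = y^2/c the wide Gaussian is e^(-t), q is at most e^(-2t), and y^(2j) <= c^j j! e^t from
   the exponential series. *)
pose c := 8 * sigma ^+ 2.
have c0 : 0 < c by rewrite mulr_gt0// exprn_gt0.
exists (1 + c ^+ j * j`!%:R); first by rewrite addr_ge0// mulr_ge0// exprn_ge0// ltW.
move=> y; pose t := y ^+ 2 / c.
have t0 : 0 <= t by rewrite divr_ge0 ?sqr_ge0// ltW.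
have y1 : `|y| ^+ j <= 1 + y ^+ 2 ^+ j.
  have [h|h] := leP `|y| 1.
    by rewrite (le_trans (exprn_ile1 j (normr_ge0 y) h))// lerDl exprn_ge0// sqr_ge0.
  apply: (@le_trans _ _ (y ^+ 2 ^+ j)); last by rewrite lerDr.
  rewrite -[y ^+ 2]real_normK ?num_real// -exprM mulnC exprM expr2 ler_peMr ?exprn_ge0//.
  by rewrite exprn_ege1// ltW.
have y2 : y ^+ 2 ^+ j <= c ^+ j * j`!%:R * expR t.
  rewrite (_ : y ^+ 2 = c * t); last by rewrite /t; field; rewrite gt_eqF.
  rewrite exprMn -mulrA ler_wpM2l ?exprn_ge0 ?(ltW c0)//.
  case: (j) => [|k].
    by rewrite expr0 fact0 mul1r (le_trans _ (expR_ge1Dx _))// lerDl.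
  rewrite [leRHS]mulrC -ler_pdivrMr ?ltr0n ?fact_gt0//.
  apply: le_trans (@expR_ge1Dxn R t k t0); by rewrite lerDr.
have e1 : 1 <= expR t by rewrite (le_trans _ (expR_ge1Dx _))// lerDl.
have y3 : `|y| ^+ j <= (1 + c ^+ j * j`!%:R) * expR t.
  by rewrite (le_trans y1)// mulrDl lerD// mul1r.
have -> : expR (- y ^+ 2 / ((2 * sigma) ^+ 2 *+ 2)) = expR (- t).
  by congr expR; rewrite /t /c (_ : (2 * sigma) ^+ 2 *+ 2 = 8 * sigma ^+ 2) ?mulNr//; rewrite mulr2n; ring.
have qE : q y <= expR (- t) * expR (- t).
  rewrite -expRD ler_expR /t /c -subr_ge0.
  rewrite (_ : sigma ^+ 2 *+ 2 = 2 * sigma ^+ 2); last by rewrite mulr2n; ring.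
  rewrite (_ : _ - _ = y ^+ 2 / sigma ^+ 2 / 4); last by field.
  by rewrite !divr_ge0 ?sqr_ge0.
apply: (le_trans (ler_wpM2l (exprn_ge0 _ (normr_ge0 y)) qE)).
rewrite mulrA ler_wpM2r ?expR_ge0// -ler_pdivlMr ?expR_gt0// expRN invrK.
exact: y3.
Qed.

Let mpow k : measurable_fun setT (fun x : R => (x - m) ^+ k).
Proof. by apply: measurable_funX; exact: measurable_funB. Qed.

Let rintegrable_pow (k : nat) : rintegrable mu (fun x => (x - m) ^+ k * pdf x).
Proof.
have [C C0 hC] := pow_exp_bound k.
have s20 : 2 * sigma != 0 by rewrite mulf_neq0.
have i2 : rintegrable mu (normal_pdf m (2 * sigma)) by exact: integrable_normal_pdf.
pose K := normal_peak sigma * C / normal_peak (2 * sigma).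
apply: (rintegrable_le _ _ (rintegrableZ K i2)).
  by apply: measurable_funM; [exact: mpow|exact: measurable_normal_pdf].
move=> x; rewrite pdfE normrM normrX /K normal_pdfE//.
have pk := normal_peak_gt0 s20.
rewrite [leRHS](_ : _ = normal_peak sigma * (C * normal_fun m (2 * sigma) x)); last first.
  by field; rewrite gt_eqF.
have -> : `|normal_peak sigma * q (x - m)| = normal_peak sigma * q (x - m).
  by rewrite ger0_norm// mulr_ge0 ?normal_peak_ge0 ?expR_ge0.
by rewrite mulrCA ler_wpM2l ?normal_peak_ge0.
Qed.

Let is_derive_q (y : R) : is_derive y 1 q (- (y / sigma ^+ 2) * q y).
Proof.
have h2 := @is_deriveX R R id 2 y 1 1 (is_derive_id _ _).
have h3 := is_derive_scalel (- (sigma ^+ 2 *+ 2)^-1) h2.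
have h4 := @is_derive1_comp R expR (fun z => - (sigma ^+ 2 *+ 2)^-1 * (id ^+ 2) z) y _ _ (is_derive_expR _) h3.
have -> : q = (fun z => expR (- (sigma ^+ 2 *+ 2)^-1 * (id ^+ 2) z)).
  by apply/funext => z; rewrite /q exprfctE; congr expR; rewrite /=; ring.
apply: (is_derive_eq h4).
rewrite exprfctE /GRing.scale/= mulrC; congr (_ * _).
rewrite (_ : sigma ^+ 2 *+ 2 = 2 * sigma ^+ 2); last by rewrite mulr2n; ring.
by rewrite expr1; field; rewrite ?s_neq0.
Qed.

(* The boundary terms and the truncation error are both O(1/n). *)
Lemma rint_normal_derivative_eq0 (k : nat) :
  rint mu (fun x => k%:R * ((x - m) ^+ k.-1 * pdf x) -
     (sigma ^+ 2)^-1 * ((x - m) ^+ k.+1 * pdf x)) = 0.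
Proof.
pose F x := (x - m) ^+ k * pdf x.
pose f x := k%:R * ((x - m) ^+ k.-1 * pdf x) - (sigma ^+ 2)^-1 * ((x - m) ^+ k.+1 * pdf x).
have intf : rintegrable mu f by apply: rintegrableB; exact: rintegrableZ.
have intyf : rintegrable mu (fun x => (x - m) * f x).
  rewrite (_ : (fun _ => _) = (fun x => k%:R * ((x - m) ^+ k.-1.+1 * pdf x) -
     (sigma ^+ 2)^-1 * ((x - m) ^+ k.+2 * pdf x))).
    by apply: rintegrableB; exact: rintegrableZ.
  by apply/funext => x; rewrite /f !exprS; ring.
have dxm (x : R) : is_derive x 1 (fun y => y - m) 1.
  have := is_derive_affine 1 (- m) x.
  by rewrite (_ : (fun _ => _) = (fun y => y - m))//; apply/funext => y; rewrite mul1r.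
have dF (x : R) : is_derive x 1 F (f x).
  have h1 := @is_deriveX R R (fun y => y - m) k x 1 1 (dxm x).
  have h2 := @is_derive1_comp R q (fun y => y - m) x _ _ (is_derive_q (x - m)) (dxm x).
  have h3 := is_derive_scalel (normal_peak sigma) h2.
  have h4 := is_deriveM h1 h3.
  rewrite (_ : F = ((fun y => y - m) ^+ k) * (fun y => normal_peak sigma * (q \o (fun y => y - m)) y)).
    apply: (is_derive_eq h4); rewrite exprfctE /f !pdfE /GRing.scale/= !exprS; field.
    by rewrite s_neq0.
  by apply/funext => y; rewrite /F pdfE mulrfctE exprfctE.
have cpdf : continuous pdf by exact: continuous_normal_pdf.
have cX j : continuous (fun x : R => (x - m) ^+ j).
  elim: j => [|j IH] x; first by under eq_fun do rewrite expr0; exact: cvg_cst.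
  under eq_fun do rewrite exprS; apply: cvgM; last exact: IH.
  by apply: cvgB; [exact: cvg_id|exact: cvg_cst].
have cf : continuous f.
  move=> x; apply: cvgB; apply: cvgM; try exact: cvg_cst; apply: cvgM;
    by [exact: cX|exact: cpdf].
have [C C0 hC] := pow_exp_bound k.+1.
have hF (y : R) : `|y| * `|F (m + y)| <= normal_peak sigma * C.
  rewrite /F pdfE (_ : m + y - m = y); last by ring.
  rewrite normrM normrX mulrA -exprS ger0_norm; last first.
    by rewrite mulr_ge0 ?normal_peak_ge0 ?expR_ge0.
  rewrite mulrCA ler_wpM2l ?normal_peak_ge0// (le_trans (hC y))//.
  rewrite ler_piMr// -[leRHS]expR0 ler_expR mulNr oppr_le0 divr_ge0 ?sqr_ge0//.
  by rewrite mulrn_wge0// sqr_ge0.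
pose A := rint mu (fun x => `|(x - m) * f x|).
pose B := A + 2 * (normal_peak sigma * C).
have A0 : 0 <= A by exact: rint_ge0.
have key (n : nat) : `|rint mu f| <= B / n.+1%:R.
  pose N : R := n.+1%:R; have N0 : 0 < N by rewrite ltr0n.
  pose ind (x : R) : R := \1_(`[(m - N)%R, (m + N)%R]) x.
  have ii : rintegrable mu (fun x => ind x * f x).
    apply: (rintegrable_le _ _ (rintegrable_norm intf)).
      by apply: measurable_funM; [exact: measurable_indic|exact: continuous_measurable_fun].
    move=> x; rewrite normrM ler_piMl// /ind indicE.
    by case: (x \in _); rewrite ?normr1// normr0.
  have E1 : rint mu (fun x => ind x * f x) = F (m + N) - F (m - N).
    apply: rint_indic_itv_derive => //.
    by rewrite -subr_gt0 (_ : _ - _ = N + N) ?addr_gt0//; ring.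
  have E2 : `|rint mu f - rint mu (fun x => ind x * f x)| <= A / N.
    rewrite -rintB// mulrC -rintZ; last exact: rintegrable_norm.
    apply: le_rint_bound.
    - apply: measurable_funB; first exact: continuous_measurable_fun.
      by apply: measurable_funM; [exact: measurable_indic|exact: continuous_measurable_fun].
    - move=> x; rewrite -{1}[f x]mul1r -mulrBl !normrM mulrA ler_wpM2r//.
      rewrite /ind indicE mem_setE in_itv/= -ler_distl.
      have [h|h] := leP `|x - m| N.
        by rewrite subrr normr0 mulr_ge0// invr_ge0 ltW.
      by rewrite subr0 normr1 mulrC ler_pdivlMr// mul1r ltW.
    - by apply: rintegrableZ; exact: rintegrable_norm.
  have FN1 : `|F (m + N)| <= normal_peak sigma * C / N.
    by rewrite ler_pdivlMr// mulrC -{1}(gtr0_norm N0).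
  have FN2 : `|F (m - N)| <= normal_peak sigma * C / N.
    by rewrite ler_pdivlMr// mulrC -{1}(gtr0_norm N0) -normrN.
  have -> : rint mu f = (rint mu f - rint mu (fun x => ind x * f x)) +
     (F (m + N) - F (m - N)) by rewrite -E1; ring.
  rewrite (le_trans (ler_normD _ _))// (le_trans (lerD E2 (ler_normB _ _)))//.
  rewrite (le_trans (lerD (lexx _) (lerD FN1 FN2)))// /B -/N.
  by rewrite le_eqVlt; apply/orP; left; apply/eqP; field; rewrite gt_eqF.
apply/eqP; rewrite -normr_eq0 eq_le normr_ge0 andbT; apply/ler_addgt0Pl => e e0.
rewrite addr0 (le_trans (key (Num.truncn (B / e))))// ler_pdivrMr// mulrC -ler_pdivrMr//.
by rewrite ltW// truncnS_gt.
Qed.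

Lemma normal_moment_integrable k : rintegrable nu (fun x : R => (x - m) ^+ k).
Proof. by apply: rintegrable_normal_prob => //. Qed.

Lemma normal_moment1 : rint nu (fun x : R => (x - m) ^+ 1) = 0.
Proof.
rewrite rint_normal_prob//; have := rint_normal_derivative_eq0 0.
rewrite rintB; [|exact: rintegrableZ|exact: rintegrableZ].
rewrite (rintZ _ (rintegrable_pow 0)) (rintZ _ (rintegrable_pow 1)) mul0r sub0r => /eqP; rewrite oppr_eq0 mulf_eq0 invr_eq0 sqrf_eq0.
by rewrite (negbTE s_neq0)/= => /eqP.
Qed.

(** The derivative of (x - m)^(k+1) times the density has integral 0. *)
Lemma normal_moment_rec k : rint nu (fun x : R => (x - m) ^+ k.+2) =
  k.+1%:R * sigma ^+ 2 * rint nu (fun x : R => (x - m) ^+ k).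
Proof.
rewrite !rint_normal_prob//; have := rint_normal_derivative_eq0 k.+1.
rewrite rintB; [|exact: rintegrableZ|exact: rintegrableZ].
rewrite (rintZ _ (rintegrable_pow k)) (rintZ _ (rintegrable_pow k.+2)) => /eqP; rewrite subr_eq0 => /eqP h.
rewrite mulrAC h; field; exact: s_neq0.
Qed.

End normal_moments.

(** * Moments of Gaussian random variables *)

Section gaussian_law_moments.
Context {R : realType}.

Section dirac.
Variable m : R.
Local Notation dm := (\d_(m : measurableTypeR R) : probability (measurableTypeR R) R).

Lemma rintegrable_dirac (f : R -> R) : measurable_fun setT f -> rintegrable dm f.
Proof.
move=> mf; apply/integrableP; split; first exact/measurable_EFinP.
rewrite integral_dirac//; last by apply: measurableT_comp => //; exact/measurable_EFinP.
by rewrite diracT mul1e ltry.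
Qed.

Lemma rint_dirac (f : R -> R) : measurable_fun setT f -> rint dm f = f m.
Proof.
move=> mf; rewrite /rint /Rintegral integral_dirac//; last exact/measurable_EFinP.
by rewrite diracT mul1e.
Qed.

End dirac.

Let mpow (m : R) k : measurable_fun setT (fun x : R => (x - m) ^+ k).
Proof. by apply: measurable_funX; exact: measurable_funB. Qed.

(** The recursion also holds for the Dirac mass at v = 0, so degenerate linear combinations need no
    separate treatment later. *)
Lemma gaussian_law_moments (m v : R) : 0 <= v ->
  [/\ forall k, rintegrable (gaussian_law m v) (fun x : R => (x - m) ^+ k),
      rint (gaussian_law m v) (fun x : R => (x - m) ^+ 1) = 0 &
      forall k, rint (gaussian_law m v) (fun x : R => (x - m) ^+ k.+2) =
        k.+1%:R * v * rint (gaussian_law m v) (fun x : R => (x - m) ^+ k)].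
Proof.
move=> v0; rewrite /gaussian_law; have [v00|vn0] := eqVneq v 0.
  split=> [k||k]; first exact: rintegrable_dirac.
    by rewrite rint_dirac// subrr expr1.
  by rewrite rint_dirac// subrr v00 exprS mul0r mulr0 mul0r.
have s0 : 0 < Num.sqrt v by rewrite sqrtr_gt0 lt_neqAle eq_sym vn0.
split=> [k||k].
- exact: normal_moment_integrable.
- exact: normal_moment1.
- by rewrite normal_moment_rec// sqr_sqrtr.
Qed.

Context {d : measure_display} {T : measurableType d} (P : probability T R).

Lemma rint_law (X : T -> R) (nu : probability (measurableTypeR R) R) (f : R -> R) :
  measurable_fun setT X ->
  (forall A : set (measurableTypeR R), measurable A ->
     pushforward P (X : T -> measurableTypeR R) A = nu A) ->
  rintegrable nu f -> rintegrable P (fun w => f (X w)) /\ rint P (fun w => f (X w)) = rint nu f.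
Proof.
move=> mX hX intf.
have mf := rintegrable_measurable intf.
pose pX := measure_function_pushforward__canonical__measure_function_Measure P
  (mX : measurable_fun setT (X : T -> measurableTypeR R)).
have eqm (g : R -> \bar R) : (\int[nu]_x g x = \int[pX]_x g x)%E.
  by apply: eq_measure_integral => A mA _; exact: (esym (hX A mA)).
have ge0 (g : R -> \bar R) : measurable_fun setT g -> (forall x, 0 <= g x)%E ->
    (\int[nu]_x g x = \int[P]_w g (X w))%E.
  move=> mg g0; rewrite eqm.
  exact: (ge0_integral_pushforward (mX : measurable_fun setT (X : T -> measurableTypeR R)) P
    measurableT mg (fun x _ => g0 x)).
have mEf : measurable_fun setT (EFin \o f) by exact/measurable_EFinP.
split.
  apply/integrableP; split; first by apply/measurable_EFinP; exact: measurableT_comp.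
  case/integrableP : intf => _; rewrite (ge0 (fun x => `|(f x)%:E|%E))//.
  by apply: measurableT_comp.
rewrite /rint /Rintegral [in RHS]integralE.
rewrite (ge0 (EFin \o f)^\+%E); [|exact: measurable_funepos|by move=> x; exact: funepos_ge0].
rewrite (ge0 (EFin \o f)^\-%E); [|exact: measurable_funeneg|by move=> x; exact: funeneg_ge0].
rewrite [in LHS]integralE; congr (fine (_ - _)%E); apply: eq_integral => w _;
  by rewrite ?funeposE ?funenegE.
Qed.

Lemma gaussian_moments (X : T -> R) : measurable_fun setT X -> has_gaussian_law P X ->
  (forall k, rintegrable P (fun w => X w ^+ k)) /\
  (rint P X = 0 -> forall k, rint P (fun w => X w ^+ k.+2) =
     k.+1%:R * rint P (fun w => X w ^+ 2) * rint P (fun w => X w ^+ k)).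
Proof.
move=> mX [m [v [v0 hX]]].
have [iM M1 Mrec] := gaussian_law_moments m v0.
have ik k : rintegrable (gaussian_law m v) (fun x : R => x ^+ k).
  rewrite (_ : (fun _ => _) = (fun x : R => \sum_(i < k.+1) m ^+ (k - i) *+ 'C(k, i) * (x - m) ^+ i)).
    by apply: rintegrable_sum => i _; exact: rintegrableZ.
  apply/funext => x; rewrite -[in LHS](subrKC m x) exprDn.
  by apply: eq_bigr => i _; rewrite mulrnAl.
split=> [k|X0 k]; first by have [] := rint_law mX hX (ik k).
have E k' : rint P (fun w => X w ^+ k') = rint (gaussian_law m v) (fun x : R => x ^+ k').
  by have [] := rint_law mX hX (ik k').
(* The parameter m of the law is the mean, identified through the first moment. *)
have m0 : m = 0.
  have := E 1%N; rewrite (_ : rint P _ = rint P X); last first.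
    by apply: eq_rint => w; rewrite expr1.
  have iX : rintegrable (gaussian_law m v) (fun x : R => x ^+ 1) by exact: ik.
  rewrite X0 => h; have := M1.
  rewrite (_ : rint _ _ = rint (gaussian_law m v) (fun x : R => x ^+ 1 - m)); last first.
    by apply: eq_rint => x; rewrite !expr1.
  rewrite rintB//; last exact: finite_measure_integrable_cst.
  by rewrite -h rint_cst sub0r => /eqP; rewrite oppr_eq0 => /eqP.
have Ms k' : rint (gaussian_law m v) (fun x : R => x ^+ k') =
   rint (gaussian_law m v) (fun x : R => (x - m) ^+ k').
  by apply: eq_rint => x; rewrite m0 subr0.
rewrite !E !Ms !Mrec; congr (_ * _ * _).
rewrite mul1r (_ : rint _ _ = 1) ?mulr1//.
by rewrite -[RHS](rint_cst (gaussian_law m v)); apply: eq_rint => x; rewrite expr0.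
Qed.

End gaussian_law_moments.

(** * Random variables with finite moments of all orders *)

Section all_moments.
Context {R : realType} {d : measure_display} {T : measurableType d}.
Variable P : probability T R.

(** A class closed under sums and products, so that integrability of polynomials in Gaussian
    variables follows structurally. *)
Definition allmom (X : T -> R) := measurable_fun setT X /\
  forall k, rintegrable P (fun w => X w ^+ k).

Lemma allmom_int X : allmom X -> rintegrable P X.
Proof. by case=> _ /(_ 1%N); congr (rintegrable P _); apply/funext => w; rewrite expr1. Qed.

Lemma allmom_cst c : allmom (fun=> c).
Proof. by split=> [|k]; [exact: measurable_cst|exact: finite_measure_integrable_cst]. Qed.

Lemma allmomD X Y : allmom X -> allmom Y -> allmom (fun w => X w + Y w).
Proof.
move=> [mX iX] [mY iY]; split=> [|k]; first exact: measurable_funD.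
apply: (@rintegrable_le _ _ _ P _ (fun w => 2 ^+ k * (`|X w ^+ k| + `|Y w ^+ k|))).
- by apply: measurable_funX; exact: measurable_funD.
- move=> w; rewrite !normrX.
  apply: (@le_trans _ _ ((2 * Num.max `|X w| `|Y w|) ^+ k)).
    rewrite lerXn2r ?nnegrE ?mulr_ge0 ?le_max ?normr_ge0//.
    by rewrite (le_trans (ler_normD _ _))// mulr2n mulrDl !mul1r lerD// le_max lexx ?orbT.
  rewrite exprMn ler_wpM2l ?exprn_ge0//.
  by rewrite /Num.max; case: ifP => _; rewrite ?lerDl ?lerDr exprn_ge0.
- by apply: rintegrableZ; apply: rintegrableD; apply: rintegrable_norm.
Qed.

Lemma allmomM X Y : allmom X -> allmom Y -> allmom (fun w => X w * Y w).
Proof.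
move=> [mX iX] [mY iY]; split=> [|k]; first exact: measurable_funM.
apply: (@rintegrable_le _ _ _ P _ (fun w => X w ^+ (k * 2) + Y w ^+ (k * 2))).
- by apply: measurable_funX; exact: measurable_funM.
- move=> w; rewrite exprMn normrM !exprM.
  move: (X w ^+ k) (Y w ^+ k) => x y.
  rewrite -(real_normK (num_real x)) -(real_normK (num_real y)).
  have := sqr_ge0 (`|x| - `|y|); have := sqr_ge0 (`|x|); have := sqr_ge0 (`|y|).
  rewrite sqrrB; move: (`|x| ^+ 2) (`|y| ^+ 2) => u v; lra.
- exact: rintegrableD.
Qed.

Lemma allmomZ c X : allmom X -> allmom (fun w => c * X w).
Proof. by move=> aX; apply: allmomM => //; exact: allmom_cst. Qed.

Lemma allmomX X k : allmom X -> allmom (fun w => X w ^+ k).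
Proof.
move=> aX; elim: k => [|k IH]; first by under eq_fun do rewrite expr0; exact: allmom_cst.
by under eq_fun do rewrite exprS; exact: allmomM.
Qed.

Lemma allmom_sum I (r : seq I) (X : I -> T -> R) : (forall i, allmom (X i)) ->
  allmom (fun w => \sum_(i <- r) X i w).
Proof.
move=> aX; elim: r => [|i r IH].
  by under eq_fun do rewrite big_nil; exact: allmom_cst.
by under eq_fun do rewrite big_cons; exact: allmomD.
Qed.

End all_moments.

(** * Comparison of polynomial coefficients *)

Section polynomial_coefficient.
Context {R : realType}.

(** The difference vanishes at 0, 1, ..., size - 1, more roots than its degree. Reading off the
    coefficient of t in identities between expectations replaces differentiation at t = 0. *)
Lemma eq_poly_horner (p q : {poly R}) : (forall t, p.[t] = q.[t]) -> p = q.
Proof.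
move=> pq; apply/eqP; rewrite -subr_eq0; apply/eqP.
apply: (@roots_geq_poly_eq0 _ (p - q) [seq i%:R | i <- iota 0 (size (p - q)%R)]).
- by apply/allP => x _; rewrite rootE hornerD hornerN pq subrr.
- by rewrite map_inj_uniq ?iota_uniq// => i j /eqP; rewrite eqr_nat => /eqP.
- by rewrite size_map size_iota.
Qed.

End polynomial_coefficient.

(** * Gaussian integration by parts *)

Section gaussian_integration_by_parts.
Context {R : realType} {d : measure_display} {T : measurableType d}.
Variables (P : probability T R) (N : nat) (J : 'I_N -> T -> R).
Hypothesis mJ : forall k, measurable_fun setT (J k).
Hypothesis gJ : forall a : 'I_N -> R, has_gaussian_law P (fun w => \sum_k a k * J k w).
Hypothesis J0 : forall k, rint P (J k) = 0.

Local Notation E := (rint P).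

Definition lin (a : 'I_N -> R) (w : T) : R := \sum_k a k * J k w.
Definition cov (j k : 'I_N) : R := E (fun w => J j w * J k w).
Definition bil (a b : 'I_N -> R) : R := \sum_j \sum_k a j * b k * cov j k.

Let unitv (k : 'I_N) (j : 'I_N) : R := (j == k)%:R.

Lemma sum_unitv (k : 'I_N) (f : 'I_N -> R) : \sum_j unitv k j * f j = f k.
Proof.
rewrite (bigD1 k)//= /unitv eqxx mul1r big1 ?addr0// => j /negbTE ->.
by rewrite mul0r.
Qed.

Lemma lin_unitv k : lin (unitv k) = J k.
Proof. by apply/funext => w; rewrite /lin sum_unitv. Qed.

Let mlin a : measurable_fun setT (lin a).
Proof. by apply: measurable_sum => k; exact: measurable_funM. Qed.

Lemma allmom_lin a : allmom P (lin a).
Proof. by split=> //; have [] := gaussian_moments (mlin a) (gJ a). Qed.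

Lemma allmom_J k : allmom P (J k).
Proof. by rewrite -lin_unitv; exact: allmom_lin. Qed.

Hint Resolve allmom_lin allmom_J : core.

Lemma E_lin a : E (lin a) = 0.
Proof.
rewrite /lin rint_sum => [|k _]; last by apply/rintegrableZ/allmom_int.
by rewrite big1// => k _; rewrite rintZ ?J0 ?mulr0//; exact: allmom_int.
Qed.

Lemma bilE a b : bil a b = E (fun w => lin a w * lin b w).
Proof.
have aj j k : allmom P (fun w => a j * b k * (J j w * J k w)).
  by apply: allmomZ; apply: allmomM.
transitivity (E (fun w => \sum_j \sum_k a j * b k * (J j w * J k w))).
  rewrite rint_sum => [|j _]; last first.
    by apply: rintegrable_sum => k _; exact/allmom_int.
  apply: eq_bigr => j _; rewrite rint_sum => [|k _]; last exact/allmom_int.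
  by apply: eq_bigr => k _; rewrite rintZ//; apply: allmom_int; exact: allmomM.
apply: eq_rint => w; rewrite /lin big_distrlr; apply: eq_bigr => j _.
by apply: eq_bigr => k _ /=; ring.
Qed.

Lemma bilC a b : bil a b = bil b a.
Proof. by rewrite !bilE; apply: eq_rint => w; rewrite mulrC. Qed.

Lemma lin_rec a k : E (fun w => lin a w ^+ k.+2) =
  k.+1%:R * bil a a * E (fun w => lin a w ^+ k).
Proof.
have [_ h] := gaussian_moments (mlin a) (gJ a).
by rewrite (h (E_lin a)) bilE; congr (_ * _ * _); apply: eq_rint => w; rewrite expr2.
Qed.

(* X (Y_b + t Y_c)^k, in expectation, as a polynomial in t. *)
Definition mixpoly (X : T -> R) (b c : 'I_N -> R) (k : nat) : {poly R} :=
  \poly_(i < k.+1) ('C(k, i)%:R * E (fun w => X w * lin b w ^+ (k - i) * lin c w ^+ i)).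

Definition addv (t : R) (b c : 'I_N -> R) (j : 'I_N) : R := b j + t * c j.

Lemma lin_addv t b c w : lin (addv t b c) w = lin b w + t * lin c w.
Proof.
rewrite /lin mulr_sumr -big_split; apply: eq_bigr => j _ /=.
by rewrite /addv; ring.
Qed.

Lemma mixpolyE X b c k t : allmom P X ->
  (mixpoly X b c k).[t] = E (fun w => X w * lin (addv t b c) w ^+ k).
Proof.
move=> aX; rewrite horner_poly.
have ai (i : nat) : allmom P (fun w => X w * lin b w ^+ (k - i) * lin c w ^+ i).
  by apply: allmomM; [apply: allmomM => //|]; exact: allmomX.
transitivity (E (fun w => \sum_(i < k.+1) 'C(k, i)%:R * t ^+ i *
   (X w * lin b w ^+ (k - i) * lin c w ^+ i))).
  rewrite rint_sum => [|i _]; last by apply/rintegrableZ/allmom_int.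
  by apply: eq_bigr => i _; rewrite rintZ; [ring|exact/allmom_int].
apply: eq_rint => w; rewrite lin_addv exprDn mulr_sumr; apply: eq_bigr => i _.
by rewrite exprMn -mulr_natl; ring.
Qed.

Lemma mixpoly_coef0 X b c k : (mixpoly X b c k)`_0 = E (fun w => X w * lin b w ^+ k).
Proof.
rewrite coef_poly/= bin0 mul1r subn0; apply: eq_rint => w.
by rewrite expr0 mulr1.
Qed.

Lemma mixpoly_coef1 X b c k :
  (mixpoly X b c k)`_1 = k%:R * E (fun w => X w * lin b w ^+ k.-1 * lin c w).
Proof.
rewrite coef_poly ltnS; case: k => [|k]; first by rewrite mul0r.
by rewrite /= bin1 subn1.
Qed.

Lemma bil_addvr t a b c : bil a (addv t b c) = bil a b + t * bil a c.
Proof.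
rewrite /bil mulr_sumr -big_split; apply: eq_bigr => j _ /=.
rewrite mulr_sumr -big_split; apply: eq_bigr => k _ /=.
by rewrite /addv; ring.
Qed.

Lemma bil_addvl t a b c : bil (addv t b c) a = bil b a + t * bil c a.
Proof. by rewrite bilC bil_addvr !(bilC a). Qed.

(** Polarization of the one-dimensional moment recursion: apply it to Y_b + t Y_c and compare the
    coefficients of t. The term E(Y_c Y_b^(m-2)) that appears is known by strong induction on m. *)
Lemma E_lin_pow c b m : E (fun w => lin c w * lin b w ^+ m) =
  m%:R * bil c b * E (fun w => lin b w ^+ m.-1).
Proof.
elim/ltn_ind: m => m IH; case: m IH => [|k] IH.
  rewrite !mul0r -[RHS](E_lin c); apply: eq_rint => w.
  by rewrite expr0 mulr1.
pose one : T -> R := fun=> 1.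
have a1 : allmom P one by exact: allmom_cst.
have pE : mixpoly one b c k.+2 = k.+1%:R *:
    (((bil b b)%:P + (2 * bil b c) *: 'X + (bil c c) *: 'X^2) * mixpoly one b c k).
  apply: eq_poly_horner => t.
  rewrite hornerZ hornerM !hornerD !hornerZ hornerC hornerX hornerXn !mixpolyE//.
  transitivity (E (fun w => lin (addv t b c) w ^+ k.+2)).
    by apply: eq_rint => w; rewrite mul1r.
  rewrite lin_rec bil_addvr !bil_addvl (bilC c b) -mulrA; congr (_ * (_ * _)); first by ring.
  by apply: eq_rint => w; rewrite mul1r.
move/(congr1 (fun p : {poly R} => p`_1)) : pE.
rewrite mixpoly_coef1 coefZ coefM !big_ord_recl big_ord0/= !coefD !coefZ !coefC !coefX !coefXn/=.
rewrite !mixpoly_coef0 mixpoly_coef1 !(mulr0, mulr1, addr0, add0r).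
have -> : E (fun w => one w * lin b w ^+ k.+1 * lin c w) = E (fun w => lin c w * lin b w ^+ k.+1).
  by apply: eq_rint => w; rewrite mul1r mulrC.
have -> : E (fun w => one w * lin b w ^+ k.-1 * lin c w) = E (fun w => lin c w * lin b w ^+ k.-1).
  by apply: eq_rint => w; rewrite mul1r mulrC.
have -> : E (fun w => one w * lin b w ^+ k) = E (fun w => lin b w ^+ k).
  by apply: eq_rint => w; rewrite mul1r.
have h : k%:R * bil b b * E (fun w => lin c w * lin b w ^+ k.-1) =
    k%:R * bil c b * E (fun w => lin b w ^+ k).
  case: k IH => [|k] IH; first by rewrite !mul0r.
  rewrite (IH k)//=; case: k {IH} => [|k]; last by rewrite lin_rec; ring.
  rewrite (_ : E (fun w => lin b w ^+ 1) = 0); first by ring.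
  by rewrite -[RHS](E_lin b); apply: eq_rint => w; rewrite expr1.
move=> h2; apply: (@mulfI _ k.+2%:R); first by rewrite pnatr_eq0.
rewrite h2 (bilC b c).
rewrite (_ : bil b b * (k%:R * E (fun w => lin c w * lin b w ^+ k.-1)) =
   k%:R * bil c b * E (fun w => lin b w ^+ k)); last by rewrite -h; ring.
by rewrite -!natr1 /=; ring.
Qed.

(* X with formal gradient DX satisfies Gaussian integration by parts, stably
   under multiplication by powers of linear forms. *)
Definition gradient (X : T -> R) (DX : 'I_N -> T -> R) : Prop :=
  [/\ allmom P X, forall j, allmom P (DX j) & forall c b m,
    E (fun w => lin c w * X w * lin b w ^+ m) =
    (\sum_i \sum_j c i * cov i j * E (fun w => DX j w * lin b w ^+ m)) +
    m%:R * bil c b * E (fun w => X w * lin b w ^+ m.-1)].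

Lemma gradient_ext X X' DX DX' : X =1 X' -> (forall j, DX j =1 DX' j) ->
  gradient X DX -> gradient X' DX'.
Proof.
by move=> /funext <- h; rewrite (_ : DX' = DX)//; apply/funext => j; exact/esym/funext/h.
Qed.

Lemma gradient1 : gradient (fun=> 1) (fun _ _ => 0).
Proof.
split=> [|j|c b m]; [exact: allmom_cst|exact: allmom_cst|].
rewrite [X in X + _]big1 => [|i _]; last first.
  rewrite big1// => j _; rewrite [E _](_ : _ = 0) ?mulr0//.
  by rewrite -[RHS](rint0 P); apply: eq_rint => w; rewrite mul0r.
rewrite add0r; transitivity (E (fun w => lin c w * lin b w ^+ m)).
  by apply: eq_rint => w; rewrite mulr1.
by rewrite E_lin_pow; congr (_ * _); apply: eq_rint => w; rewrite mul1r.
Qed.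

Lemma gradientD X X' DX DX' : gradient X DX -> gradient X' DX' ->
  gradient (fun w => X w + X' w) (fun j w => DX j w + DX' j w).
Proof.
move=> [aX aD h] [aX' aD' h']; split=> [|j|c b m]; [exact: allmomD|exact: allmomD|].
have ab k : allmom P (fun w => lin b w ^+ k) by exact: allmomX.
have sp (Y Y' Z : T -> R) : allmom P Y -> allmom P Y' -> allmom P Z ->
    E (fun w => (Y w + Y' w) * Z w) = E (fun w => Y w * Z w) + E (fun w => Y' w * Z w).
  move=> aY aY' aZ; rewrite -rintD; try exact/allmom_int/allmomM.
  by apply: eq_rint => w; rewrite mulrDl.
transitivity (E (fun w => (lin c w * X w + lin c w * X' w) * lin b w ^+ m)).
  by apply: eq_rint => w; rewrite mulrDr.
rewrite (sp _ _ _ (allmomM (allmom_lin c) aX) (allmomM (allmom_lin c) aX') (ab m)).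
rewrite h h' (sp _ _ _ aX aX' (ab _)) addrACA -mulrDr; congr (_ + _).
rewrite -big_split; apply: eq_bigr => i _ /=; rewrite -big_split.
by apply: eq_bigr => j _ /=; rewrite (sp _ _ _ (aD j) (aD' j) (ab _)) mulrDr.
Qed.

Lemma gradientZ k X DX : gradient X DX ->
  gradient (fun w => k * X w) (fun j w => k * DX j w).
Proof.
move=> [aX aD h]; split=> [|j|c b m]; [exact: allmomZ|exact: allmomZ|].
have ab l : allmom P (fun w => lin b w ^+ l) by exact: allmomX.
have sp (Y Z : T -> R) : allmom P Y -> allmom P Z ->
    E (fun w => k * Y w * Z w) = k * E (fun w => Y w * Z w).
  move=> aY aZ; rewrite -rintZ; last exact/allmom_int/allmomM.
  by apply: eq_rint => w; rewrite mulrA.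
transitivity (E (fun w => k * (lin c w * X w) * lin b w ^+ m)).
  by apply: eq_rint => w; ring.
rewrite (sp _ _ (allmomM (allmom_lin c) aX) (ab m)).
rewrite h (sp _ _ aX (ab _)) mulrDr [X in _ = _ + X]mulrCA; congr (_ + _).
rewrite mulr_sumr; apply: eq_bigr => i _; rewrite mulr_sumr.
by apply: eq_bigr => j _; rewrite (sp _ _ (aD j) (ab _)) mulrCA.
Qed.

Lemma gradient_sum I (r : seq I) (X : I -> T -> R) (DX : I -> 'I_N -> T -> R) :
  (forall i, gradient (X i) (DX i)) ->
  gradient (fun w => \sum_(i <- r) X i w) (fun j w => \sum_(i <- r) DX i j w).
Proof.
move=> h; elim: r => [|i r IH].
  apply: gradient_ext (gradientZ 0 gradient1) => [w|j w]; rewrite big_nil ?mul0r//.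
by apply: gradient_ext (gradientD (h i) IH) => [w|j w]; rewrite big_cons.
Qed.

Lemma bil_double_sum c a : \sum_i \sum_j c i * cov i j * a j = bil c a.
Proof. by apply: eq_bigr => i _; apply: eq_bigr => j _; ring. Qed.

(** Polarization again: the identity for X with Y_b + t Y_a and power m + 1 is polynomial in t, and
    its coefficient of t is m + 1 times the identity for Y_a X with power m. *)
Lemma gradient_linM a X DX : gradient X DX ->
  gradient (fun w => lin a w * X w) (fun j w => lin a w * DX j w + a j * X w).
Proof.
move=> [aX aD h]; split=> [|j|c b m].
- exact: allmomM.
- by apply: allmomD; [exact: allmomM|exact: allmomZ].
have acX : allmom P (fun w => lin c w * X w) by exact: allmomM.
have pE : mixpoly (fun w => lin c w * X w) b a m.+1 =
    (\sum_i \sum_j (c i * cov i j) *: mixpoly (DX j) b a m.+1) +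
    m.+1%:R *: (((bil c b)%:P + bil c a *: 'X) * mixpoly X b a m).
  apply: eq_poly_horner => t.
  rewrite hornerD hornerZ hornerM hornerD hornerC hornerZ hornerX !mixpolyE// h.
  congr (_ + _); last by rewrite bil_addvr /=; ring.
  rewrite horner_sum; apply: eq_bigr => i _; rewrite horner_sum; apply: eq_bigr => j _.
  by rewrite hornerZ mixpolyE.
move/(congr1 (fun p : {poly R} => p`_1)) : pE.
rewrite coefD coefZ coefM !big_ord_recl big_ord0/= !coefD !coefC !coefZ !coefX/=.
rewrite mixpoly_coef0 !mixpoly_coef1 coef_sum !(mulr0, mulr1, addr0, add0r) /= => h2.
apply: (@mulfI _ m.+1%:R); first by rewrite pnatr_eq0.
transitivity (m.+1%:R * E (fun w => lin c w * X w * lin b w ^+ m * lin a w)).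
  by congr (_ * _); apply: eq_rint => w; ring.
rewrite h2 mulrDr; 
have -> : \sum_i (\sum_j (c i * cov i j) *: mixpoly (DX j) b a m.+1)`_1 =
    m.+1%:R * \sum_i \sum_j c i * cov i j * E (fun w => DX j w * lin b w ^+ m * lin a w).
  rewrite mulr_sumr; apply: eq_bigr => i _; rewrite coef_sum mulr_sumr.
  by apply: eq_bigr => j _; rewrite coefZ mixpoly_coef1 mulrCA.
rewrite -mulrDr -mulrDr; congr (_ * _).
have -> : \sum_i \sum_j c i * cov i j * E (fun w => (lin a w * DX j w + a j * X w) * lin b w ^+ m) =
  \sum_i \sum_j c i * cov i j * E (fun w => DX j w * lin b w ^+ m * lin a w) +
  bil c a * E (fun w => X w * lin b w ^+ m).
  rewrite -bil_double_sum mulr_suml -big_split; apply: eq_bigr => i _ /=.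
  rewrite mulr_suml -big_split; apply: eq_bigr => j _ /=.
  rewrite -!mulrA -mulrDr; congr (_ * _); rewrite -mulrDr; congr (_ * _).
  rewrite -rintZ; last by apply/allmom_int/allmomM => //; exact: allmomX.
  rewrite -rintD.
  - by apply: eq_rint => w; ring.
  - by apply/allmom_int/allmomM => //; apply: allmomM => //; exact: allmomX.
  - by apply/allmom_int/allmomZ/allmomM => //; exact: allmomX.
rewrite -addrA; congr (_ + _); rewrite addrC; congr (_ + _).
rewrite -mulrA mulrCA; congr (_ * _); congr (_ * _).
by apply: eq_rint => w; ring.
Qed.

Lemma gradient_J i X DX : gradient X DX ->
  gradient (fun w => J i w * X w) (fun j w => J i w * DX j w + (i == j)%:R * X w).
Proof.
move=> h; apply: gradient_ext (gradient_linM (unitv i) h) => [w|j w]; rewrite lin_unitv//.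
by rewrite /unitv eq_sym.
Qed.

Lemma gradient_ibp i X DX : gradient X DX ->
  E (fun w => J i w * X w) = \sum_j cov i j * E (DX j).
Proof.
move=> [aX aD h]; have := h (unitv i) (fun=> 0) 0%N; rewrite !mul0r addr0.
rewrite (_ : (fun w => _) = (fun w => J i w * X w)); last first.
  by apply/funext => w; rewrite expr0 mulr1 lin_unitv.
move=> ->; transitivity (\sum_i0 unitv i i0 * (\sum_j cov i0 j * E (DX j))).
  apply: eq_bigr => k _; rewrite mulr_sumr; apply: eq_bigr => j _.
  by rewrite -mulrA; congr (_ * (_ * _)); apply: eq_rint => w; rewrite expr0 mulr1.
by rewrite sum_unitv.
Qed.

End gaussian_integration_by_parts.

(** * The centred sum of squares and its covariance form *)

Section second_chaos.
Context {R : realType} {d : measure_display} {T : measurableType d}.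
Variables (P : probability T R) (N : nat) (J : 'I_N -> T -> R).
Hypothesis mJ : forall k, measurable_fun setT (J k).
Hypothesis gJ : forall a : 'I_N -> R, has_gaussian_law P (fun w => \sum_k a k * J k w).
Hypothesis J0 : forall k, rint P (J k) = 0.

Local Notation E := (rint P).
Local Notation cov := (cov P J).
Local Notation gradient := (gradient P J).

Let aJ k : allmom P (J k) := allmom_J mJ gJ k.
Hint Resolve aJ : core.

Let grJ i X DX (h : gradient X DX) := gradient_J mJ gJ i h.

Let ibp i X DX : gradient X DX ->
  E (fun w => J i w * X w) = \sum_j cov i j * E (DX j).
Proof. exact: gradient_ibp. Qed.

(** With Gamma the covariance matrix of J: V = |J|^2 - tr Gamma, the form J^T Gamma J, and the
    entries of Gamma^2. *)
Definition centred_sqr (w : T) : R := \sum_i J i w ^+ 2 - \sum_i cov i i.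
Definition cov_form (w : T) : R := \sum_i \sum_j cov i j * (J i w * J j w).
Definition cov2 (j l : 'I_N) : R := \sum_i cov i j * cov i l.

Lemma covC i j : cov i j = cov j i.
Proof. by rewrite /cov; apply: eq_rint => w; rewrite mulrC. Qed.

Lemma allmom_centred_sqr : allmom P centred_sqr.
Proof.
apply: (allmomD (allmom_sum _ _) (allmom_cst _ _)) => i; exact: allmomX.
Qed.

Lemma allmom_cov_form : allmom P cov_form.
Proof.
by apply: allmom_sum => i; apply: allmom_sum => j; apply/allmomZ/allmomM.
Qed.

Lemma allmomE X Y : X =1 Y -> allmom P X -> allmom P Y.
Proof. by move=> /funext ->. Qed.

(** Leibniz rule with 2 J as the gradient of V. *)
Lemma gradient_centred_sqrM X DX : gradient X DX ->
  gradient (fun w => centred_sqr w * X w)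
    (fun j w => centred_sqr w * DX j w + 2 * J j w * X w).
Proof.
move=> h; have := gradientD mJ gJ (gradient_sum mJ gJ J0 (index_enum 'I_N) (fun i => grJ i (grJ i h)))
  (gradientZ mJ gJ (- \sum_i cov i i) h).
apply: gradient_ext => [w|j w].
  rewrite /centred_sqr mulrBl mulNr; congr (_ - _).
  by rewrite mulr_suml; apply: eq_bigr => i _; ring.
rewrite /centred_sqr mulrBl mulNr [RHS]addrAC; congr (_ - _).
transitivity (\sum_i (J i w ^+ 2 * DX j w + (i == j)%:R * (2 * J i w * X w))).
  by apply: eq_bigr => i _; ring.
rewrite big_split/= -mulr_suml; congr (_ + _).
rewrite (bigD1 j)//= eqxx mul1r big1 ?addr0// => i /negbTE ->.
by rewrite mul0r.
Qed.

Lemma gradient_centred_sqrX k :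
  gradient (fun w => centred_sqr w ^+ k)
    (fun j w => k%:R * (2 * J j w * centred_sqr w ^+ k.-1)).
Proof.
elim: k => [|k IH].
  by apply: gradient_ext (gradient1 mJ gJ J0) => [w|j w]; rewrite ?expr0 ?mul0r.
apply: gradient_ext (gradient_centred_sqrM IH) => [w|j w]; rewrite ?exprS//=.
case: k {IH} => [|k] /=; first by rewrite mul0r mulr0 add0r mul1r.
by rewrite -[in RHS]natr1 exprS; ring.
Qed.

(** Integrate one factor of each J_i^2 by parts; differentiating the other factor gives tr Gamma E
    X, which the centring cancels. *)
Lemma E_centred_sqrM X DX : gradient X DX ->
  E (fun w => centred_sqr w * X w) = E (fun w => \sum_i \sum_j cov i j * (J i w * DX j w)).
Proof.
move=> h; have [aX aD _] := h.
transitivity (\sum_i E (fun w => J i w * (J i w * X w)) - (\sum_i cov i i) * E X).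
  rewrite -rint_sum => [|i _]; last by apply/allmom_int/allmomM => //; exact: allmomM.
  rewrite -rintZ; last exact/allmom_int.
  rewrite -rintB; last 2 first.
  - by apply: rintegrable_sum => i _; apply/allmom_int/allmomM => //; exact: allmomM.
  - exact/rintegrableZ/allmom_int.
  apply: eq_rint => w; rewrite /centred_sqr mulrBl mulr_suml; congr (_ - _).
  by apply: eq_bigr => i _; ring.
rewrite rint_sum => [|i _]; last first.
  by apply: rintegrable_sum => j _; apply/allmom_int/allmomZ/allmomM.
rewrite mulr_suml -sumrB; apply: eq_bigr => i _.
rewrite (ibp i (grJ _ h)) rint_sum => [|j _]; last exact/allmom_int/allmomZ/allmomM.
transitivity (\sum_j (cov i j * E (fun w => J i w * DX j w) + (i == j)%:R * (cov i j * E X)) - cov i i * E X).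
  congr (_ - _); apply: eq_bigr => j _; rewrite rintD; last 2 first.
  - exact/allmom_int/allmomM.
  - exact/allmom_int/allmomZ.
  by rewrite rintZ; [ring|exact/allmom_int].
rewrite big_split/= [X in _ + X - _](_ : _ = cov i i * E X) ?addrK; last first.
  rewrite (bigD1 i)//= eqxx mul1r big1 ?addr0// => j; rewrite eq_sym => /negbTE ->.
  by rewrite mul0r.
by apply: eq_bigr => j _; rewrite rintZ//; apply/allmom_int/allmomM.
Qed.

(** Take X = V^k, whose gradient is 2k V^(k-1) J. *)
Lemma centred_sqr_rec k : E (fun w => centred_sqr w ^+ k.+1) =
  k%:R * E (fun w => 2 * cov_form w * centred_sqr w ^+ k.-1).
Proof.
transitivity (E (fun w => centred_sqr w * centred_sqr w ^+ k)).
  by apply: eq_rint => w; rewrite exprS.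
rewrite (E_centred_sqrM (gradient_centred_sqrX k)) -rintZ; last first.
  apply/allmom_int/allmomM; first exact/allmomZ/allmom_cov_form.
  exact/allmomX/allmom_centred_sqr.
apply: eq_rint => w; rewrite /cov_form mulr_sumr mulr_suml mulr_sumr; apply: eq_bigr => i _.
rewrite mulr_sumr mulr_suml mulr_sumr; apply: eq_bigr => j _; ring.
Qed.

Lemma E_cov_formM X DX : gradient X DX ->
  E (fun w => cov_form w * X w) = (\sum_i \sum_j cov i j ^+ 2) * E X +
    \sum_j \sum_l cov2 j l * E (fun w => J j w * DX l w).
Proof.
move=> h; have [aX aD _] := h.
transitivity (\sum_i \sum_j cov i j * E (fun w => J i w * (J j w * X w))).
  transitivity (E (fun w => \sum_i \sum_j cov i j * (J i w * (J j w * X w)))).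
    apply: eq_rint => w; rewrite /cov_form mulr_suml; apply: eq_bigr => i _.
    by rewrite mulr_suml; apply: eq_bigr => j _; ring.
  have ai i j : allmom P (fun w => J i w * (J j w * X w)).
    by apply: allmomM => //; exact: allmomM.
  rewrite rint_sum => [|i _]; last first.
    by apply: rintegrable_sum => j _; exact/allmom_int/allmomZ.
  apply: eq_bigr => i _; rewrite rint_sum => [|j _]; last exact/allmom_int/allmomZ.
  by apply: eq_bigr => j _; rewrite rintZ//; exact/allmom_int.
transitivity (\sum_i \sum_j (cov i j ^+ 2 * E X +
    \sum_l cov i j * cov i l * E (fun w => J j w * DX l w))).
  apply: eq_bigr => i _; apply: eq_bigr => j _; rewrite (ibp i (grJ _ h)) mulr_sumr.
  transitivity (\sum_l (cov i j * cov i l * E (fun w => J j w * DX l w) +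
      (j == l)%:R * (cov i j * cov i l * E X))).
    apply: eq_bigr => l _; rewrite rintD; last 2 first.
    - exact/allmom_int/allmomM.
    - exact/allmom_int/allmomZ.
    by rewrite rintZ; [ring|exact/allmom_int].
  rewrite big_split/= addrC; congr (_ + _).
  rewrite (bigD1 j)//= eqxx mul1r big1 ?addr0 ?expr2// => l; rewrite eq_sym => /negbTE ->.
  by rewrite mul0r.
under eq_bigr do rewrite big_split/=.
rewrite big_split/= mulr_suml; congr (_ + _).
  by apply: eq_bigr => i _; rewrite mulr_suml.
rewrite exchange_big; apply: eq_bigr => j _ /=; rewrite exchange_big; apply: eq_bigr => l _ /=.
by rewrite /cov2 mulr_suml.
Qed.

Let grJ1 j : gradient (J j) (fun l _ => (j == l)%:R).
Proof.
apply: gradient_ext (grJ j (gradient1 mJ gJ J0)) => [w|l w]; rewrite ?mulr1//.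
by rewrite mulr0 add0r.
Qed.

Lemma E_JJ i j : E (fun w => J i w * J j w) = cov i j.
Proof. by []. Qed.

Lemma E_cov_form : E cov_form = \sum_i \sum_j cov i j ^+ 2.
Proof.
transitivity (E (fun w => cov_form w * 1)); first by apply: eq_rint => w; rewrite mulr1.
rewrite (E_cov_formM (gradient1 mJ gJ J0)) [X in _ + X]big1 => [|j _]; last first.
  rewrite big1// => l _; rewrite [E _](_ : _ = 0) ?mulr0//.
  by rewrite -[RHS](rint0 P); apply: eq_rint => w; rewrite mulr0.
rewrite addr0 [E _](_ : _ = 1) ?mulr1//; exact: rint_cst.
Qed.

Lemma gradient_cov_form : gradient cov_form (fun l w => 2 * \sum_i cov i l * J i w).
Proof.
have := gradient_sum mJ gJ J0 (index_enum 'I_N) (fun i =>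
  gradient_sum mJ gJ J0 (index_enum 'I_N) (fun j => gradientZ mJ gJ (cov i j) (grJ i (grJ1 j)))).
apply: gradient_ext => [w|l w]; first by [].
transitivity (\sum_i \sum_j ((j == l)%:R * (cov i j * J i w) + (i == l)%:R * (cov i j * J j w))).
  by apply: eq_bigr => i _; apply: eq_bigr => j _; ring.
under eq_bigr do rewrite big_split/=.
rewrite big_split/= mulr2n mulrDl !mul1r; congr (_ + _).
  apply: eq_bigr => i _; rewrite (bigD1 l)//= eqxx mul1r big1 ?addr0// => j /negbTE ->.
  by rewrite mul0r.
rewrite (bigD1 l)//= [X in _ + X]big1 ?addr0 => [|i /negbTE ->]; last first.
  by rewrite big1// => j _; rewrite mul0r.
by apply: eq_bigr => j _; rewrite eqxx mul1r covC.
Qed.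

(** This says that J^T Gamma J has mean tr Gamma^2 and variance 2 tr Gamma^4. *)
Lemma E_cov_form2 : E (fun w => cov_form w ^+ 2) =
  (\sum_i \sum_j cov i j ^+ 2) ^+ 2 + 2 * \sum_j \sum_l cov2 j l ^+ 2.
Proof.
transitivity (E (fun w => cov_form w * cov_form w)).
  by apply: eq_rint => w; rewrite expr2.
rewrite (E_cov_formM gradient_cov_form) E_cov_form expr2; congr (_ + _).
rewrite mulr_sumr; apply: eq_bigr => j _; rewrite mulr_sumr; apply: eq_bigr => l _.
rewrite expr2 mulrCA; congr (_ * _).
transitivity (E (fun w => \sum_i 2 * cov i l * (J j w * J i w))).
  by apply: eq_rint => w; rewrite mulrCA !mulr_sumr; apply: eq_bigr => i _; ring.
rewrite rint_sum => [|i _]; last exact/allmom_int/allmomZ/allmomM.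
rewrite /cov2 mulr_sumr; apply: eq_bigr => i _.
rewrite rintZ; last exact/allmom_int/allmomM.
by rewrite E_JJ (covC j i) -mulrA (mulrC (cov i l)).
Qed.

Variable C : R.
Hypothesis C0 : 0 < C.
Hypothesis formC : forall a : 'I_N -> R, bil P J a a <= C * \sum_k a k ^+ 2.

Lemma bil_ge0 a : 0 <= bil P J a a.
Proof. by rewrite (bilE mJ gJ); apply: rint_ge0 => w; rewrite -expr2 sqr_ge0. Qed.

Lemma cov_le i : cov i i <= C.
Proof.
have := formC (fun j => (j == i)%:R); rewrite /bil (bigD1 i)//= (bigD1 i)//= eqxx !mul1r.
rewrite [X in _ + X + _]big1 => [|j /negbTE ->]; last by rewrite mulr0 mul0r.
rewrite [X in _ + X]big1 => [|j /negbTE ->]; last by rewrite big1// => k _; rewrite !mul0r.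
rewrite !addr0 (bigD1 i)//= eqxx expr1n big1 ?addr0 ?mulr1// => j /negbTE ->.
by rewrite expr0n.
Qed.

(* With u = Gamma v this is 0 <= B(u - C v, u - C v) for the covariance form B. *)
Lemma cov_apply_le (v : 'I_N -> R) :
  \sum_j (\sum_i cov i j * v i) ^+ 2 <= C ^+ 2 * \sum_i v i ^+ 2.
Proof.
pose u j := \sum_i cov i j * v i.
have vu : bil P J v u = \sum_j u j ^+ 2.
  rewrite /bil exchange_big; apply: eq_bigr => j _ /=.
  rewrite (_ : u j ^+ 2 = u j * \sum_i cov i j * v i)// mulr_sumr.
  by apply: eq_bigr => i _; ring.
have := bil_ge0 (addv (- C) u v).
rewrite (bil_addvr P J) !(bil_addvl mJ gJ) (bilC mJ gJ u v) vu => h.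
have hu := formC u; have hv := formC v.
set U := \sum_j u j ^+ 2 in h hu vu *; set V := \sum_i v i ^+ 2 in hv *.
have h3 : C ^+ 2 * bil P J v v <= C ^+ 2 * (C * V) by rewrite ler_pM2l// exprn_gt0.
rewrite -(ler_pM2l C0).
have -> : C * (C ^+ 2 * V) = C ^+ 2 * (C * V) by ring.
have : 0 <= bil P J u u - 2 * (C * U) + C ^+ 2 * bil P J v v.
  by apply: le_trans h _; rewrite le_eqVlt; apply/orP; left; apply/eqP; ring.
lra.
Qed.

(** C bounds Gamma in operator norm: applying Gamma to its own columns costs C^2, and each column,
    as the image of a unit vector, has squared norm at most C^2. This gives tr Gamma^4 <= C^4 N. *)
Lemma cov2_sum_le : \sum_j \sum_l cov2 j l ^+ 2 <= C ^+ 4 * N%:R.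
Proof.
rewrite exchange_big/=.
apply: (@le_trans _ _ (\sum_(l < N) C ^+ 2 * \sum_i cov i l ^+ 2)).
  by apply: ler_sum => l _; exact: (cov_apply_le (fun i => cov i l)).
apply: (@le_trans _ _ (\sum_(l < N) C ^+ 4)); last first.
  by rewrite sumr_const card_ord mulr_natr.
apply: ler_sum => l _; rewrite (_ : 4%N = (2 + 2)%N)// exprD ler_wpM2l ?sqr_ge0//.
have := cov_apply_le (fun i => (i == l)%:R).
rewrite [X in _ <= _ * X](bigD1 l)//= eqxx expr1n [X in _ * (_ + X)]big1 => [|i /negbTE ->]; last first.
  by rewrite expr0n.
rewrite addr0 mulr1; apply: le_trans; apply: ler_sum => j _.
rewrite (bigD1 l)//= eqxx mulr1 big1 ?addr0 => [|i /negbTE ->]; last by rewrite mulr0.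
by rewrite (covC l j).
Qed.

Lemma cov_form_ge0 w : 0 <= cov_form w.
Proof.
have := bil_ge0 (J ^~ w); rewrite /bil /cov_form.
by under eq_bigr => i _ do under eq_bigr => j _ do rewrite mulrC.
Qed.

Lemma cov_form_le w : cov_form w <= C * \sum_i J i w ^+ 2.
Proof.
have := formC (J ^~ w); rewrite /bil /cov_form.
by under eq_bigr => i _ do under eq_bigr => j _ do rewrite mulrC.
Qed.

End second_chaos.

(** * Approximate moment recursion for the normalized sum of squares *)

Section normalized_chaos.
Context {R : realType} {d : measure_display} {T : measurableType d}.
Variables (P : probability T R) (N : nat) (J : 'I_N -> T -> R).
Hypothesis mJ : forall k, measurable_fun setT (J k).
Hypothesis gJ : forall a : 'I_N -> R, has_gaussian_law P (fun w => \sum_k a k * J k w).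
Hypothesis J0 : forall k, rint P (J k) = 0.
Variable C : R.
Hypothesis C0 : 0 < C.
Hypothesis formC : forall a : 'I_N -> R, bil P J a a <= C * \sum_k a k ^+ 2.
Hypothesis N0 : (0 < N)%N.

Local Notation E := (rint P).
Local Notation cov := (cov P J).

Let n : R := N%:R.
Let n_gt0 : 0 < n. Proof. by rewrite ltr0n. Qed.
Let n_ge1 : 1 <= n. Proof. by rewrite ler1n. Qed.

Definition normalized_sqr (w : T) : R := centred_sqr P J w / Num.sqrt N%:R.
Local Notation W := normalized_sqr.
(** The random factor in the moment recursion of W; q is its mean. The central limit theorem amounts
    to Q concentrating at q. *)
Let Q (w : T) : R := 2 / n * cov_form P J w.
Let q : R := 2 / n * \sum_i \sum_j cov i j ^+ 2.

Lemma allmom_normalized_sqr : allmom P W.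
Proof.
apply: (allmomE (X := fun w => (Num.sqrt N%:R)^-1 * centred_sqr P J w)).
  by move=> w; rewrite mulrC.
exact/allmomZ/allmom_centred_sqr.
Qed.

Let aW := allmom_normalized_sqr.
Let aQ : allmom P Q.
Proof. exact/allmomZ/allmom_cov_form. Qed.

Lemma normalized_sqr_rec k :
  E (fun w => W w ^+ k.+2) = k.+1%:R * E (fun w => Q w * W w ^+ k).
Proof.
have aV := allmom_centred_sqr mJ gJ.
have aF := allmom_cov_form mJ gJ.
pose c := (Num.sqrt n)^-1.
have c2 : c ^+ 2 = n^-1 by rewrite exprVn sqr_sqrtr// ltW.
transitivity (c ^+ k.+2 * E (fun w => centred_sqr P J w ^+ k.+2)).
  rewrite -rintZ; last exact/allmom_int/allmomX.
  by apply: eq_rint => w; rewrite exprMn mulrC.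
rewrite (centred_sqr_rec mJ gJ J0) mulrCA; congr (_ * _).
rewrite -rintZ; last by apply/allmom_int/allmomM; [exact: allmomZ|exact: allmomX].
apply: eq_rint => w; rewrite exprMn/= -/n -/c -addn2 exprD c2 /Q; ring.
Qed.

Lemma normalized_sqr_mean : E W = 0.
Proof.
have aV := allmom_centred_sqr mJ gJ.
transitivity ((Num.sqrt N%:R)^-1 * E (fun w => centred_sqr P J w ^+ 1)).
  rewrite -rintZ; last exact/allmom_int/allmomX.
  by apply: eq_rint => w; rewrite expr1 mulrC.
by rewrite (centred_sqr_rec mJ gJ J0) mul0r mulr0.
Qed.

Let EQ : E Q = q.
Proof.
rewrite /q -(E_cov_form mJ gJ J0) -rintZ//.
exact/allmom_int/allmom_cov_form.
Qed.

(** The variance of Q is (2/n)^2 times 2 tr Gamma^4, and tr Gamma^4 <= C^4 n. *)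
Let EQ2 : E (fun w => (Q w - q) ^+ 2) <= 8 * C ^+ 4 / n.
Proof.
have aF := allmom_cov_form mJ gJ.
pose S := \sum_i \sum_j cov i j ^+ 2.
have -> : E (fun w => (Q w - q) ^+ 2) = (2 / n) ^+ 2 *
    (E (fun w => cov_form P J w ^+ 2) - S ^+ 2).
  transitivity (E (fun w => (2 / n) ^+ 2 * (cov_form P J w ^+ 2 +
      ((- 2 * S) * cov_form P J w + S ^+ 2)))).
    by apply: eq_rint => w; rewrite /Q /q -/S; ring.
  have a1 : allmom P (fun w => (- 2 * S) * cov_form P J w + S ^+ 2).
    by apply: allmomD; [exact: allmomZ|exact: allmom_cst].
  rewrite rintZ; last by apply/allmom_int/allmomD => //; exact: allmomX.
  rewrite rintD; [|exact/allmom_int/allmomX|exact/allmom_int].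
  rewrite rintD; [|exact/allmom_int/allmomZ|exact/allmom_int/allmom_cst].
  rewrite rintZ; last exact/allmom_int.
  by rewrite rint_cst (E_cov_form mJ gJ J0) -/S; congr (_ * _); ring.
rewrite (E_cov_form2 mJ gJ J0) -/S addrAC subrr add0r.
apply: (@le_trans _ _ ((2 / n) ^+ 2 * (2 * (C ^+ 4 * n)))).
  rewrite ler_wpM2l ?sqr_ge0// ler_pM2l//.
  exact: (cov2_sum_le mJ gJ C0 formC).
by rewrite le_eqVlt; apply/orP; left; apply/eqP; field; rewrite gt_eqF.
Qed.

Let Q_ge0 w : 0 <= Q w.
Proof.
by rewrite mulr_ge0 ?(cov_form_ge0 mJ gJ)// divr_ge0// ltW.
Qed.

(** Q <= (2C/n)|J|^2, where |J|^2 = sqrt n W + tr Gamma <= n|W| + C n. *)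
Let Q_le w : Q w <= 2 * C * (`|W w| + C).
Proof.
have sn : 1 <= Num.sqrt n by rewrite -[leLHS]sqrtr1 ler_wsqrtr.
have hF := cov_form_le formC w.
have tr : \sum_i cov i i <= C * n.
  rewrite (le_trans (ler_sum _ (fun i _ => cov_le formC i)))//.
  by rewrite sumr_const card_ord mulr_natr.
have e : \sum_i J i w ^+ 2 = Num.sqrt n * W w + \sum_i cov i i.
  rewrite /W /centred_sqr -/n mulrC divfK ?subrK// gt_eqF// (lt_le_trans ltr01)//.
have h1 : Num.sqrt n * W w <= n * `|W w|.
  apply: (@le_trans _ _ (Num.sqrt n * `|W w|)).
    by rewrite ler_wpM2l ?ler_norm// sqrtr_ge0.
  rewrite ler_wpM2r// -[leRHS](sqr_sqrtr (ltW n_gt0)) expr2 ler_peMl// sqrtr_ge0//.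
rewrite /Q mulrAC ler_pdivrMr//.
have : C * \sum_i J i w ^+ 2 <= C * (n * `|W w| + C * n).
  by rewrite ler_pM2l// e lerD.
have -> : 2 * C * (`|W w| + C) * n = 2 * (C * (n * `|W w| + C * n)) by ring.
lra.
Qed.

(** The factor is a^2 + 2 a C with a = 2C(2k + 1), the outcome of the absorption argument in
    [normalized_sqr_even_moment]. *)
Fixpoint even_moment_bound (C : R) (k : nat) : R :=
  if k is k'.+1 then
    even_moment_bound C k' *
    ((k'.*2.+1%:R * (2 * C)) ^+ 2 + 2 * (k'.*2.+1%:R * (2 * C)) * C)
  else 1.

Lemma even_moment_bound_ge0 k : 0 <= even_moment_bound C k.
Proof.
elim: k => [|k IH] //=; rewrite mulr_ge0// addr_ge0 ?sqr_ge0// !mulr_ge0//; exact: ltW.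
Qed.

(** The recursion and [Q_le] bound E W^(2k+2) by a (E |W|^(2k+1) + C E W^(2k)). Since |W| <= (W^2/a
    + a)/2, half of the left-hand side reappears on the right and is absorbed. *)
Lemma normalized_sqr_even_moment k :
  E (fun w => W w ^+ k.*2) <= even_moment_bound C k.
Proof.
elim: k => [|k IH] /=.
  rewrite (_ : E _ = 1)//; transitivity (E (fun=> 1)); last exact: rint_cst.
  by apply: eq_rint => w; rewrite expr0.
set a := k.*2.+1%:R * (2 * C).
have a_gt0 : 0 < a by rewrite !mulr_gt0.
set x := E (fun w => W w ^+ k.*2) in IH *.
set y := E (fun w => W w ^+ k.+1.*2).
have x0 : 0 <= x by apply: rint_ge0 => w; rewrite -muln2 exprM sqr_ge0.
suff h : y <= a * (2^-1 * (a^-1 * y + a * x) + C * x).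
  have e : a * (2^-1 * (a^-1 * y + a * x) + C * x) = 2^-1 * y + (2^-1 * a ^+ 2 + a * C) * x.
    by field; rewrite gt_eqF.
  have h2 : y <= (a ^+ 2 + 2 * a * C) * x.
    rewrite e in h; have e2 : (a ^+ 2 + 2 * a * C) * x = 2 * ((2^-1 * a ^+ 2 + a * C) * x) by field.
    rewrite e2; lra.
  apply: (le_trans h2); rewrite mulrC ler_wpM2r//.
  by rewrite addr_ge0 ?sqr_ge0// !mulr_ge0// ltW.
rewrite /y doubleS [leLHS]normalized_sqr_rec.
have -> : a * (2^-1 * (a^-1 * E (fun w => W w ^+ k.*2.+2) + a * x) + C * x) =
  k.*2.+1%:R * E (fun w => 2 * C * (2^-1 * (a^-1 * W w ^+ k.*2.+2 + a * W w ^+ k.*2) + C * W w ^+ k.*2)).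
  have aX m : rintegrable P (fun w => W w ^+ m) by exact/allmom_int/allmomX.
  have i1 : rintegrable P (fun w => a^-1 * W w ^+ k.*2.+2 + a * W w ^+ k.*2).
    by apply: rintegrableD; exact: rintegrableZ.
  rewrite rintZ; last by apply: rintegrableD; exact: rintegrableZ.
  rewrite rintD; [|exact: rintegrableZ|exact: rintegrableZ].
  rewrite (rintZ _ i1) rintD; [|exact: rintegrableZ|exact: rintegrableZ].
  rewrite !(rintZ _ (aX _)) -/x /a; set y' := E _; field.
  by rewrite gt_eqF//= addrC natr1 pnatr_eq0.
rewrite ler_pM2l//; apply: le_rint.
- by apply/allmom_int/allmomM => //; exact: allmomX.
- apply: rintegrableZ; apply: rintegrableD; apply: rintegrableZ; last exact/allmom_int/allmomX.
  by apply: rintegrableD; apply: rintegrableZ; exact/allmom_int/allmomX.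
move=> w; have p0 : 0 <= W w ^+ k.*2 by rewrite -muln2 exprM sqr_ge0.
apply: (le_trans (ler_wpM2r p0 (Q_le w))).
rewrite -(mulrA (2 * C) _ (W w ^+ _)) ler_wpM2l ?mulr_ge0 ?(ltW C0)// mulrDl lerD2r//.
rewrite (_ : W w ^+ k.*2.+2 = `|W w| ^+ 2 * W w ^+ k.*2); last first.
  by rewrite real_normK ?num_real// -exprD.
rewrite mulrA -mulrDl mulrA ler_wpM2r//.
have e : 2^-1 * (a^-1 * `|W w| ^+ 2 + a) - `|W w| = 2^-1 * a^-1 * (`|W w| - a) ^+ 2.
  by field; rewrite gt_eqF.
by rewrite -subr_ge0 e mulr_ge0 ?sqr_ge0// mulr_ge0 ?invr_ge0 ?(ltW a_gt0).
Qed.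

(** The error is (k + 1) E((Q - q) W^k), small because Q - q has second moment O(1/n) and W^k has
    bounded second moment. *)
Lemma normalized_sqr_moment_rec k :
  `|E (fun w => W w ^+ k.+2) - k.+1%:R * q * E (fun w => W w ^+ k)| <=
  k.+1%:R * (2^-1 * (8 * C ^+ 4 + even_moment_bound C k)) / Num.sqrt N%:R.
Proof.
pose s := Num.sqrt n.
have s0 : 0 < s by rewrite sqrtr_gt0.
have s2 : s ^+ 2 = n by rewrite sqr_sqrtr// ltW.
have aX m : allmom P (fun w => W w ^+ m) by exact/allmomX.
have aQq : allmom P (fun w => Q w - q) by apply: allmomD => //; exact: allmom_cst.
have [mQW _] : allmom P (fun w => (Q w - q) * W w ^+ k) by exact: allmomM.
have -> : E (fun w => W w ^+ k.+2) - k.+1%:R * q * E (fun w => W w ^+ k) =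
    k.+1%:R * E (fun w => (Q w - q) * W w ^+ k).
  rewrite normalized_sqr_rec -mulrA -mulrBr; congr (_ * _).
  rewrite -rintZ; last exact/allmom_int.
  rewrite -rintB; [|exact/allmom_int/allmomM|exact/rintegrableZ/allmom_int].
  by apply: eq_rint => w; rewrite mulrBl.
rewrite normrM ger0_norm// -!mulrA ler_pM2l//.
have i1 : rintegrable P (fun w => 2^-1 * (s * (Q w - q) ^+ 2 + s^-1 * W w ^+ k.*2)).
  apply: rintegrableZ; apply: rintegrableD; apply: rintegrableZ; last exact/allmom_int.
  exact/allmom_int/allmomX.
(* Young's inequality with weight s = sqrt n balances the two second moments at order 1/sqrt n. *)
apply: (@le_trans _ _ (E (fun w => 2^-1 * (s * (Q w - q) ^+ 2 + s^-1 * W w ^+ k.*2)))).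
  apply: (le_rint_bound mQW _ i1) => w; rewrite normrM.
  rewrite (_ : W w ^+ k.*2 = `|W w ^+ k| ^+ 2); last first.
    by rewrite real_normK ?num_real// -exprM muln2.
  rewrite -(real_normK (num_real (Q w - q))).
  move: `|Q w - q| `|W w ^+ k| => x y.
  have e : 2^-1 * (s * x ^+ 2 + s^-1 * y ^+ 2) - x * y = 2^-1 * s^-1 * (s * x - y) ^+ 2.
    by field; rewrite gt_eqF.
  by rewrite -subr_ge0 e mulr_ge0 ?sqr_ge0// mulr_ge0 ?invr_ge0 ?(ltW s0).
rewrite rintZ; last first.
  apply: rintegrableD; apply: rintegrableZ; last exact/allmom_int.
  exact/allmom_int/allmomX.
rewrite ler_pM2l// rintD; last 2 first.
- exact/rintegrableZ/allmom_int/allmomX.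
- exact/rintegrableZ/allmom_int.
rewrite !rintZ; [|exact/allmom_int|exact/allmom_int/allmomX].
rewrite mulrDl lerD//; last first.
  by rewrite mulrC ler_wpM2r ?invr_ge0 ?(ltW s0)//; exact: normalized_sqr_even_moment.
apply: (@le_trans _ _ (s * (8 * C ^+ 4 / n))); first by rewrite ler_pM2l.
rewrite -s2 le_eqVlt; apply/orP; left; apply/eqP; rewrite -/n -/s; field.
by rewrite gt_eqF.
Qed.

End normalized_chaos.

(** * Central limit theorem for sums of squares of Gaussian variables *)

Section moment_limit.
Context {R : realType}.

(** Induction two orders at a time: an asymptotic recursion with the right initial values has the
    exact recursion as its limit. *)
Lemma moment_rec_cvg (m : nat -> nat -> R) (q e : nat -> R) (c : nat -> R) (v : R)
    (mu : nat -> R) :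
  (forall n, m n 0%N = 1) -> (forall n, m n 1%N = 0) ->
  (forall k, \forall n \near \oo, `|m n k.+2 - k.+1%:R * q n * m n k| <= c k * e n) ->
  q @ \oo --> v -> e @ \oo --> (0 : R) ->
  mu 0%N = 1 -> mu 1%N = 0 -> (forall k, mu k.+2 = k.+1%:R * v * mu k) ->
  forall k, m n k @[n --> \oo] --> mu k.
Proof.
move=> m0 m1 mrec qv e0 mu0 mu1 murec.
suff h k : (m n k @[n --> \oo] --> mu k) /\ (m n k.+1 @[n --> \oo] --> mu k.+1).
  by move=> k; have [] := h k.
elim: k => [|k [IH1 IH2]].
  split; [rewrite mu0|rewrite mu1].
  - by rewrite (_ : (fun n => _) = (fun=> 1)); [exact: cvg_cst|apply/funext].
  - by rewrite (_ : (fun n => _) = (fun=> 0)); [exact: cvg_cst|apply/funext].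
split=> //; rewrite murec.
rewrite (_ : (fun n => m n k.+2) = (fun n => (m n k.+2 - k.+1%:R * q n * m n k) +
  k.+1%:R * q n * m n k)); last by apply/funext => n; rewrite subrK.
rewrite -[X in _ --> X]add0r; apply: cvgD; last first.
  by apply: cvgM => //; apply: cvgM => //; exact: cvg_cst.
apply/cvgr0Pnorm_le => eps eps0.
have ce : (fun n => c k * e n) @ \oo --> (0 : R).
  by rewrite -[X in _ --> X](mulr0 (c k)); apply: cvgM => //; exact: cvg_cst.
move/cvgr0Pnorm_le : ce => /(_ _ eps0) h.
near=> n.
apply: (@le_trans _ _ (c k * e n)); first by near: n; exact: mrec.
apply: (le_trans (ler_norm _)); near: n; exact: h.
Unshelve. all: end_near.
Qed.

End moment_limit.

Section gaussian_sqr_clt.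
Context {R : realType}.

Lemma gaussian_law0_moments (v : R) : 0 <= v ->
  let M k := rint (gaussian_law 0 v) (fun x : R => x ^+ k) in
  [/\ forall k, rintegrable (gaussian_law 0 v) (fun x : R => x ^+ k),
      M 0%N = 1, M 1%N = 0 & forall k, M k.+2 = k.+1%:R * v * M k].
Proof.
move=> v0 M; have [iM M1 Mrec] := gaussian_law_moments 0 v0.
have e k : (fun x : R => (x - 0) ^+ k) = (fun x : R => x ^+ k).
  by apply/funext => x; rewrite subr0.
split=> [k||  |k].
- by rewrite -e.
- rewrite /M (_ : (fun x : R => x ^+ 0) = (fun=> 1)) ?rint_cst//.
- by rewrite /M -e.
- by rewrite /M -!e.
Qed.

(** The even moments are v^m (2m)!/(2^m m!), so the sequence is (s^2 v/2)^m/m!, the general term of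
    an exponential series. *)
Lemma gaussian_law0_moments_small (v : R) : 0 <= v -> forall s : R,
  s ^+ m.*2 * rint (gaussian_law 0 v) (fun x : R => x ^+ m.*2) / (m.*2)`!%:R
    @[m --> \oo] --> (0 : R).
Proof.
move=> v0 s; have [_ M0 _ Mrec] := gaussian_law0_moments v0.
rewrite (_ : (fun m => _) = exp_coeff (s ^+ 2 * v / 2)); last first.
  apply/funext; elim=> [|m IH].
    by rewrite double0 M0 /exp_coeff /= !expr0 fact0 !mul1r.
  rewrite doubleS Mrec /exp_coeff /= in IH *.
  rewrite (_ : s ^+ m.*2.+2 = s ^+ 2 * s ^+ m.*2); last by rewrite -exprD.
  rewrite (_ : (m.*2.+2)`!%:R = m.*2.+2%:R * m.*2.+1%:R * (m.*2)`!%:R :> R); last first.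
    by rewrite !factS !natrM mulrA.
  rewrite [in RHS]exprS [in m.+1`!]factS [in RHS]natrM.
  move: IH; set F := rint _ _; move=> IH.
  have -> : m.*2.+2%:R = 2 * m.+1%:R :> R by rewrite -natrM mul2n doubleS.
  transitivity (s ^+ 2 * v / 2 / m.+1%:R * (s ^+ m.*2 * F / (m.*2)`!%:R)).
    field; rewrite !pnatr_eq0 -!lt0n fact_gt0 /=.
    by rewrite !(addrC 1) !natr1 !pnatr_eq0.
  rewrite IH invfM; move: (_ ^+ m) (m`!%:R^-1) => y z; ring.
by apply: cvg_series_cvg_0; exact: is_cvg_series_exp_coeff.
Qed.

Lemma cvg_inv_sqrt : (Num.sqrt n%:R)^-1 @[n --> \oo] --> (0 : R).
Proof.
apply/cvgr0Pnorm_le => e e0; near=> n.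
have n0 : (0 < n)%N by near: n; exact: nbhs_infty_gt.
have s0 : 0 < Num.sqrt n%:R :> R by rewrite sqrtr_gt0 ltr0n.
rewrite ger0_norm ?invr_ge0 ?sqrtr_ge0// invf_ple ?posrE//.
rewrite -[e^-1]ger0_norm ?invr_ge0 ?(ltW e0)// -sqrtr_sqr ler_wsqrtr//.
near: n; exact: nbhs_infty_ger.
Unshelve. all: end_near. Qed.

Context {d : measure_display} {T : measurableType d}.
Variables (P : probability T R) (J : forall n : nat, 'I_n -> T -> R) (b : nat -> R).
Variables (C v : R).
Hypothesis mJ : forall (n : nat) (k : 'I_n), measurable_fun setT (J k).
Hypothesis gJ : forall (n : nat) (a : 'I_n -> R), has_gaussian_law P (fun w => \sum_k a k * J k w).
Hypothesis J0 : forall (n : nat) (k : 'I_n), rint P (J k) = 0.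
Hypothesis C0 : 0 < C.
Hypothesis formC : forall (n : nat) (a : 'I_n -> R), (0 < n)%N ->
  bil P (@J n) a a <= C * \sum_k a k ^+ 2.
Hypothesis cvg_cov :
  2 / n%:R * (\sum_(i < n) \sum_(j < n) cov P (@J n) i j ^+ 2) @[n --> \oo] --> v.
Hypothesis cvg_b : b n @[n --> \oo] --> (0 : R).

(** A uniform bound C on the covariance forms makes the moment recursion exact in the limit, with
    variance v the limit of (2/n) sum Gamma_ij^2. *)
Theorem gaussian_sqr_clt :
  cvg_in_distribution P (fun n w => normalized_sqr P (@J n) w + b n) (gaussian_law 0 v).
Proof.
have v0 : 0 <= v.
  apply: (cvgr_to_ge cvg_cov); near=> n.
  by rewrite mulr_ge0// ?divr_ge0//; do 2!apply: sumr_ge0 => ? _; rewrite sqr_ge0.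
have aW n : allmom P (normalized_sqr P (@J n)) := allmom_normalized_sqr (mJ (n := n)) (gJ (n := n)).
have [iM M0 M1 Mrec] := gaussian_law0_moments v0.
apply: moments_cvg_in_distribution => //.
- by move=> n; have [] := aW n.
- by move=> n k; have [_] := aW n.
- apply: (moment_rec_cvg (q := fun n => 2 / n%:R * \sum_i \sum_j cov P (@J n) i j ^+ 2)
    (e := fun n => (Num.sqrt n%:R)^-1)
    (c := fun k => k.+1%:R * (2^-1 * (8 * C ^+ 4 + even_moment_bound C k))) (v := v)) => //.
  + by move=> n; under eq_rint do rewrite expr0; exact: rint_cst.
  + move=> n; rewrite -[RHS](normalized_sqr_mean (mJ (n := n)) (gJ (n := n)) (J0 (n := n))).
    by apply: eq_rint => w; rewrite expr1.
  + move=> k; near=> n; have n0 : (0 < n)%N by near: n; exact: nbhs_infty_gt.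
    exact: (normalized_sqr_moment_rec (mJ (n := n)) (gJ (n := n)) (J0 (n := n)) C0
      (fun a => formC a n0) n0).
  + exact: cvg_inv_sqrt.
- exact: gaussian_law0_moments_small.
Unshelve. all: end_near.
Qed.

End gaussian_sqr_clt.

(** * Time integration of the wave kernel *)

Section wave_covariance.
Context {R : realType} {d : nat} (theta beta t : R).
Hypotheses (beta_gt0 : 0 < beta) (beta_lt2 : beta < 2) (beta_ltd : beta < d%:R).
Hypotheses (theta_gt0 : 0 < theta) (t_gt0 : 0 < t).
Local Notation mu := (@lebesgue_measure R).
Local Notation leb := (@lebn R d).
Local Notation fwk := (fourier_wave_kernel theta).

(** Closed form of |xi|^(beta-d) times the integral over r in [0, t] of sin^2((t - r) a)/a^2, with a
    = sqrt(theta)|xi|. At xi = 0 it is 0 by the conventions for division, as is the kernel. *)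
Definition wave_spectrum (xi : 'rV[R]_d) : R :=
  let a := Num.sqrt theta * enorm xi in
  (t / 2 - sin (2 * t * a) / (4 * a)) / a ^+ 2 * enorm xi `^ (beta - d%:R).

Lemma time_integral (xi : 'rV[R]_d) (a := Num.sqrt theta * enorm xi) :
  rint mu (fun r => \1_(`[0%R, t]) r * fwk (t - r) xi ^+ 2) =
  (t / 2 - sin (2 * t * a) / (4 * a)) / a ^+ 2.
Proof.
have [a0|a0] := eqVneq a 0.
  rewrite a0 expr0n invr0 mulr0; transitivity (rint mu (fun=> 0)); last exact: rint0.
  by apply: eq_rint => r; rewrite /fourier_wave_kernel -/a a0 invr0 mulr0 expr0n mulr0.
pose F (r : R) : R := (2^-1 * r + (4 * a)^-1 * sin (- (2 * a) * r + 2 * a * t)) / a ^+ 2.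
pose f (r : R) : R := (2^-1 - 2^-1 * cos (- (2 * a) * r + 2 * a * t)) / a ^+ 2.
have dF (r : R) : is_derive r 1 F (f r).
  rewrite (_ : F = (fun r => (a ^+ 2)^-1 * (2^-1 * r + (4 * a)^-1 * sin (- (2 * a) * r + 2 * a * t)))); last first.
    by apply/funext => x; rewrite /F mulrC.
  have h := is_derive_sin_affine (- (2 * a)) (2 * a * t) r.
  have h1 := is_derive_scalel (4 * a)^-1 h.
  have h2 := is_derive_affine 2^-1 0 r.
  have h3 := is_deriveD h2 h1.
  have h4 := is_derive_scalel (a ^+ 2)^-1 h3.
  rewrite (_ : (fun _ => _) = (fun y => (a ^+ 2)^-1 * ((fun y : R => 2^-1 * y + 0) +
     (fun y => (4 * a)^-1 * sin (- (2 * a) * y + 2 * a * t)) : R -> R) y)).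
    by apply: (is_derive_eq h4); rewrite /f; field.
  by apply/funext => y /=; rewrite fctE addr0.
have cf : continuous f.
  move=> r; apply: cvgM; last exact: cvg_cst.
  apply: cvgB; first exact: cvg_cst.
  apply: cvgM; first exact: cvg_cst.
  apply: is_derive_continuous; exact: is_derive_cos_affine.
have := rint_indic_itv_derive t_gt0 dF cf.
have -> : (fun r => \1_(`[0%R, t]) r * f r) = (fun r => \1_(`[0%R, t]) r * fwk (t - r) xi ^+ 2).
  apply/funext => r; congr (_ * _); rewrite /fourier_wave_kernel -/a exprMn exprVn /f; congr (_ / _).
  rewrite (_ : - (2 * a) * r + 2 * a * t = ((t - r) * Num.sqrt theta * enorm xi) *+ 2); last first.
    by rewrite -(mulrA (t - r)) -/a mulr2n; ring.
  rewrite cos_mulr2n; have := cos2Dsin2 ((t - r) * Num.sqrt theta * enorm xi).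
  move: (cos _) (sin _) => x y xy; have -> : x ^+ 2 = 1 - y ^+ 2 by rewrite -xy addrK.
  by field.
move=> ->; rewrite /F !mulr0 !add0r -mulrBl; congr (_ / _).
rewrite (_ : - (2 * a) * t + 2 * a * t = 0); last by ring.
by rewrite sin0 mulr0 addr0 (_ : 2 * a * t = 2 * t * a); [ring|ring].
Qed.

(** The kernel is at most s <= t because |sin x| <= |x|, and at most 1/(sqrt(theta)|xi|) because
    |sin| <= 1; the first is used near 0, the second far away. *)
Lemma fwk_sqr_le (s : R) (xi : 'rV[R]_d) : 0 <= s <= t ->
  fwk s xi ^+ 2 * enorm xi `^ (beta - d%:R) <=
  (t ^+ 2 + theta^-1) * constK (d := d) beta * majK beta xi.
Proof.
move=> /andP[s0 st].
have c0 : 0 < t ^+ 2 + theta^-1 by rewrite addr_gt0 ?invr_gt0 ?exprn_gt0.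
have p0 : 0 <= enorm xi `^ (beta - d%:R) by exact: powR_ge0.
have r0 := enorm_ge0 xi.
have sth : 0 < Num.sqrt theta by rewrite sqrtr_gt0.
rewrite -mulrA -ler_pdivrMl//; apply: (@le_majK _ _ _ _ _ _ (beta - d%:R)) => //.
- by move=> h; rewrite /fourier_wave_kernel h !mulr0 sin0 mul0r expr0n/= mul0r mulr0.
- move=> _; rewrite mulrA ler_piMl// ler_pdivrMl// mulr1 -(real_normK (num_real _)).
  apply: (@le_trans _ _ (t ^+ 2)); last by rewrite lerDl invr_ge0 ltW.
  rewrite lerXn2r ?nnegrE ?(ltW t_gt0)//; apply: le_trans st.
  rewrite /fourier_wave_kernel; have [->|a0] := eqVneq (Num.sqrt theta * enorm xi) 0.
    by rewrite invr0 mulr0 normr0.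
  have a1 : 0 < Num.sqrt theta * enorm xi by rewrite lt_neqAle eq_sym a0 mulr_ge0// ltW.
  rewrite normrM normfV (gtr0_norm a1) ler_pdivrMr// (le_trans (sin_le_norm _))//.
  by rewrite -mulrA normrM (gtr0_norm a1) ger0_norm.
- move=> r1; have r1' : 0 < enorm xi by exact: lt_le_trans r1.
  have -> : enorm xi `^ (beta - d%:R) = enorm xi ^+ 2 * enorm xi `^ (beta - d%:R - 2).
    by rewrite powR_expn_add//; congr (_ `^ _); ring.
  rewrite (_ : _ * _ = ((t ^+ 2 + theta^-1)^-1 * (fwk s xi ^+ 2 * enorm xi ^+ 2)) *
    enorm xi `^ (beta - d%:R - 2)); last by rewrite !mulrA.
  rewrite ler_piMl ?powR_ge0// ler_pdivrMl// mulr1.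
  apply: (@le_trans _ _ theta^-1); last by rewrite lerDr sqr_ge0.
  have r0' : enorm xi != 0 by rewrite gt_eqF.
  have s0' : Num.sqrt theta != 0 by rewrite gt_eqF.
  rewrite (_ : _ * _ = sin (s * Num.sqrt theta * enorm xi) ^+ 2 * (Num.sqrt theta ^+ 2)^-1).
    rewrite sqr_sqrtr ?(ltW theta_gt0)// ler_piMl ?invr_ge0 ?(ltW theta_gt0)//.
  rewrite /fourier_wave_kernel; field.
  by rewrite r0' s0'.
Qed.

Let msin : measurable_fun setT (@sin R).
Proof. exact: (continuous_measurable_fun (@continuous_sin R)). Qed.

Section fubini.
Variable x : 'rV[R]_d.

Let phi (p : measurableTypeR R * 'rV[R]_d) : R :=
  \1_(`[0%R, t]) p.1 * (cos (dotp x p.2) * (fwk (t - p.1) p.2 * fwk (t - p.1) p.2 *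
    enorm p.2 `^ (beta - d%:R))).

Let mphi : measurable_fun setT phi.
Proof.
have m1 : measurable_fun setT (fun p : measurableTypeR R * 'rV[R]_d => p.1 : R).
  exact: measurable_fst.
have me : measurable_fun setT (fun p : measurableTypeR R * 'rV[R]_d => enorm p.2).
  by apply: (measurableT_comp (@measurable_enorm R d)); exact: measurable_snd.
have mk : measurable_fun setT (fun p : measurableTypeR R * 'rV[R]_d => fwk (t - p.1) p.2).
  apply: measurable_funM.
    apply: (measurableT_comp msin); apply: measurable_funM => //; apply: measurable_funM => //.
    exact: measurable_funB.
  (* The inverse is written as a power with exponent -1, for which measurability is available. *)
  rewrite (_ : (fun _ => _) = (fun p => (Num.sqrt theta * enorm p.2) `^ (-1))).
    by apply: measurable_powRl; apply: measurable_funM.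
  by apply/funext => p; rewrite powR_inv1// mulr_ge0 ?sqrtr_ge0 ?enorm_ge0.
apply: measurable_funM.
  by apply: (measurableT_comp _ m1); exact: measurable_indic.
apply: measurable_funM.
  apply: (measurableT_comp (continuous_measurable_fun (@continuous_cos R))).
  by apply: (measurableT_comp (measurable_dotp x)); exact: measurable_snd.
by apply: measurable_funM; [exact: measurable_funM|exact: measurable_powRl].
Qed.

Let phi_le p : `|phi p| <= \1_(`[0%R, t]) p.1 *
  ((t ^+ 2 + theta^-1) * constK (d := d) beta * majK beta p.2).
Proof.
rewrite /phi normrM indicE mem_setE in_itv/=.
case: (boolP (0 <= p.1 <= t)) => [/andP[h0 ht]|_]; last by rewrite normr0 !mul0r.
rewrite normr1 !mul1r normrM; apply: (@le_trans _ _ (1 *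
    (fwk (t - p.1) p.2 ^+ 2 * enorm p.2 `^ (beta - d%:R)))).
  apply: ler_pM => //; first exact: cos_max.
  by rewrite -expr2 ger0_norm// mulr_ge0 ?sqr_ge0 ?powR_ge0.
by rewrite mul1r fwk_sqr_le//; apply/andP; split; lra.
Qed.

Let ih2 : rintegrable leb (fun w => (t ^+ 2 + theta^-1) * constK (d := d) beta * majK beta w).
Proof. by apply: rintegrableZ; exact: integrable_majK. Qed.

Let phiE w : rint mu (fun r => phi (r, w)) = cos (dotp x w) * wave_spectrum w.
Proof.
rewrite /wave_spectrum -time_integral.
have bnd : rintegrable mu (fun r => \1_(`[0%R, t]) r * fwk (t - r) w ^+ 2).
  apply: (rintegrable_itv_bounded (C := `|(Num.sqrt theta * enorm w)^-1| ^+ 2)).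
    apply: measurable_funX; apply: measurable_funM => //; apply: (measurableT_comp msin).
    apply: measurable_funM => //; apply: measurable_funM => //; exact: measurable_funB.
  move=> r _; rewrite normrX /fourier_wave_kernel normrM exprMn ler_piMl ?sqr_ge0//.
  by rewrite exprn_ile1// sin_max.
rewrite mulrC -mulrA mulrC -rintZ//; apply: eq_rint => r; rewrite /phi /=; ring.
Qed.

(** The integrand is dominated by the indicator of [0, t] times a multiple of [majK], so the
    integrals in time and frequency may be exchanged and the time integral evaluated. *)
Lemma wave_fubini :
  Rintegral mu `[0%R, t] (fun r => Rintegral leb setT (fun xi =>
    cos (dotp x xi) * (fwk (t - r) xi * fwk (t - r) xi * enorm xi `^ (beta - d%:R)))) =
  rint leb (fun xi => cos (dotp x xi) * wave_spectrum xi) /\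
  rintegrable leb (fun xi => cos (dotp x xi) * wave_spectrum xi).
Proof.
have := rint_fubini mphi (rintegrable_indic_itv 0 t) ih2 phi_le.
have := rintegrable_fubini2 mphi (rintegrable_indic_itv 0 t) ih2 phi_le.
rewrite (_ : (fun y => rint _ (fun z => phi (z, y))) =
  (fun xi => cos (dotp x xi) * wave_spectrum xi)); last by apply/funext => w; rewrite phiE.
move=> h1 h2; split=> //; rewrite -h2 -rint_indic_itv; apply: eq_rint => r.
rewrite /phi/= indicE; case: (_ \in _); last first.
  by rewrite mul0r -[LHS](rint0 leb); apply: eq_rint => w; rewrite mul0r.
by rewrite mul1r; apply: (@eq_rint _ _ _ leb) => w; rewrite mul1r.
Qed.

End fubini.

Lemma rintegrable_wave_spectrum : rintegrable leb wave_spectrum.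
Proof.
have [_] := wave_fubini 0; congr (rintegrable leb _); apply/funext => xi.
by rewrite /dotp big1 ?cos0 ?mul1r// => i _; rewrite mxE mul0r.
Qed.

End wave_covariance.

(** * Second differences in Fourier space *)

Section second_difference.
Context {R : realType}.

Definition diff2 (a : nat) : R := if a == 1%N then - 2 else 1.

(** The multiplier of the second difference has squared modulus |e^(iz) - 2 + e^(-iz)|^2 = 16
    sin^4(z/2). *)
Lemma diff2_cos (m z : R) :
  \sum_(a < 3) \sum_(b < 3) diff2 a * diff2 b * cos ((m + a%:R - b%:R) * z) =
  16 * sin (z / 2) ^+ 4 * cos (m * z).
Proof.
rewrite !big_ord_recl !big_ord0 /diff2 /bump /= !addr0 !subr0.
rewrite (_ : (m + 1 - 1) * z = m * z); last by ring.
rewrite (_ : (m + 2 - 2) * z = m * z); last by ring.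
rewrite (_ : (m - 1) * z = m * z - z); last by ring.
rewrite (_ : (m + 1) * z = m * z + z); last by ring.
rewrite (_ : (m + 1 - 2) * z = m * z - z); last by ring.
rewrite (_ : (m + 2 - 1) * z = m * z + z); last by ring.
rewrite (_ : (m - 2) * z = m * z - z *+ 2); last by rewrite mulr2n; ring.
rewrite (_ : (m + 2) * z = m * z + z *+ 2); last by rewrite mulr2n; ring.
have c2 := cos_mulr2n z; move: (z *+ 2) c2 => z2 c2.
rewrite !cosB !cosD c2.
rewrite (_ : cos z = 1 - 2 * sin (z / 2) ^+ 2); first by ring.
rewrite {1}(_ : z = (z / 2) *+ 2); last by rewrite mulr2n -splitr.
rewrite cos_mulr2n; have := cos2Dsin2 (z / 2); move: (cos _) (sin _) => x y xy.
have -> : x ^+ 2 = 1 - y ^+ 2 by rewrite -xy addrK.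
by ring.
Qed.

(** The shift to k.+1 makes the stencil run over k, k + 1, k + 2. *)
Lemma I_spE d (Omega : Type) (u : R -> 'rV[R]_d -> Omega -> R) t rho lam k w :
  I_sp u t rho lam k.+1 w = \sum_(a < 3) diff2 a * u t (obs_point rho lam (k + a)) w.
Proof.
rewrite !big_ord_recl big_ord0 /diff2 /bump /I_sp /= !addn0 addn1 addn2; ring.
Qed.

Lemma dotp_obs_point d (rho : 'rV[R]_d) lam (j k : nat) w :
  dotp (obs_point rho lam j - obs_point rho lam k) w = (j%:R - k%:R) * (lam * dotp rho w).
Proof. by rewrite dotpBl /obs_point !dotp_scalel; ring. Qed.

End second_difference.

(** * Spectral density of the rescaled second differences *)

Section density.
Context {R : realType} {d : nat} (theta beta t : R).
Hypotheses (beta_gt0 : 0 < beta) (beta_lt2 : beta < 2) (beta_ltd : beta < d%:R).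
Hypotheses (theta_gt0 : 0 < theta) (t_gt0 : 0 < t).
Variable rho : 'rV[R]_d.
Hypothesis rho1 : enorm rho = 1.
Local Notation g := (g_sp beta rho).

(* The spectral density of the stationary rescaled second differences, up to
   the factor (2 pi)^-d. *)
Definition diff2_density (lam : R) (w : 'rV[R]_d) : R :=
  8 * t / theta * g w -
  lam * (4 / (theta * Num.sqrt theta)) * gerr beta rho (2 * t * Num.sqrt theta / lam) w.

Let sth : 0 < Num.sqrt theta. Proof. by rewrite sqrtr_gt0. Qed.
Let sth2 : Num.sqrt theta ^+ 2 = theta. Proof. by rewrite sqr_sqrtr// ltW. Qed.

Lemma measurable_diff2_density lam : measurable_fun setT (diff2_density lam).
Proof.
apply: measurable_funB; apply: measurable_funM => //; first exact: measurable_g_sp.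
exact: measurable_gerr.
Qed.

Let g0 w : enorm w = 0 -> g w = 0.
Proof. by move=> w0; rewrite /g_sp w0 powR0 ?mulr0// lt_eqF// subr_lt0 (lt_trans (y := 0))// subr_lt0. Qed.

Let gerr0 A w : enorm w = 0 -> gerr beta rho A w = 0.
Proof. by move=> w0; rewrite /gerr w0 powR0 ?mulr0 ?mul0r// lt_eqF// subr_lt0 (lt_trans (y := 0))// subr_lt0. Qed.

(** Since |sin(A r)| <= A r, the remainder is at most A [g_sp]. The factor 1/lambda in A cancels the
    prefactor lambda, so the majorant does not depend on lambda. *)
Lemma diff2_density_le lam w : 0 < lam ->
  `|diff2_density lam w| <= 16 * t / theta * constH (d := d) beta * majH beta w.
Proof.
move=> lam0; rewrite -mulrA.
have c0 : 0 < 16 * t / theta by rewrite divr_gt0// mulr_gt0.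
apply: (@le_trans _ _ (16 * t / theta * g w)); last first.
  by rewrite ler_pM2l// (le_trans (ler_norm _))// g_sp_le_majH.
rewrite /diff2_density; have [w0|w0] := eqVneq (enorm w) 0.
  by rewrite g0// gerr0// !mulr0 subrr normr0.
have r0 : 0 < enorm w by rewrite lt_neqAle eq_sym w0 enorm_ge0.
set A := 2 * t * Num.sqrt theta / lam.
have A0 : 0 < A by rewrite divr_gt0// !mulr_gt0.
have h : `|gerr beta rho A w| <= A * g w.
  rewrite /gerr /g_sp normrM [X in X * _]ger0_norm; last first.
    by rewrite mulr_ge0 ?powR_ge0// exprn_even_ge0.
  have s4 : 0 <= sin (dotp rho w / 2) ^+ 4 by rewrite exprn_even_ge0.
  rewrite mulrCA -mulrA; apply: ler_wpM2l => //.
  rewrite (_ : beta - d%:R - 2 = 1%:R + (beta - d%:R - 3)); last by ring.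
  rewrite -powR_expn_add// expr1 mulrA mulrC ler_wpM2r ?powR_ge0//.
  by rewrite (le_trans (sin_le_norm _))// gtr0_norm// mulr_gt0.
have k0 : 0 < lam * (4 / (theta * Num.sqrt theta)) by rewrite !mulr_gt0// invr_gt0 mulr_gt0.
apply: (le_trans (ler_normB _ _)); rewrite normrM (gtr0_norm (x := 8 * t / theta)); last first.
  by rewrite divr_gt0// mulr_gt0.
rewrite (ger0_norm (g_sp_ge0 _ _ _)) normrM (gtr0_norm k0).
have := ler_wpM2l (ltW k0) h.
have -> : lam * (4 / (theta * Num.sqrt theta)) * (A * g w) = 8 * t / theta * g w.
  by rewrite /A; field; rewrite !gt_eqF.
rewrite (_ : 16 * t / theta * g w = 8 * t / theta * g w + 8 * t / theta * g w); last by ring.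
lra.
Qed.

(** Substitution xi = w/lambda: by homogeneity the powers of lambda cancel in the leading term, and
    one power survives in the oscillating term. *)
Lemma wave_spectrum_scale lam w : 0 < lam ->
  lam `^ (beta - 2) * lam ^- d * (16 * sin (dotp rho w / 2) ^+ 4 * wave_spectrum theta beta t (lam^-1 *: w))
  = diff2_density lam w.
Proof.
move=> lam0; have l0 := ltW lam0; have li0 : 0 <= lam^-1 by rewrite invr_ge0.
rewrite /wave_spectrum enorm_scale// /diff2_density.
have [w0|w0] := eqVneq (enorm w) 0.
  by rewrite g0// gerr0// w0 !mulr0 expr0n invr0 mulr0 mul0r !mulr0 subrr.
have r0 : 0 < enorm w by rewrite lt_neqAle eq_sym w0 enorm_ge0.
rewrite /g_sp /gerr powRM ?enorm_ge0//.
rewrite (_ : lam^-1 `^ (beta - d%:R) = lam `^ (d%:R - beta)); last first.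
  by rewrite -[in LHS]powR_inv1// -powRrM; congr (_ `^ _); ring.
have e1 : lam `^ (beta - 2) * lam `^ (d%:R - beta) * lam ^+ 2 = lam ^+ d.
  rewrite -!powR_mulrn// -!powRD ?(gt_eqF lam0) ?implybT//.
  by congr (_ `^ _); ring.
have e2 : enorm w `^ (beta - d%:R) = enorm w ^+ 3 * enorm w `^ (beta - d%:R - 3).
  by rewrite powR_expn_add//; congr (_ `^ _); ring.
have e3 : enorm w `^ (beta - d%:R - 2) = enorm w ^+ 1 * enorm w `^ (beta - d%:R - 3).
  by rewrite powR_expn_add//; congr (_ `^ _); ring.
rewrite e2 e3 (_ : 2 * t * (Num.sqrt theta * (lam^-1 * enorm w)) =
  2 * t * Num.sqrt theta / lam * enorm w); last by ring.
have ld : lam ^+ d != 0 by rewrite expf_neq0// gt_eqF.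
have e4 : lam `^ (d%:R - beta) = lam ^+ d / (lam `^ (beta - 2) * lam ^+ 2).
  by rewrite -e1; field; rewrite ?gt_eqF ?powR_gt0//.
rewrite e4; have s0 : Num.sqrt theta != 0 by rewrite gt_eqF.
move: (Num.sqrt theta) sth2 s0 => s <- s0.
move: (sin (dotp rho w / 2)) (sin _) (enorm w `^ (beta - d%:R - 3)) => x y z.
have p0 : lam `^ (beta - 2) != 0 by rewrite gt_eqF// powR_gt0.
move: (lam `^ _) p0 (lam ^+ d) ld => p p0 l ld.
have lam0' : lam != 0 by rewrite gt_eqF.
field.
by rewrite p0 ld s0 lam0' w0.
Qed.

End density.

(** * The rescaled second differences of the solution *)

Section solution.
Context {R : realType} {d : nat} (theta beta t : R).
Hypotheses (beta_gt0 : 0 < beta) (beta_lt2 : beta < 2) (beta_ltd : beta < d%:R).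
Hypotheses (theta_gt0 : 0 < theta) (t_gt0 : 0 < t).
Variable rho : 'rV[R]_d.
Hypothesis rho1 : enorm rho = 1.
Context {dO : measure_display} {Omega : measurableType dO}
  (P : probability Omega R) (u : R -> 'rV[R]_d -> {RV P >-> R}).
Hypothesis u_sol : is_wave_solution theta beta u.
Local Notation leb := (@lebn R d).
Local Notation S := (wave_spectrum theta beta t).
Local Notation E := (rint P).
Local Notation U x := (u t x : Omega -> R).

Lemma expectation_rint (X : Omega -> R) : fine ('E_P[X])%E = E X.
Proof. by rewrite unlock. Qed.

Let t_ge0 : 0 <= t. Proof. exact: ltW. Qed.

Lemma solution_gaussian N (x : 'I_N -> 'rV[R]_d) (a : 'I_N -> R) :
  has_gaussian_law P (fun w => \sum_k a k * U (x k) w).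
Proof. by have [h _ _] := u_sol; exact: (h N (fun k => (t, x k)) a). Qed.

Lemma solution_gaussian_fin (I : finType) (x : I -> 'rV[R]_d) (a : I -> R) :
  has_gaussian_law P (fun w => \sum_i a i * U (x i) w).
Proof.
have := solution_gaussian (fun k : 'I_#|I| => x (enum_val k)) (fun k => a (enum_val k)).
rewrite (_ : (fun w => _) = (fun w => \sum_i a i * U (x i) w))//.
by apply/funext => w; rewrite [RHS](reindex _ (onW_bij _ (enum_val_bij I))).
Qed.

Lemma solution_allmom x : allmom P (U x).
Proof.
split; first exact: measurable_funP.
have [] // := @gaussian_moments _ _ _ P (U x) (measurable_funP _).
have := solution_gaussian (fun _ : 'I_1 => x) (fun=> 1).
rewrite (_ : (fun w => _) = U x)//; apply/funext => w.
by rewrite big_ord_recl big_ord0 mul1r addr0.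
Qed.

Lemma solution_mean x : E (U x) = 0.
Proof. by have [_ h _] := u_sol; rewrite -expectation_rint h. Qed.

(** The real part of the covariance identity, in which the exponential becomes a cosine, with the
    time integral carried out by [wave_fubini]. *)
Lemma solution_cov x y : E (fun w => U x w * U y w) =
  (2 * pi) ^- d * rint leb (fun xi => cos (dotp (x - y) xi) * S xi).
Proof.
have [_ _ h] := u_sol.
have := congr1 (@complex.Re R) (h t x t y t_ge0 t_ge0).
rewrite expectation_rint /= => ->.
rewrite /wave_covariance minxx /Cintegral /= mul0r subr0; congr (_ * _).
have [<- _] := wave_fubini beta_gt0 beta_lt2 beta_ltd theta_gt0 t_gt0 (x - y).
apply: eq_Rintegral => r _; apply: eq_Rintegral => xi _.
by rewrite mulr0 subr0.
Qed.

(** Indexed from 0, so that k stands for I_sp at k + 1; the sum of squares over k < n is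
    lambda^(beta-2) [V_sp]. *)
Definition rescaled_diff2 (lam : R) (k : nat) (w : Omega) : R :=
  lam `^ ((beta - 2) / 2) * I_sp (fun s x => u s x) t rho lam k.+1 w.

Local Notation p := (obs_point rho).

Let rescaledE lam k w : rescaled_diff2 lam k w =
  \sum_(a < 3) lam `^ ((beta - 2) / 2) * diff2 a * U (p lam (k + a)) w.
Proof.
by rewrite /rescaled_diff2 I_spE mulr_sumr; apply: eq_bigr => a _; rewrite mulrA.
Qed.

Lemma rescaled_diff2_gaussian lam N (a : 'I_N -> R) :
  has_gaussian_law P (fun w => \sum_k a k * rescaled_diff2 lam k w).
Proof.
have := solution_gaussian_fin (fun i : 'I_N * 'I_3 => p lam (i.1 + i.2))
  (fun i => a i.1 * (lam `^ ((beta - 2) / 2) * diff2 i.2)).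
rewrite (_ : (fun w => _) = (fun w => \sum_k a k * rescaled_diff2 lam k w))//.
apply/funext => w.
rewrite -(pair_bigA _ (fun (k : 'I_N) (l : 'I_3) => a k * (lam `^ ((beta - 2) / 2) * diff2 l) * U (p lam (k + l)) w))/=.
apply: eq_bigr => k _; rewrite rescaledE mulr_sumr; apply: eq_bigr => l _.
by rewrite !mulrA.
Qed.

Lemma measurable_rescaled_diff2 lam k : measurable_fun setT (rescaled_diff2 lam k).
Proof.
rewrite (_ : rescaled_diff2 lam k = fun w => \sum_(a < 3) lam `^ ((beta - 2) / 2) * diff2 a * U (p lam (k + a)) w).
  apply: measurable_sum => a; exact: measurable_funM.
by apply/funext => w; rewrite rescaledE.
Qed.

Lemma rescaled_diff2_mean lam k : E (rescaled_diff2 lam k) = 0.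
Proof.
under eq_rint do rewrite rescaledE.
rewrite rint_sum => [|a _]; last exact/rintegrableZ/allmom_int/solution_allmom.
rewrite big1// => a _; rewrite rintZ ?solution_mean ?mulr0//.
exact/allmom_int/solution_allmom.
Qed.

Let intcS (x : 'rV[R]_d) : rintegrable leb (fun xi => cos (dotp x xi) * S xi).
Proof. by have [] := wave_fubini beta_gt0 beta_lt2 beta_ltd theta_gt0 t_gt0 x. Qed.

(** The double second difference of cos produces 16 sin^4 times a cosine of (j - k), and the
    dilation xi = w/lambda turns the spectrum into [diff2_density]. The covariance depends on j - k
    only. *)
Lemma rescaled_diff2_cov lam j k : 0 < lam ->
  E (fun w => rescaled_diff2 lam j w * rescaled_diff2 lam k w) =
  (2 * pi) ^- d * fco rho (diff2_density theta beta t rho lam) (j%:R - k%:R).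
Proof.
move=> lam0; set q := lam `^ ((beta - 2) / 2).
have q2 : q ^+ 2 = lam `^ (beta - 2) by rewrite powR_exprn divfK.
have aUU x y : allmom P (fun w => U x w * U y w).
  by apply: allmomM; exact: solution_allmom.
transitivity (E (fun w => \sum_(a < 3) \sum_(b < 3)
    q ^+ 2 * (diff2 a * diff2 b) * (U (p lam (j + a)) w * U (p lam (k + b)) w))).
  apply: eq_rint => w; rewrite !rescaledE big_distrlr; apply: eq_bigr => a _.
  by apply: eq_bigr => b _ /=; rewrite -/q; ring.
rewrite rint_sum => [|a _]; last first.
  by apply: rintegrable_sum => b _; apply/rintegrableZ/allmom_int.
pose y xi := lam * dotp rho xi.
transitivity ((2 * pi) ^- d * (lam `^ (beta - 2) * rint leb (fun xi =>
    \sum_(a < 3) \sum_(b < 3) diff2 a * diff2 b *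
      (cos (dotp (p lam (j + a) - p lam (k + b)) xi) * S xi)))).
  rewrite rint_sum => [|a _]; last by apply: rintegrable_sum => b _; exact: rintegrableZ.
  rewrite mulrA mulr_sumr; apply: eq_bigr => a _.
  rewrite rint_sum => [|b _]; last by apply/rintegrableZ/allmom_int.
  rewrite rint_sum => [|b _]; last exact: rintegrableZ.
  rewrite mulr_sumr; apply: eq_bigr => b _.
  by rewrite !rintZ//; [rewrite solution_cov q2; ring|apply: allmom_int].
congr (_ * _).
pose f xi := 16 * sin (y xi / 2) ^+ 4 * cos ((j%:R - k%:R) * y xi) * S xi.
have fE : (fun xi => \sum_(a < 3) \sum_(b < 3) diff2 a * diff2 b *
      (cos (dotp (p lam (j + a) - p lam (k + b)) xi) * S xi)) = f.
  apply/funext => xi; rewrite /f -diff2_cos mulr_suml; apply: eq_bigr => a _.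
  rewrite mulr_suml; apply: eq_bigr => b _; rewrite dotp_obs_point mulrA.
  by rewrite !natrD; congr (_ * cos (_ * _) * _); ring.
have intf : rintegrable leb f.
  rewrite -fE; apply: rintegrable_sum => a _; apply: rintegrable_sum => b _.
  exact: rintegrableZ.
rewrite fE; have li0 : 0 < lam^-1 by rewrite invr_gt0.
have := rint_scale li0 intf; rewrite exprVn invrK => h.
have -> : rint leb f = lam ^- d * rint leb (fun w => f (lam^-1 *: w)).
  by rewrite h mulrA mulVf ?mul1r// expf_neq0// gt_eqF.
rewrite mulrA -rintZ; last exact: rintegrable_scale.
apply: eq_rint => w; rewrite -(wave_spectrum_scale t beta_ltd theta_gt0 rho w lam0).
rewrite /f /y dotp_scaler mulVKf ?gt_eqF//; ring.
Qed.

End solution.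

(** * Means of Toeplitz sums *)

Section toeplitz_means.
Context {R : realType}.
Implicit Types (h : nat -> R) (F : R -> R).

(** Enlarging the matrix from size k to k + 1 adds one diagonal entry and two equal borders. Divided
    by n, the sum is a Cesaro mean of symmetric partial sums of F. *)
Lemma toeplitz_sum F n : (forall y, F (- y) = F y) ->
  \sum_(i < n) \sum_(j < n) F (i%:R - j%:R) =
  \sum_(k < n) (\sum_(m < k.+1) F m%:R + \sum_(m < k) F m.+1%:R).
Proof.
move=> FN; have rev k (G : nat -> R) : \sum_(j < k) G (k - j)%N = \sum_(m < k) G m.+1.
  rewrite [LHS](reindex_inj rev_ord_inj); apply: eq_bigr => m _ /=.
  by rewrite subKn.
elim: n => [|n IH]; first by rewrite !big_ord0.
rewrite big_ord_recr/= [RHS]big_ord_recr/= -IH.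
under eq_bigr do rewrite big_ord_recr/=.
rewrite big_split/= -addrA; congr (_ + _).
rewrite addrC; congr (_ + _).
  rewrite big_ord_recr/= subrr [RHS]big_ord_recl addrC; congr (_ + _).
  rewrite -(rev n (fun m => F m%:R)); apply: eq_bigr => j _.
  by rewrite natrB// ltnW.
rewrite -(rev n (fun m => F m%:R)); apply: eq_bigr => j _.
by rewrite natrB 1?ltnW// -FN opprB.
Qed.

Lemma toeplitz_sum_le F n : (forall y, F (- y) = F y) -> (forall y, 0 <= F y) ->
  \sum_(i < n) \sum_(j < n) F (i%:R - j%:R) <= n%:R * (2 * \sum_(m < n) F m%:R).
Proof.
move=> FN F0; rewrite toeplitz_sum//.
have nd : nondecreasing_seq (fun k => \sum_(m < k) F m%:R).
  by apply/nondecreasing_seqP => k; rewrite big_ord_recr/= lerDl.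
apply: (@le_trans _ _ (\sum_(k < n) 2 * \sum_(m < n) F m%:R)); last first.
  by rewrite sumr_const card_ord [leRHS]mulr_natl.
apply: ler_sum => k _; rewrite mulr2n mulrDl !mul1r; apply: lerD; first exact: nd.
apply: (@le_trans _ _ (\sum_(m < k.+1) F m%:R)); last exact: nd.
by rewrite [leRHS]big_ord_recl lerDr.
Qed.

Lemma bounded_series_cvg h (K : R) : (forall k, 0 <= h k) ->
  (forall n, \sum_(k < n) h k <= K) -> cvgn (fun n => \sum_(k < n) h k).
Proof.
move=> h0 hK; apply: nondecreasing_is_cvgn.
  by apply/nondecreasing_seqP => n; rewrite big_ord_recr/= lerDl.
by exists K => _ [n _ <-].
Qed.

Lemma nneseries_bounded h (K : R) : (forall k, 0 <= h k) ->
  (forall n, \sum_(k < n) h k <= K) ->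
  (\esum_(k in [set: nat]) (h k)%:E = (limn (fun n => \sum_(k < n) h k))%:E)%E.
Proof.
move=> h0 hK; rewrite -nneseries_esumT => [|n]; last by rewrite lee_fin.
rewrite -EFin_lim; last exact: bounded_series_cvg hK.
by congr (limn _); apply/funext => n /=; rewrite big_mkord sumEFin.
Qed.

Lemma esum_int (f : int -> \bar R) : (forall z, 0 <= f z)%E ->
  (\esum_(z in [set: int]) f z =
   \esum_(n in [set: nat]) f (Posz n) + \esum_(n in [set: nat]) f (Negz n))%E.
Proof.
move=> f0; rewrite (esumID [set z : int | 0 <= z])//; congr (_ + _)%E.
- apply: (reindex_esum setT); split=> [n _|m n _ _ []//|[n|n] []//= _ _] //.
  by exists n.
- apply: (reindex_esum setT); split=> [n _|m n _ _ []//|[n|n] [] //= _ h] //.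
  by exists n.
Qed.

(** The symmetric partial sums converge to the series over the integers, split into nonnegative and
    negative indices, and Cesaro means keep the limit. *)
Lemma toeplitz_mean_cvg F (K : R) : (forall y, F (- y) = F y) -> (forall y, 0 <= F y) ->
  (forall n, \sum_(m < n) F m%:R <= K) ->
  n%:R^-1 * (\sum_(i < n) \sum_(j < n) F (i%:R - j%:R)) @[n --> \oo] -->
  fine (\esum_(z in [set: int]) (F z%:~R)%:E)%E.
Proof.
move=> FN F0 FK.
pose h k := F k%:R; pose h1 k := F k.+1%:R.
have h1K n : \sum_(m < n) h1 m <= K.
  by apply: le_trans (FK n.+1); rewrite big_ord_recl lerDr.
have -> : fine (\esum_(z in [set: int]) (F z%:~R)%:E)%E =
    limn (fun n => \sum_(k < n) h k) + limn (fun n => \sum_(k < n) h1 k).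
  rewrite esum_int => [|z]; last by rewrite lee_fin.
  rewrite (_ : \esum_(n in [set: nat]) (F (Posz n)%:~R)%:E =
    (limn (fun n => \sum_(k < n) h k))%:E)%E; last exact: nneseries_bounded FK.
  rewrite (_ : \esum_(n in [set: nat]) (F (Negz n)%:~R)%:E =
    (limn (fun n => \sum_(k < n) h1 k))%:E)%E//.
  rewrite -(nneseries_bounded (h := h1) _ h1K) => [|k]; last exact: F0.
  apply: eq_esum => n _.
  by rewrite NegzE -FN mulrNz opprK.
set L := limn (fun n : nat => \sum_(k < n) h k); set L1 := limn (fun n : nat => \sum_(k < n) h1 k).
pose s k := \sum_(m < k.+1) h m + \sum_(m < k) h1 m.
have hL : \sum_(m < k) h m @[k --> \oo] --> L by apply: (bounded_series_cvg (h := h) _ FK) => k; exact: F0.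
have h1L : \sum_(m < k) h1 m @[k --> \oo] --> L1 by apply: (bounded_series_cvg (h := h1) _ h1K) => k; exact: F0.
have sL : s k @[k --> \oo] --> L + L1.
  by apply: cvgD => //; move: hL; rewrite -(cvg_shiftS (fun k => \sum_(m < k) h m)).
(* [arithmetic_mean] at n averages n + 1 terms, hence the shift. *)
have := cesaro sL; rewrite -[X in _ -> X]cvg_shiftS.
rewrite (_ : arithmetic_mean s = (fun n => n.+1%:R^-1 *
  (\sum_(i < n.+1) \sum_(j < n.+1) F (i%:R - j%:R))))//.
by apply/funext => n; rewrite /arithmetic_mean /= /series/= big_mkord toeplitz_sum.
Qed.

End toeplitz_means.

(** * Consequences of the mesh condition *)

Lemma cvg0_le {R : realType} (f g : nat -> R) : (\forall n \near \oo, `|f n| <= g n) ->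
  g n @[n --> \oo] --> (0 : R) -> f n @[n --> \oo] --> (0 : R).
Proof.
move=> fg /cvgr0Pnorm_le g0; apply/cvgr0Pnorm_le => e e0.
near=> n; apply: (@le_trans _ _ `|g n|); last by near: n; exact: g0.
by rewrite (le_trans _ (ler_norm _))//; near: n.
Unshelve. all: end_near. Qed.

Section mesh.
Context {R : realType} (lambda : nat -> R).
Hypothesis lambda_gt0 : forall n, (0 < n)%N -> 0 < lambda n.
Hypothesis lambda_o : lambda =o_\oo (fun n => n%:R `^ (- 4^-1)).

Let lambda_le (e : R) : 0 < e ->
  \forall n \near \oo, (0 < n)%N /\ lambda n <= e * n%:R `^ (- 4^-1).
Proof.
move=> e0; have := lambda_o; rewrite eqoP => /(_ e e0) h.
near=> n; have n0 : (0 < n)%N by near: n; exact: nbhs_infty_gt.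
split=> //; apply: (le_trans (ler_norm _)).
rewrite -[X in _ <= e * X]ger0_norm ?powR_ge0//.
by near: n; exact: h.
Unshelve. all: end_near. Qed.

Lemma mesh_cvg0 : lambda n @[n --> \oo] --> (0 : R).
Proof.
apply/cvgr0Pnorm_le => e e0; near=> n.
have [n0 h] : (0 < n)%N /\ lambda n <= e * n%:R `^ (- 4^-1) by near: n; exact: lambda_le.
rewrite gtr0_norm ?lambda_gt0// (le_trans h)// ler_piMr ?(ltW e0)//.
rewrite powRN invf_le1 ?powR_gt0 ?ltr0n// -[leLHS](powRr0 n%:R).
by apply: ler_powR; rewrite ?ler1n.
Unshelve. all: end_near. Qed.

(** lambda^2 = o(n^(-1/2)); this is the rate that removes the bias. *)
Lemma sqrt_mesh_cvg0 : Num.sqrt n%:R * lambda n ^+ 2 @[n --> \oo] --> (0 : R).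
Proof.
(* The constant min(1, e) is chosen because its square is at most e. *)
apply/cvgr0Pnorm_le => e e0; have m0 : 0 < Num.min 1 e by rewrite lt_min ltr01.
near=> n.
have [n0 h] : (0 < n)%N /\ lambda n <= Num.min 1 e * n%:R `^ (- 4^-1).
  by near: n; exact: lambda_le m0.
have l0 := lambda_gt0 n0.
have nR : 0 < n%:R :> R by rewrite ltr0n.
rewrite ger0_norm; last by rewrite mulr_ge0 ?sqrtr_ge0 ?sqr_ge0.
apply: (@le_trans _ _ (Num.sqrt n%:R * (Num.min 1 e * n%:R `^ (- 4^-1)) ^+ 2)).
  rewrite ler_wpM2l ?sqrtr_ge0// lerXn2r ?nnegrE ?mulr_ge0 ?powR_ge0//; exact: ltW.
rewrite exprMn powR_exprn mulrCA -powR12_sqrt ?(ltW nR)//.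
rewrite -powRD ?(gt_eqF nR) ?implybT// (_ : 2^-1 + _ = 0); last by field.
rewrite powRr0 mulr1 expr2 (@le_trans _ _ (1 * Num.min 1 e))//.
  by rewrite ler_wpM2r ?(ltW m0)// ge_min lexx.
by rewrite mul1r ge_min lexx orbT.
Unshelve. all: end_near. Qed.

End mesh.

(** * Limit of the variance, vanishing bias and conclusion *)

Section assembly.
Context {R : realType} {d : nat} (theta beta t : R).
Hypotheses (beta_gt0 : 0 < beta) (beta_lt2 : beta < 2) (beta_ltd : beta < d%:R).
Hypotheses (theta_gt0 : 0 < theta) (t_gt0 : 0 < t).
Variable rho : 'rV[R]_d.
Hypothesis rho1 : enorm rho = 1.
Local Notation leb := (@lebn R d).
Local Notation g := (g_sp beta rho).
Local Notation G := (diff2_density theta beta t rho).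
Local Notation A lam := (2 * t * Num.sqrt theta / lam).
Local Notation kappa := (4 / (theta * Num.sqrt theta)).

Let CH := constH (d := d) beta.
Let CH0 : 0 <= CH. Proof. exact: constH_ge0. Qed.

Lemma rintegrable_g_sp : rintegrable leb g.
Proof.
exact: (rintegrable_dominated beta_gt0 beta_lt2 beta_ltd (measurable_g_sp _ _)
  (g_sp_le_majH beta_gt0 beta_lt2 beta_ltd rho1)).
Qed.

Lemma fco_diff2_density lam y :
  fco rho (G lam) y = 8 * t / theta * fco rho g y -
    lam * kappa * fco rho (gerr beta rho (A lam)) y.
Proof.
have i1 := rintegrable_cos_dominated beta_gt0 beta_lt2 beta_ltd rho (measurable_g_sp _ _)
  (g_sp_le_majH beta_gt0 beta_lt2 beta_ltd rho1) y.
have i2 := rintegrable_cos_dominated beta_gt0 beta_lt2 beta_ltd rho (measurable_gerr beta rho (A lam))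
  (gerr_le_majH beta_gt0 beta_lt2 beta_ltd rho1 (A lam)) y.
rewrite /fco -!rintZ// -rintB; [|exact: rintegrableZ..].
by apply: eq_rint => w; rewrite /diff2_density; ring.
Qed.

Lemma fco0 (f : 'rV[R]_d -> R) : fco rho f 0 = rint leb f.
Proof. by apply: eq_rint => w; rewrite mul0r cos0 mul1r. Qed.

Lemma C_spE_fco : C_spE beta rho = 8 / (2 * pi) ^+ d * fco rho g 0.
Proof.
rewrite /C_spE fco0; congr (_ * _); rewrite Lnorm1 /rint /Rintegral; congr fine.
by apply: eq_integral => w _ /=; rewrite ger0_norm// g_sp_ge0.
Qed.

Lemma C_spV_fco : C_spV beta rho = 128 / (2 * pi) ^+ (2 * d) *
  fine (\esum_(z in [set: int]) (fco rho g z%:~R ^+ 2)%:E)%E.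
Proof.
rewrite /C_spV; congr (_ * fine _); apply: eq_esum => z _; congr (_ ^+ 2)%:E.
by rewrite /Fc /fco; apply: eq_Rintegral => w _; rewrite dotp_scalel.
Qed.

Let fcoF (f : 'rV[R]_d -> R) y : fco rho f (- y) ^+ 2 = fco rho f y ^+ 2.
Proof. by rewrite fcoN. Qed.

(** Each coefficient is p x - r y with x from [g_sp], y from the remainder and r = O(lambda). Its
    square differs from p^2 x^2 by at most r^2 y^2 + p r (x^2 + y^2), and the Toeplitz means of x^2
    and y^2 are bounded uniformly in lambda by [fco_bound]. Hence only [g_sp] contributes to the
    limit. *)
Lemma toeplitz_diff2_density_cvg (lambda : nat -> R) :
  (forall n, (0 < n)%N -> 0 < lambda n) -> lambda n @[n --> \oo] --> (0 : R) ->
  n%:R^-1 * (\sum_(i < n) \sum_(j < n) fco rho (G (lambda n)) (i%:R - j%:R) ^+ 2) @[n --> \oo] -->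
  (8 * t / theta) ^+ 2 * fine (\esum_(z in [set: int]) (fco rho g z%:~R ^+ 2)%:E)%E.
Proof.
move=> l0 lcvg.
have [M0 M0_ge0 hM0] := spectral_bound beta_gt0 beta_lt2 beta_ltd rho1.
(* [fco_bound] requires a strictly positive constant. *)
pose M := M0 + 1; have M_gt0 : 0 < M by rewrite ltr_wpDl.
have hM N (c : 'I_N -> R) : (\int[leb]_w (tsum c (dotp rho w) * majH beta w)%:E <=
    (M * \sum_k c k ^+ 2)%:E)%E.
  apply: (le_trans (hM0 N c)); rewrite lee_fin ler_wpM2r ?lerDl//.
  by apply: sumr_ge0 => k _; rewrite sqr_ge0.
pose K := CH ^+ 2 * M * rint leb (majH beta).
have K0 : 0 <= K.
  rewrite !mulr_ge0 ?sqr_ge0 ?(ltW M_gt0)//.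
  by apply: rint_ge0 => w; exact: majH_ge0.
have bnd := fco_bound beta_gt0 beta_lt2 beta_ltd rho1 M_gt0 hM.
have gK N : \sum_(k < N) fco rho g k%:R ^+ 2 <= K.
  by have [_] := bnd _ _ CH0 (measurable_g_sp _ _) (g_sp_le_majH beta_gt0 beta_lt2 beta_ltd rho1).
have eK lam N : \sum_(k < N) fco rho (gerr beta rho (A lam)) k%:R ^+ 2 <= K.
  by have [_] := bnd _ _ CH0 (measurable_gerr beta rho (A lam))
     (gerr_le_majH beta_gt0 beta_lt2 beta_ltd rho1 (A lam)).
pose D (f : 'rV[R]_d -> R) n : R :=
  n%:R^-1 * (\sum_(i < n) \sum_(j < n) fco rho f (i%:R - j%:R) ^+ 2).
have D_le f n : (0 < n)%N -> (forall N, \sum_(k < N) fco rho f k%:R ^+ 2 <= K) ->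
    D f n <= 2 * K.
  move=> n0 fK; rewrite /D ler_pdivrMl ?ltr0n//.
  apply: le_trans (toeplitz_sum_le (F := fun y => fco rho f y ^+ 2) _ (fcoF f) _) _ => //.
    by move=> y; rewrite sqr_ge0.
  by rewrite ler_wpM2l// ler_pM2l.
have Dg := toeplitz_mean_cvg (F := fun y => fco rho g y ^+ 2) (fcoF g) (fun y => sqr_ge0 _) gK.
pose p := 8 * t / theta; have p0 : 0 < p by rewrite divr_gt0// mulr_gt0.
have kap0 : 0 < kappa by rewrite divr_gt0// mulr_gt0// sqrtr_gt0.
rewrite -[X in _ --> X]addr0.
rewrite (_ : (fun n => _) = (fun n => p ^+ 2 * D g n + (D (G (lambda n)) n - p ^+ 2 * D g n))); last first.
  by apply/funext => n; rewrite addrC subrK.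
apply: cvgD; first by apply: cvgM => //; exact: cvg_cst.
pose r n := lambda n * kappa.
have rcvg : r n @[n --> \oo] --> (0 : R).
  by rewrite -[X in _ --> X](mul0r kappa); apply: cvgM => //; exact: cvg_cst.
apply: (@cvg0_le _ _ (fun n => r n ^+ 2 * (2 * K) + p * r n * (4 * K))); last first.
  rewrite [X in _ --> X](_ : 0 = 0 ^+ 2 * (2 * K) + p * 0 * (4 * K)); last by rewrite !(mulr0, mul0r, expr0n)/= addr0.
  apply: cvgD; apply: cvgM; [|exact: cvg_cst| |exact: cvg_cst].
  - by rewrite (_ : (fun n => r n ^+ 2) = (fun n => r n * r n)); [exact: cvgM|apply/funext => n; rewrite expr2].
  - by apply: cvgM => //; exact: cvg_cst.
near=> n; have n0 : (0 < n)%N by near: n; exact: nbhs_infty_gt.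
have r0 : 0 < r n by rewrite mulr_gt0 ?l0.
pose e := gerr beta rho (A (lambda n)).
have h : `|D (G (lambda n)) n - p ^+ 2 * D g n| <= r n ^+ 2 * D e n + p * r n * (D g n + D e n).
  rewrite /D; set X := \sum_i _; set Y := \sum_i _; set Z := \sum_i _.
  rewrite (_ : _ - _ = n%:R^-1 * (X - p ^+ 2 * Y)); last by ring.
  rewrite [leRHS](_ : _ = n%:R^-1 * (r n ^+ 2 * Z + p * r n * (Y + Z))); last by ring.
  rewrite normrM ger0_norm ?invr_ge0// ler_wpM2l ?invr_ge0//.
  rewrite /X /Y /Z -big_split/= !mulr_sumr -sumrB -big_split/=.
  apply: (le_trans (ler_norm_sum _ _ _)); apply: ler_sum => i _.
  rewrite -big_split/= !mulr_sumr -sumrB -big_split/=.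
  apply: (le_trans (ler_norm_sum _ _ _)); apply: ler_sum => j _.
  rewrite fco_diff2_density -/p -/(r n) -/e.
  move: (fco _ g _) (fco _ e _) => x y.
  have -> : (p * x - r n * y) ^+ 2 - p ^+ 2 * x ^+ 2 = r n ^+ 2 * y ^+ 2 - p * r n * (2 * x * y) by ring.
  have pr : 0 < p * r n by rewrite mulr_gt0.
  apply: (le_trans (ler_normB _ _)); rewrite [X in X + _ <= _]ger0_norm; last by rewrite mulr_ge0 ?sqr_ge0.
  rewrite lerD2l.
  rewrite normrM (gtr0_norm pr) ler_pM2l// ler_norml; apply/andP; split.
    by have := sqr_ge0 (x + y); rewrite sqrrD; lra.
  by have := sqr_ge0 (x - y); rewrite sqrrB; lra.
apply: (le_trans h); apply: lerD.
  by rewrite ler_wpM2l ?sqr_ge0// D_le// => N; exact: eK.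
have pr : 0 <= p * r n by rewrite ltW// mulr_gt0.
rewrite ler_wpM2l// (_ : 4 * K = 2 * K + 2 * K); last by ring.
by rewrite lerD// D_le// => N; exact: eK.
Unshelve. all: end_near. Qed.

(** The leading term of the variance of each rescaled difference is exactly the centring constant.
    The rest is lambda times the integral of [gerr], which is O(1/A) = O(lambda). *)
Lemma bias_cvg0 (lambda : nat -> R) : (forall n, (0 < n)%N -> 0 < lambda n) ->
  Num.sqrt n%:R * lambda n ^+ 2 @[n --> \oo] --> (0 : R) ->
  Num.sqrt n%:R * ((2 * pi) ^- d * fco rho (G (lambda n)) 0 - t / theta * C_spE beta rho)
    @[n --> \oo] --> (0 : R).
Proof.
move=> l0 lcvg; have [C C0 hC] := gerr_bias beta_gt0 beta_lt2 beta_ltd rho1.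
have sth : 0 < Num.sqrt theta by rewrite sqrtr_gt0.
have pi0 : 0 < (2 * pi) ^- d :> R by rewrite invr_gt0 exprn_gt0// mulr_gt0// pi_gt0.
pose c := (2 * pi) ^- d * kappa * (C / (2 * t * Num.sqrt theta)).
apply: (@cvg0_le _ _ (fun n => c * (Num.sqrt n%:R * lambda n ^+ 2))); last first.
  by rewrite -[X in _ --> X](mulr0 c); apply: cvgM => //; exact: cvg_cst.
near=> n; have n0 : (0 < n)%N by near: n; exact: nbhs_infty_gt.
have l0n := l0 n n0.
rewrite C_spE_fco fco_diff2_density.
rewrite (_ : _ - t / theta * _ = - ((2 * pi) ^- d * (lambda n * kappa) * fco rho (gerr beta rho (A (lambda n))) 0)); last by ring.
have kap0 : 0 < kappa by rewrite divr_gt0// mulr_gt0// sqrtr_gt0.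
rewrite fco0 mulrN normrN 2!normrM (ger0_norm (sqrtr_ge0 _)) gtr0_norm; last exact: (mulr_gt0 pi0 (mulr_gt0 l0n kap0)).
have A0 : 0 < A (lambda n) by rewrite divr_gt0// !mulr_gt0.
have -> : c * (Num.sqrt n%:R * lambda n ^+ 2) =
    Num.sqrt n%:R * ((2 * pi) ^- d * (lambda n * kappa) * (C / A (lambda n))).
  rewrite /c; move: (_ ^- d) (Num.sqrt n%:R) => x y; field.
  by rewrite !gt_eqF.
apply: ler_wpM2l; first exact: sqrtr_ge0.
apply: ler_wpM2l; last exact: hC.
exact: ltW (mulr_gt0 pi0 (mulr_gt0 l0n kap0)).
Unshelve. all: end_near. Qed.

Context {dO : measure_display} {Omega : measurableType dO}
  (P : probability Omega R) (u : R -> 'rV[R]_d -> {RV P >-> R}).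
Hypothesis u_sol : is_wave_solution theta beta u.
Variable lambda : nat -> R.
Hypothesis lambda_gt0 : forall n, (0 < n)%N -> 0 < lambda n.
Hypothesis lambda_o : lambda =o_\oo (fun n => n%:R `^ (- 4^-1)).

(** The statistic equals the normalized centred sum of squares of the rescaled differences plus the
    bias b n, so [gaussian_sqr_clt] applies once the covariance bounds and limits are supplied. *)
Lemma V_sp_clt : cvg_in_distribution P
    (fun n w => Num.sqrt n%:R *
       (lambda n `^ (beta - 2) / n%:R * V_sp (fun s x => u s x) t rho (lambda n) n w
        - t / theta * C_spE beta rho))
    (gaussian_law 0 (t ^+ 2 / theta ^+ 2 * C_spV beta rho)).
Proof.
pose J n (k : 'I_n) := rescaled_diff2 beta t rho u (lambda n) k.
pose b n := Num.sqrt n%:R * ((2 * pi) ^- d * fco rho (G (lambda n)) 0 - t / theta * C_spE beta rho).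
have pi0 : 0 < (2 * pi) ^- d :> R by rewrite invr_gt0 exprn_gt0// mulr_gt0// pi_gt0.
have covE n (i j : 'I_n) : (0 < n)%N ->
    cov P (J n) i j = (2 * pi) ^- d * fco rho (G (lambda n)) (i%:R - j%:R).
  by move=> n0; exact: (rescaled_diff2_cov beta_gt0 beta_lt2 beta_ltd theta_gt0 t_gt0 _ u_sol _ _ (lambda_gt0 n0)).
rewrite (_ : (fun n w => _) = (fun n w => normalized_sqr P (J n) w + b n)); last first.
  apply/funext => n; apply/funext => w.
  (* At n = 0 both sides vanish, as sqrt 0 = 0 and division by 0 gives 0; nothing is assumed about
     the sign of [lambda 0]. *)
  have [->|n0] := posnP n.
    by rewrite /b /normalized_sqr sqrtr0 invr0 !mul0r mulr0 addr0.
  have nR : 0 < n%:R :> R by rewrite ltr0n.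
  have sn : 0 < Num.sqrt n%:R :> R by rewrite sqrtr_gt0.
  rewrite /normalized_sqr /centred_sqr.
  rewrite (_ : \sum_i cov P (J n) i i = n%:R * ((2 * pi) ^- d * fco rho (G (lambda n)) 0)); last first.
    under eq_bigr => i _ do rewrite covE// subrr.
    by rewrite sumr_const card_ord [RHS]mulr_natl.
  rewrite (_ : \sum_i J n i w ^+ 2 = lambda n `^ (beta - 2) * V_sp (fun s x => u s x) t rho (lambda n) n w); last first.
    rewrite /V_sp big_add1 big_mkord mulr_sumr; apply: eq_bigr => i _.
    by rewrite /J /rescaled_diff2 exprMn powR_exprn divfK.
  have nE : n%:R = Num.sqrt n%:R ^+ 2 :> R by rewrite sqr_sqrtr// ltW.
  rewrite /b; move: (Num.sqrt n%:R) nE sn => s -> s0.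
  have p0 : (2 * pi) ^+ d != 0 :> R by rewrite -invr_eq0 gt_eqF.
  by field; rewrite p0 !gt_eqF.
have [M0 M0_ge0 hM0] := spectral_bound beta_gt0 beta_lt2 beta_ltd rho1.
pose M := M0 + 1; have M_gt0 : 0 < M by rewrite ltr_wpDl.
have hM N (c : 'I_N -> R) : (\int[leb]_w (tsum c (dotp rho w) * majH beta w)%:E <=
    (M * \sum_k c k ^+ 2)%:E)%E.
  apply: (le_trans (hM0 N c)); rewrite lee_fin ler_wpM2r ?lerDl//.
  by apply: sumr_ge0 => k _; rewrite sqr_ge0.
have bnd := fco_bound beta_gt0 beta_lt2 beta_ltd rho1 M_gt0 hM.
pose C1 := 16 * t / theta * CH.
have C1_ge0 : 0 <= C1 by rewrite mulr_ge0// ltW// divr_gt0// mulr_gt0.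
(* The operator norm bound for the Toeplitz matrix of [diff2_density], with 1 added for strict
   positivity. *)
apply: (gaussian_sqr_clt (C := (2 * pi) ^- d * (C1 * M) + 1)).
- by move=> n k; exact: measurable_rescaled_diff2.
- by move=> n a; exact: (rescaled_diff2_gaussian t_gt0 rho u_sol).
- by move=> n k; exact: (rescaled_diff2_mean t_gt0 rho u_sol).
- by rewrite ltr_wpDl// mulr_ge0 ?(ltW pi0)// mulr_ge0 ?(ltW M_gt0).
- move=> n a n0.
  have [hQ _] := bnd _ _ C1_ge0 (measurable_diff2_density theta beta t rho (lambda n))
    (fun w => diff2_density_le beta_gt0 beta_lt2 beta_ltd theta_gt0 t_gt0 rho1 w (lambda_gt0 n0)).
  apply: (@le_trans _ _ ((2 * pi) ^- d * (C1 * M * \sum_k a k ^+ 2))).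
    apply: (le_trans _ (ler_wpM2l (ltW pi0) (hQ n a))).
    rewrite le_eqVlt; apply/orP; left; apply/eqP; rewrite /bil mulr_sumr.
    apply: eq_bigr => i _; rewrite mulr_sumr; apply: eq_bigr => j _.
    by rewrite covE// mulrCA.
  rewrite [leRHS]mulrDl mul1r -[X in _ <= X + _]mulrA lerDl; apply: sumr_ge0 => k _; exact: sqr_ge0.
(* The constants agree because 2 (8t/theta)^2 = 128 t^2/theta^2. *)
- rewrite (_ : t ^+ 2 / theta ^+ 2 * C_spV beta rho = 2 * ((2 * pi) ^- d) ^+ 2 *
     ((8 * t / theta) ^+ 2 * fine (\esum_(z in [set: int]) (fco rho g z%:~R ^+ 2)%:E)%E)); last first.
    rewrite C_spV_fco mulnC exprM; set F := fine _.
    have p0 : (2 * pi) ^+ d != 0 :> R by rewrite expf_neq0// mulf_neq0// gt_eqF// pi_gt0.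
    move: (_ ^+ d) p0 => x x0; field.
    by rewrite x0 gt_eqF.
  have := toeplitz_diff2_density_cvg lambda_gt0 (mesh_cvg0 lambda_gt0 lambda_o).
  move=> /(cvgM (cvg_cst (2 * ((2 * pi) ^- d) ^+ 2))).
  apply: cvg_trans; apply: near_eq_cvg; near=> n.
  have n0 : (0 < n)%N by near: n; exact: nbhs_infty_gt.
  rewrite /= [RHS](_ : _ = 2 / n%:R * (((2 * pi) ^- d) ^+ 2 *
    \sum_(i < n) \sum_(j < n) fco rho (G (lambda n)) (i%:R - j%:R) ^+ 2)); first by ring.
  congr (_ * _); rewrite mulr_sumr; apply: eq_bigr => i _; rewrite mulr_sumr.
  by apply: eq_bigr => j _; rewrite covE// exprMn.
- exact: (bias_cvg0 lambda_gt0 (sqrt_mesh_cvg0 lambda_gt0 lambda_o)).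
Unshelve. all: end_near. Qed.

End assembly.

Theorem corollary3p11 (R : realType) (d : nat) (beta theta : R)
    (beta_gt0 : 0 < beta) (beta_lt : beta < Num.min 2 d%:R)
    (theta_gt0 : 0 < theta)
    (dO : measure_display) (Omega : measurableType dO)
    (P : probability Omega R) (u : R -> 'rV[R]_d -> {RV P >-> R})
    (u_sol : is_wave_solution theta beta u)
    (t : R) (t_gt0 : 0 < t) (rho : 'rV[R]_d) (rho1 : enorm rho = 1)
    (lambda : nat -> R) (lambda_gt0 : forall n, (0 < n)%N -> 0 < lambda n)
    (lambda_o : lambda =o_\oo (fun n => n%:R `^ (- 4^-1))) :
  cvg_in_distribution P
    (fun n w => Num.sqrt n%:R *
       (lambda n `^ (beta - 2) / n%:R * V_sp (fun s x => u s x) t rho (lambda n) n w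
        - t / theta * C_spE beta rho))
    (gaussian_law 0 (t ^+ 2 / theta ^+ 2 * C_spV beta rho)).
Proof.
move: beta_lt; rewrite lt_min => /andP[beta_lt2 beta_ltd].
exact: V_sp_clt.
Qed.
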